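(* Let $a\in\mathbb{C}$, $1<p<\infty$, $r_0>0$, and assume that $\alpha>\max(0,p-2)$. Consider, for $\varepsilon\in\,]0,1]$, the mixed problem for $v^\varepsilon=(v^\varepsilon_-,v^\varepsilon_+)$ on $t\ge 0$, $r\ge 0$: $$\left\{\begin{aligned} &(\partial_t\pm\partial_r)v^\varepsilon_\pm=\varepsilon^\alpha r^{1-p}g(v^\varepsilon_-+v^\varepsilon_+),\qquad g(y):=-a\,2^{-p}|y|^{p-1}y,\\ &(v^\varepsilon_-+v^\varepsilon_+)\big|_{r=0}=0,\\ &v^\varepsilon_\mp\big|_{t=0}=P_\mp\Big(r,\frac{r-r_0}{\varepsilon}\Big)\pm\varepsilon P_1\Big(r,\frac{r-r_0}{\varepsilon}\Big), \end{aligned}\right.\qquad(\ast)$$ and let $(v^\varepsilon_\pm)_{\rm free}$ be the solution of the linear problem $$(\partial_t\pm\partial_r)(v^\varepsilon_\pm)_{\rm free}=0,\qquad \big((v^\varepsilon_-)_{\rm free}+(v^\varepsilon_+)_{\rm free}\big)\big|_{r=0}=0,\qquad (v^\varepsilon_\mp)_{\rm free}\big|_{t=0}=P_\mp\Big(r,\frac{r-r_0}{\varepsilon}\Big).$$ (i) If $\alpha>p-2>0$, then there exists $\varepsilon_0>0$ such that for any $\varepsilon\in\,]0,\varepsilon_0]$, $(\ast)$ has a unique global solution $v^\varepsilon\in C^1([0,\infty[\times\mathbb{R}_+)$. Moreover, as $\varepsilon\to0$, the following asymptotics hold in $L^\infty(\mathbb{R}_+\times\mathbb{R}_+)$: $$v^\varepsilon_\pm=(v^\varepsilon_\pm)_{\rm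 free}+O\big(\varepsilon^{\min(1,\alpha+2-p)}\big),\qquad \varepsilon\partial_tv^\varepsilon_\pm=\varepsilon\partial_t(v^\varepsilon_\pm)_{\rm free}+O\big(\varepsilon^{\min(1,\alpha+2-p)}\big).$$ (ii) If $\alpha>0$ and $1<p\le2$, let $T>0$. Then there exists $\varepsilon(T)>0$ such that for any $\varepsilon\in\,]0,\varepsilon(T)]$, $(\ast)$ has a unique solution $v^\varepsilon\in C^1([0,T]\times\mathbb{R}_+)$. Moreover, as $\varepsilon\to0$, the following asymptotics hold in $L^\infty([0,T]\times\mathbb{R}_+)$: if $1<p<2$, $$v^\varepsilon_\pm=(v^\varepsilon_\pm)_{\rm free}+O\big(\varepsilon^{\min(1,\alpha)}\big),\qquad \varepsilon\partial_tv^\varepsilon_\pm=\varepsilon\partial_t(v^\varepsilon_\pm)_{\rm free}+O\big(\varepsilon^{\min(1,\alpha)}\big),$$ and if $p=2$, $$v^\varepsilon_\pm=(v^\varepsilon_\pm)_{\rm free}+O\big(\varepsilon+\varepsilon^\alpha|\log\varepsilon|\big),\qquad \varepsilon\partial_tv^\varepsilon_\pm=\varepsilon\partial_t(v^\varepsilon_\pm)_{\rm free}+O\big(\varepsilon+\varepsilon^\alpha|\log\varepsilon|\big).$$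
   Context: $\mathbb{R}_+=[0,\infty[$. The functions $U_0(r,z)$ and $U_1(r,z)$, $r\ge0$, $z\in\mathbb{R}$, are real-valued, infinitely differentiable and bounded, and there is $z_0>0$ such that $\operatorname{supp}U_j(r,\cdot)\subset[-z_0,z_0]$ for all $r\ge0$ and $j=0,1$. Define $$P_\mp(r,z):=rU_1(r,z)\pm r\,\partial_zU_0(r,z),\qquad P_1(r,z):=U_0(r,z)+r\,\partial_rU_0(r,z).$$ In formulas with $\pm$ or $\mp$, upper signs go together and lower signs go together. The parameter $\varepsilon$ lies in $]0,1]$ and $\varepsilon\to0$; for $\varepsilon$ small the initial data are supported in $\{|r-r_0|\le z_0\varepsilon\}$, away from $r=0$. Explicitly (with the profiles $P_\pm(r,z)$ extended by $0$ to $r<0$), $$(v_-^\varepsilon)_{\rm free}(t,r)=P_-\Big(r+t,\frac{r+t-r_0}{\varepsilon}\Big),\qquad (v_+^\varepsilon)_{\rm free}(t,r)=P_+\Big(r-t,\frac{r-t-r_0}{\varepsilon}\Big)-P_-\Big(t-r,\frac{t-r-r_0}{\varepsilon}\Big).$$ Origin of the system: if $u^\varepsilon(t,|x|)$ is the spherically symmetric solution on $\mathbb{R}^{1+3}$ of $(\partial_t^2-\Delta_x)u^\varepsilon+a\,\varepsilon^\alpha|\partial_tu^\varepsilon|^{p-1}\partial_tu^\varepsilon=0$ with $u^\varepsilon|_{t=0}=\varepsilon U_0(r,\frac{r-r_0}{\varepsilon})$, $\partial_tu^\varepsilon|_{t=0}=U_1(r,\frac{r-r_0}{\varepsilon})$,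 then $v^\varepsilon_\mp=(\partial_t\pm\partial_r)(ru^\varepsilon)$. ''$f^\varepsilon=h^\varepsilon+O(\eta(\varepsilon))$ in $L^\infty(\Omega)$'' means that there are a constant $C$ independent of $\varepsilon$ (allowed to depend on $T$ in (ii)) such that $\|f^\varepsilon-h^\varepsilon\|_{L^\infty(\Omega)}\le C\eta(\varepsilon)$ for all sufficiently small $\varepsilon>0$. *)

(* Defs.v *)
From Stdlib Require Import Reals.
From Coquelicot Require Export Coquelicot.
Open Scope R_scope.

(** [C] as a normed space over the reals (the default structure is over [C]). *)
Notation CR := C_R_CompleteNormedModule.

(** Calculus on a subset [D] of the plane.  Derivatives at a point of [D] are
    taken along [D], hence one-sided at boundary points; the values of a function
    outside [D] are irrelevant. *)

Definition is_partial1 {V : CompleteNormedModule R_AbsRing} (D : R * R -> Prop)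
    (f : R * R -> V) (q : R * R) (l : V) : Prop :=
  filterdiff (fun s : R => f (s, snd q))
    (within (fun s : R => D (s, snd q)) (locally (fst q)))
    (fun h : R => scal h l).

Definition is_partial2 {V : CompleteNormedModule R_AbsRing} (D : R * R -> Prop)
    (f : R * R -> V) (q : R * R) (l : V) : Prop :=
  filterdiff (fun s : R => f (fst q, s))
    (within (fun s : R => D (fst q, s)) (locally (snd q)))
    (fun h : R => scal h l).

Definition partial1 {V : CompleteNormedModule R_AbsRing} (D : R * R -> Prop)
    (f : R * R -> V) (q : R * R) : V := iota (is_partial1 D f q).

Definition partial2 {V : CompleteNormedModule R_AbsRing} (D : R * R -> Prop)
    (f : R * R -> V) (q : R * R) : V := iota (is_partial2 D f q).

Fixpoint Ck_on {V : CompleteNormedModule R_AbsRing} (k : nat) (D : R * R -> Prop)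
    (f : R * R -> V) : Prop :=
  continuous_on (T := prod_UniformSpace R_UniformSpace R_UniformSpace) D f /\
  match k with
  | O => True
  | S k' =>
      (forall q, D q -> exists l, is_partial1 D f q l) /\
      (forall q, D q -> exists l, is_partial2 D f q l) /\
      Ck_on k' D (partial1 D f) /\ Ck_on k' D (partial2 D f)
  end.

Definition smooth_on {V : CompleteNormedModule R_AbsRing} (D : R * R -> Prop)
    (f : R * R -> V) : Prop := forall k, Ck_on k D f.

(** Profiles: functions of [(r, z)] on [r >= 0]. *)

Definition half_plane (q : R * R) : Prop := 0 <= fst q.

Definition admissible_profile (z0 : R) (U : R * R -> R) : Prop :=
  smooth_on (V := R_CompleteNormedModule) half_plane U /\
  (exists M, forall q, half_plane q -> Rabs (U q) <= M) /\
  (forall r z, 0 <= r -> z0 < Rabs z -> U (r, z) = 0).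

(** Extension by [0] to [r < 0]. *)
Definition ext0 (f : R * R -> R) (q : R * R) : R :=
  if Rle_dec 0 (fst q) then f q else 0.

Definition P_minus (U0 U1 : R * R -> R) : R * R -> R :=
  ext0 (fun q => fst q * U1 q
    + fst q * partial2 (V := R_CompleteNormedModule) half_plane U0 q).

Definition P_plus (U0 U1 : R * R -> R) : R * R -> R :=
  ext0 (fun q => fst q * U1 q
    - fst q * partial2 (V := R_CompleteNormedModule) half_plane U0 q).

Definition P_1 (U0 : R * R -> R) (q : R * R) : R :=
  U0 q + fst q * partial1 (V := R_CompleteNormedModule) half_plane U0 q.

(** Space-time domain of [(t, r)]: [0, T] x [0, oo[, and [0, oo[ x [0, oo[ when
    [T = p_infty]. *)
Definition slab (T : Rbar) (q : R * R) : Prop :=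
  0 <= fst q /\ Rbar_le (fst q) T /\ 0 <= snd q.

(** [v = (vm, vp)] is a C^1 solution on [slab T], up to its boundary, of
    [(d_t + d_r) vp = F r (vm + vp)], [(d_t - d_r) vm = F r (vm + vp)],
    with [vm + vp = 0] at [r = 0] and [vm = bm], [vp = bp] at [t = 0].  The
    equations are required for [r > 0], where the coefficient [r^(1-p)] of
    [source] makes sense; by continuity this determines them at [r = 0]. *)
Definition is_solution (T : Rbar) (F : R -> C -> C) (bm bp : R -> C)
    (vm vp : R * R -> C) : Prop :=
  Ck_on (V := CR) 1 (slab T) vm /\
  Ck_on (V := CR) 1 (slab T) vp /\
  (forall t r, slab T (t, r) -> 0 < r ->
     Cplus (partial1 (V := CR) (slab T) vp (t, r))
           (partial2 (V := CR) (slab T) vp (t, r))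
       = F r (Cplus (vm (t, r)) (vp (t, r))) /\
     Cminus (partial1 (V := CR) (slab T) vm (t, r))
            (partial2 (V := CR) (slab T) vm (t, r))
       = F r (Cplus (vm (t, r)) (vp (t, r)))) /\
  (forall t, slab T (t, 0) -> Cplus (vm (t, 0)) (vp (t, 0)) = RtoC 0) /\
  (forall r, 0 <= r -> vm (0, r) = bm r /\ vp (0, r) = bp r).

Definition is_unique_solution (T : Rbar) (F : R -> C -> C) (bm bp : R -> C)
    (vm vp : R * R -> C) : Prop :=
  is_solution T F bm bp vm vp /\
  forall wm wp, is_solution T F bm bp wm wp ->
    forall q, slab T q -> wm q = vm q /\ wp q = vp q.

(** [g y = - a 2^(-p) |y|^(p-1) y].  [Rpower 0 _] is a junk value, here
    multiplied by [y = 0], so that [g 0 = 0]. *)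
Definition g (a : C) (p : R) (y : C) : C :=
  Cmult (Cmult (Copp a) (RtoC (Rpower 2 (- p))))
        (Cmult (RtoC (Rpower (Cmod y) (p - 1))) y).

Definition source (a : C) (p alpha eps r : R) (y : C) : C :=
  Cmult (RtoC (Rpower eps alpha * Rpower r (1 - p))) (g a p y).

Definition data_minus (U0 U1 : R * R -> R) (r0 eps r : R) : C :=
  RtoC (P_minus U0 U1 (r, (r - r0) / eps) + eps * P_1 U0 (r, (r - r0) / eps)).

Definition data_plus (U0 U1 : R * R -> R) (r0 eps r : R) : C :=
  RtoC (P_plus U0 U1 (r, (r - r0) / eps) - eps * P_1 U0 (r, (r - r0) / eps)).

Definition is_unique_nonlinear_solution (T : Rbar) (a : C) (p alpha r0 : R)
    (U0 U1 : R * R -> R) (eps : R) (vm vp : R * R -> C) : Prop :=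
  is_unique_solution T (source a p alpha eps)
    (data_minus U0 U1 r0 eps) (data_plus U0 U1 r0 eps) vm vp.

Definition is_unique_free_solution (T : Rbar) (r0 : R)
    (U0 U1 : R * R -> R) (eps : R) (vm vp : R * R -> C) : Prop :=
  is_unique_solution T (fun _ _ => RtoC 0)
    (fun r => RtoC (P_minus U0 U1 (r, (r - r0) / eps)))
    (fun r => RtoC (P_plus U0 U1 (r, (r - r0) / eps))) vm vp.

Definition free_minus (U0 U1 : R * R -> R) (r0 eps : R) (q : R * R) : C :=
  let (t, r) := q in RtoC (P_minus U0 U1 (r + t, (r + t - r0) / eps)).

Definition free_plus (U0 U1 : R * R -> R) (r0 eps : R) (q : R * R) : C :=
  let (t, r) := q in
  RtoC (P_plus U0 U1 (r - t, (r - t - r0) / eps)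
        - P_minus U0 U1 (t - r, (t - r - r0) / eps)).

(** [f = h + O(eta)] in L^oo([slab T]) as [eps -> 0+].  It is only used for
    functions continuous on [slab T], whose L^oo norm is their supremum. *)
Definition bigO_Linf (T : Rbar) (f h : R -> R * R -> C) (eta : R -> R) : Prop :=
  exists K : R, at_right 0 (fun eps =>
    forall q, slab T q -> Cmod (Cminus (f eps q) (h eps q)) <= K * eta eps).

Definition eps_dt (T : Rbar) (f : R -> R * R -> C) (eps : R) (q : R * R) : C :=
  Cmult (RtoC eps) (partial1 (V := CR) (slab T) (f eps) q).

Definition C1_asymptotics (T : Rbar) (f h : R -> R * R -> C) (eta : R -> R) : Prop :=
  bigO_Linf T f h eta /\ bigO_Linf T (eps_dt T f) (eps_dt T h) eta.

(* Main.v *)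
(* Reflecting the outgoing component across the axis, w(t,s) = v_-(t,s) for s >= 0 and
   w(t,s) = - v_+(t,-s) for s <= 0, turns the mixed problem into one nonlocal transport
   equation on the whole line; in the characteristic coordinate x = s + t it is the ODE
     d_t W(t,x) = lam(t) |x - t|^(1-p) f(W(t,x) - W(t,2t-x)),   f(y) = |y|^(p-1) y,
   with W(0,.) = b, where b = O(1) and b' = O(1/eps).  If |W| <= 2M and |W_x| <= 2M/eps, the
   jump W(t,x) - W(t,2t-x) is O(min(1, |s|/eps)) with s = x - t, so that the right-hand side
   and its Lipschitz constants are controlled by (|s| + eps)^(1-p), whose integral J along a
   characteristic is O(eps^(2-p)), O(|log eps|) or O(1) for p > 2, p = 2, p < 2.  Since
   eps^alpha J is small, the Picard iteration contracts in the sup norm over the whole time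
   interval, and eps^alpha J is also the size of W - b and eps (W_x - b').
   For p < 2 the derivative of f is only Hoelder continuous, so the iteration does not
   contract in C^1.  The derivative of the fixed point is obtained by comparing its difference
   quotients: they satisfy the linearised equation up to a small error, except on a short time
   interval around the crossing of s = 0, so the same contraction makes them uniformly Cauchy.
   Uniqueness needs no smallness: on a backward cone the sum of the components is O(r), hence
   the source is Lipschitz there, and the difference of two solutions is at most
   B (2 K t)^n / n! for every n. *)
Require Import Defs.
From Stdlib Require Import Reals Lra Lia Factorial ClassicalEpsilon.
From Coquelicot Require Import Coquelicot.
Open Scope R_scope.

(** * Complex-valued calculus along subsets of the line and the plane *)

(** For p >= 2 the weight |s|^(1-p) is not integrable at s = 0, so sup bounds on W could never close
    the iteration: the Lipschitz bound in x has to be carried along, because it alone makes the jump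
    small near the crossing. The iteration therefore runs in a class of bounded Lipschitz functions,
    which is closed under pointwise limits, and C^1 regularity is left to a separate argument. W is
    defined for all real t and x, negative times included, so all its derivatives are two-sided;
    one-sided derivatives appear only when W is restricted to the slab. No compatibility condition
    at the corner t = r = 0 remains to be checked: the two components are traces of one C^1 function
    of the plane on the two sides of x = t. What this needs is that b is C^1 across 0, and it is,
    because for small eps the data vanish near r = 0. The amplitude M of the data is fixed before
    eps, so that all constants depending on it are uniform in eps. *)

Lemma norm_CR (z : C) : norm (V := CR) z = Cmod z.
Proof.
  unfold norm; simpl; unfold prod_norm, Cmod; simpl; unfold norm; simpl.
  unfold abs; simpl. f_equal.
  rewrite !Rmult_1_r, <- !Rabs_mult, !Rabs_right; try reflexivity; nra.
Qed.

Lemma scal_CR (r : R) (z : C) : scal (V := CR) r z = Cmult (RtoC r) z.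
Proof.
  destruct z as [x y]; unfold Cmult, RtoC; simpl.
  change (scal (V := CR) r (x, y)) with (r * x, r * y). f_equal; ring.
Qed.

Lemma minus_CR (z w : C) : minus (G := CR) z w = Cminus z w.
Proof. reflexivity. Qed.

Lemma Cmod_minus_sym (z w : C) : Cmod (Cminus z w) = Cmod (Cminus w z).
Proof. rewrite <- Cmod_opp. f_equal. ring. Qed.

Lemma Cmod_minus_le (z w : C) : Cmod (Cminus z w) <= Cmod z + Cmod w.
Proof.
  unfold Cminus. eapply Rle_trans. apply Cmod_triangle. rewrite Cmod_opp. lra.
Qed.

Lemma Cmod_minus_triangle (z w u : C) :
  Cmod (Cminus z u) <= Cmod (Cminus z w) + Cmod (Cminus w u).
Proof.
  replace (Cminus z u) with (Cplus (Cminus z w) (Cminus w u)) by ring.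
  apply Cmod_triangle.
Qed.

Lemma Cmod_scal (r : R) (z : C) : Cmod (Cmult (RtoC r) z) = Rabs r * Cmod z.
Proof. now rewrite Cmod_mult, Cmod_R. Qed.

Lemma Cmod_minus_abs (z w : C) : Rabs (Cmod z - Cmod w) <= Cmod (Cminus z w).
Proof.
  apply Rabs_le; split.
  - assert (H := Cmod_triangle (Cminus w z) z).
    replace (Cplus (Cminus w z) z) with w in H by ring.
    rewrite Cmod_minus_sym in H. lra.
  - assert (H := Cmod_triangle (Cminus z w) w).
    replace (Cplus (Cminus z w) w) with z in H by ring. lra.
Qed.

(** The Euclidean inner product of the plane underlying [C]. Pairing with a fixed vector turns
    complex-valued statements into real ones, to which the real mean value theorem applies. *)
Definition Cdot (z w : C) : R := fst z * fst w + snd z * snd w.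

Lemma Cmod_sqr (z : C) : Cmod z * Cmod z = Cdot z z.
Proof.
  unfold Cmod, Cdot. rewrite sqrt_sqrt; [ring|nra].
Qed.

Lemma Cdot_le (z w : C) : Rabs (Cdot z w) <= Cmod z * Cmod w.
Proof.
  rewrite <- (Rabs_pos_eq (Cmod z * Cmod w))
    by (apply Rmult_le_pos; apply Cmod_ge_0).
  apply Rsqr_le_abs_0. unfold Rsqr.
  replace (Cmod z * Cmod w * (Cmod z * Cmod w))
    with ((Cmod z * Cmod z) * (Cmod w * Cmod w)) by ring.
  rewrite !Cmod_sqr. unfold Cdot.
  assert (0 <= Rsqr (fst z * snd w - snd z * fst w)) by apply Rle_0_sqr.
  unfold Rsqr in H. nra.
Qed.

(** Here and in the next two definitions, [full] or [full2] as [D] gives the ordinary two-sided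
    notion, while a slice of the slab gives one that is one-sided at its boundary. *)
Definition cont_in (D : R -> Prop) (f : R -> C) (x : R) : Prop :=
  forall e, 0 < e -> exists d, 0 < d /\
    forall y, D y -> Rabs (y - x) < d -> Cmod (Cminus (f y) (f x)) < e.

Definition der_in (D : R -> Prop) (f : R -> C) (x : R) (l : C) : Prop :=
  forall e, 0 < e -> exists d, 0 < d /\
    forall y, D y -> Rabs (y - x) < d ->
      Cmod (Cminus (Cminus (f y) (f x)) (Cmult (RtoC (y - x)) l)) <= e * Rabs (y - x).

Definition cont2_in (D : R -> R -> Prop) (f : R -> R -> C) (x y : R) : Prop :=
  forall e, 0 < e -> exists d, 0 < d /\
    forall u v, D u v -> Rabs (u - x) < d -> Rabs (v - y) < d ->
      Cmod (Cminus (f u v) (f x y)) < e.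

Notation full := (fun _ : R => True).
Notation full2 := (fun _ _ : R => True).

Lemma der_in_cont (D : R -> Prop) f x l : der_in D f x l -> cont_in D f x.
Proof.
  intros H e He. destruct (H 1 Rlt_0_1) as [d [Hd H1]].
  assert (HL := Cmod_ge_0 l).
  exists (Rmin d (e / (2 + Cmod l))). split.
  - apply Rmin_pos; [lra|]. apply Rdiv_lt_0_compat; lra.
  - intros y Dy Hy. 
    assert (Hy1 := Rlt_le_trans _ _ _ Hy (Rmin_l _ _)).
    assert (Hy2 := Rlt_le_trans _ _ _ Hy (Rmin_r _ _)).
    specialize (H1 y Dy Hy1).
    replace (Cminus (f y) (f x)) with
      (Cplus (Cminus (Cminus (f y) (f x)) (Cmult (RtoC (y - x)) l))
             (Cmult (RtoC (y - x)) l)) by ring.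
    eapply Rle_lt_trans. apply Cmod_triangle. rewrite Cmod_scal.
    apply Rle_lt_trans with ((1 + Cmod l) * Rabs (y - x)); [lra|].
    assert (0 <= Rabs (y - x)) by apply Rabs_pos.
    apply Rle_lt_trans with ((2 + Cmod l) * Rabs (y - x)); [nra|].
    apply Rmult_lt_reg_r with (/ (2 + Cmod l)); [apply Rinv_0_lt_compat; lra|].
    replace ((2 + Cmod l) * Rabs (y - x) * / (2 + Cmod l)) with (Rabs (y - x)) by (field; lra).
    exact Hy2.
Qed.

Lemma der_in_dot (f : R -> C) (x : R) (l e : C) :
  der_in full f x l -> is_derive (fun y => Cdot e (f y)) x (Cdot e l).
Proof.
  intros H. apply is_derive_Reals. intros eps Heps.
  assert (HE := Cmod_ge_0 e).
  assert (Hq : 0 < eps / (2 * (1 + Cmod e))) by (apply Rdiv_lt_0_compat; lra).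
  destruct (H _ Hq) as [d [Hd H1]].
  exists (mkposreal d Hd). intros h Hh0 Hh. simpl in Hh.
  specialize (H1 (x + h) I). replace (x + h - x) with h in H1 by ring.
  specialize (H1 Hh).
  replace ((Cdot e (f (x + h)) - Cdot e (f x)) / h - Cdot e l) with
    (Cdot e (Cminus (Cminus (f (x + h)) (f x)) (Cmult (RtoC h) l)) / h).
  2:{ unfold Cdot, Cminus, Cmult, RtoC; simpl. field. exact Hh0. }
  unfold Rdiv. rewrite Rabs_mult.
  assert (Hh1 : 0 < Rabs h) by (now apply Rabs_pos_lt).
  rewrite Rabs_inv.
  apply Rle_lt_trans with (Cmod e * (eps / (2 * (1 + Cmod e)) * Rabs h) * / Rabs h).
  - apply Rmult_le_compat_r; [left; now apply Rinv_0_lt_compat|].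
    eapply Rle_trans; [apply Cdot_le|].
    now apply Rmult_le_compat_l.
  - replace (Cmod e * (eps / (2 * (1 + Cmod e)) * Rabs h) * / Rabs h)
      with (eps * (Cmod e / (2 * (1 + Cmod e)))) by (field; lra).
    assert (Cmod e / (2 * (1 + Cmod e)) < 1).
    { apply Rmult_lt_reg_r with (2 * (1 + Cmod e)); [lra|].
      unfold Rdiv. rewrite Rmult_assoc, Rinv_l; lra. }
    nra.
Qed.

(* The derivative of [<f b - f a, f>] is at most [|f b - f a| K']. *)
Lemma mean_value_ineq (f f' : R -> C) (K K' : R -> R) (a b : R) :
  a <= b ->
  (forall x, a <= x <= b -> cont_in (fun y => a <= y <= b) f x) ->
  (forall x, a < x < b -> der_in full f x (f' x)) ->
  (forall x, is_derive K x (K' x)) ->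
  (forall x, a < x < b -> Cmod (f' x) <= K' x) ->
  Cmod (Cminus (f b) (f a)) <= K b - K a.
Proof.
  intros Hab Hc Hd HK Hb.
  destruct (Rle_lt_or_eq_dec _ _ Hab) as [Hlt|Heq].
  2:{ subst b. replace (Cminus (f a) (f a)) with (RtoC 0) by ring.
      rewrite Cmod_0. lra. }
  (* The mean value theorem asks for two-sided continuity at the end points, where [f] is only
     continuous from inside. Composing with the projection onto [a, b] repairs this and changes
     nothing in the interior. *)
  set (cl := fun x => Rmax a (Rmin b x)).
  assert (Hcl : forall x, a <= cl x <= b).
  { intros x; unfold cl; split. apply Rmax_l. apply Rmax_lub; auto. apply Rmin_l. }
  assert (Hclid : forall x, a <= x <= b -> cl x = x).
  { intros x Hx; unfold cl. rewrite Rmin_right, Rmax_right; lra. }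
  assert (Hcl1 : forall x y, Rabs (cl x - cl y) <= Rabs (x - y)).
  { intros x y; unfold cl, Rmax, Rmin.
    repeat destruct Rle_dec; unfold Rabs; repeat destruct Rcase_abs; lra. }
  set (e := Cminus (f b) (f a)).
  set (psi := fun x => Cdot e (f (cl x)) - Cmod e * K x).
  assert (HM : exists c, a < c < b /\ psi b - psi a = (Cdot e (f' c) - Cmod e * K' c) * (b - a)).
  { assert (HD : forall c, a < c < b -> derivable_pt_lim psi c (Cdot e (f' c) - Cmod e * K' c)).
    { intros c Hcc. apply is_derive_Reals. unfold psi.
      apply (is_derive_minus (fun x => Cdot e (f (cl x))) (fun x => Cmod e * K x)).
      - apply (is_derive_ext_loc (fun x => Cdot e (f x))).
        + apply (locally_interval _ c a b); simpl; try lra.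
          intros y H1 H2. rewrite Hclid; auto. simpl in *; lra.
        + now apply der_in_dot, Hd.
      - apply (is_derive_scal K c (Cmod e) (K' c)). apply HK. }
    assert (HC : forall c, a <= c <= b -> continuity_pt psi c).
    { intros c Hcc. unfold psi.
      apply continuity_pt_minus.
      2:{ apply continuity_pt_scal.
          apply derivable_continuous_pt. exists (K' c). apply is_derive_Reals, HK. }
      intros eps Heps.
      assert (HE := Cmod_ge_0 e).
      assert (Hq : 0 < eps / (1 + Cmod e)) by (apply Rdiv_lt_0_compat; lra).
      destruct (Hc c Hcc _ Hq) as [d [Hdp H1]].
      exists d. split; auto. intros x [_ Hx]. simpl in *. unfold Rdist in *.
      replace (Cdot e (f (cl x)) - Cdot e (f (cl c)))
        with (Cdot e (Cminus (f (cl x)) (f (cl c))))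
        by (unfold Cdot, Cminus; simpl; ring).
      eapply Rle_lt_trans; [apply Cdot_le|].
      rewrite (Hclid c Hcc).
      assert (H2 : Cmod (Cminus (f (cl x)) (f c)) < eps / (1 + Cmod e)).
      { apply H1; auto. rewrite <- (Hclid c Hcc).
        eapply Rle_lt_trans; [apply Hcl1|exact Hx]. }
      assert (H3 := Cmod_ge_0 (Cminus (f (cl x)) (f c))).
      apply Rle_lt_trans with (Cmod e * (eps / (1 + Cmod e))); [nra|].
      replace (Cmod e * (eps / (1 + Cmod e))) with (eps - eps / (1 + Cmod e)) by (field; lra).
      lra. }
    assert (pr : forall c, a < c < b -> derivable_pt psi c).
    { intros c Hcc. eexists. apply HD; eassumption. }
    destruct (MVT psi id a b pr (fun c _ => derivable_pt_id c) Hlt HC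
                (fun c _ => derivable_continuous_pt _ _ (derivable_pt_id c))) as [c [P HE]].
    exists c. split; auto.
    rewrite (derive_pt_eq_0 _ _ _ (pr c P) (HD c P)) in HE.
    rewrite (derive_pt_eq_0 _ _ _ (derivable_pt_id c) (derivable_pt_lim_id c)) in HE.
    unfold id in HE. lra. }
  destruct HM as [c [Hc1 HM]].
  assert (H1 : Cdot e (f' c) - Cmod e * K' c <= 0).
  { assert (H1 := Cdot_le e (f' c)). assert (H2 := Rle_abs (Cdot e (f' c))).
    assert (H3 := Hb c Hc1). assert (H4 := Cmod_ge_0 e). nra. }
  assert (H2 : psi b <= psi a) by nra.
  unfold psi in H2. rewrite !Hclid in H2 by lra.
  assert (H3 : Cdot e (f b) - Cdot e (f a) = Cmod e * Cmod e).
  { rewrite Cmod_sqr. unfold e, Cdot, Cminus; simpl; ring. }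
  (* The scalar estimate reads |e|^2 <= |e| (K b - K a). If e = 0 one cannot divide, and the claim
     becomes K a <= K b, which follows from [0 <= K']. *)
  destruct (Rle_lt_or_eq_dec _ _ (Cmod_ge_0 e)) as [Hp|Hz].
  - apply Rmult_le_reg_l with (Cmod e); nra.
  - rewrite <- Hz.
    destruct (MVT_cor2 K K' a b Hlt) as [c' [HK1 Hc']].
    { intros. apply is_derive_Reals, HK. }
    assert (0 <= K' c') by (eapply Rle_trans; [apply Cmod_ge_0|apply Hb; auto]).
    nra.
Qed.

(** The mean value inequality for [f] minus the linear map s -> s l. Both end points are free, so
    this is a strict form of differentiability. *)
Lemma mean_value_affine (f f' : R -> C) (l : C) (e x d : R) :
  (forall u, Rabs (u - x) < d -> der_in full f u (f' u)) ->
  (forall u, Rabs (u - x) < d -> Cmod (Cminus (f' u) l) <= e) ->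
  forall u v, Rabs (u - x) < d -> Rabs (v - x) < d ->
    Cmod (Cminus (Cminus (f v) (f u)) (Cmult (RtoC (v - u)) l)) <= e * Rabs (v - u).
Proof.
  intros Hd Hl.
  assert (W : forall u v, u <= v -> Rabs (u - x) < d -> Rabs (v - x) < d ->
    Cmod (Cminus (Cminus (f v) (f u)) (Cmult (RtoC (v - u)) l)) <= e * Rabs (v - u)).
  { intros u v Huv Hu Hv.
    assert (HD : forall y, u <= y <= v -> der_in full
       (fun s => Cminus (f s) (Cmult (RtoC s) l)) y (Cminus (f' y) l)).
    { intros y Hy. assert (Hy' : Rabs (y - x) < d).
      { unfold Rabs in *; repeat destruct Rcase_abs; lra. }
      intros eps Heps. destruct (Hd y Hy' eps Heps) as [dd [Hdd H]].
      exists dd; split; auto. intros z Hz1 Hz. specialize (H z Hz1 Hz).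
      replace (Cminus _ _) with (Cminus (Cminus (f z) (f y)) (Cmult (RtoC (z - y)) (f' y))); auto.
      rewrite RtoC_minus. ring. }
    rewrite (Rabs_right (v - u)) by lra.
    replace (e * (v - u)) with ((fun s => e * s) v - (fun s => e * s) u) by (simpl; ring).
    replace (Cminus _ _) with (Cminus (Cminus (f v) (Cmult (RtoC v) l))
       (Cminus (f u) (Cmult (RtoC u) l))).
    2:{ rewrite RtoC_minus; ring. }
    apply (mean_value_ineq (fun s => Cminus (f s) (Cmult (RtoC s) l))
             (fun s => Cminus (f' s) l) (fun s => e * s) (fun _ => e)); auto.
    - intros y Hy. apply HD in Hy. apply der_in_cont in Hy.
      intros ep Hep. destruct (Hy ep Hep) as [dd [Hdd H]]. exists dd; split; auto.
    - intros; apply HD; lra.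
    - intros y. auto_derive; auto; ring.
    - intros y Hy. apply Hl. unfold Rabs in *; repeat destruct Rcase_abs; lra. }
  intros u v Hu Hv. destruct (Rle_dec u v) as [H|H]; [now apply W|].
  rewrite Rabs_minus_sym, <- Cmod_opp.
  replace (Copp _) with (Cminus (Cminus (f u) (f v)) (Cmult (RtoC (u - v)) l)).
  - apply W; auto; lra.
  - rewrite !RtoC_minus; ring.
Qed.

(** Move from [(x, y)] first in the second variable, where differentiability at the point suffices,
    then in the first, where nearby points occur and continuity of [f1] enters. Only one partial
    derivative has to be continuous. *)
Lemma der_along_line (f f1 : R -> R -> C) (l2 : C) (x y t0 al be r : R) :
  0 < r ->
  (forall u v, Rabs (u - x) < r -> Rabs (v - y) < r ->
     der_in full (fun s => f s v) u (f1 u v)) ->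
  cont2_in full2 f1 x y ->
  der_in full (f x) y l2 ->
  der_in full (fun t => f (x + al * (t - t0)) (y + be * (t - t0))) t0
    (Cplus (Cmult (RtoC al) (f1 x y)) (Cmult (RtoC be) l2)).
Proof.
  intros Hr H1 Hc1 H2 e He.
  set (k := 1 + Rabs al + Rabs be).
  assert (Ha := Rabs_pos al). assert (Hb := Rabs_pos be).
  assert (Hk : 1 <= k) by (unfold k; lra).
  assert (He' : 0 < e / k) by (apply Rdiv_lt_0_compat; lra).
  destruct (Hc1 _ He') as [d1 [Hd1 C1]].
  destruct (H2 _ He') as [d2 [Hd2 C2]].
  set (d := Rmin r (Rmin d1 d2)).
  assert (Hd : 0 < d) by (unfold d; repeat apply Rmin_pos; auto).
  assert (Hdr : d <= r) by apply Rmin_l.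
  assert (Hdd1 : d <= d1) by (eapply Rle_trans; [apply Rmin_r|apply Rmin_l]).
  assert (Hdd2 : d <= d2) by (eapply Rle_trans; [apply Rmin_r|apply Rmin_r]).
  exists (d / k). split; [apply Rdiv_lt_0_compat; lra|].
  intros t _ Ht.
  assert (Ht' : k * Rabs (t - t0) < d).
  { apply Rmult_lt_reg_r with (/ k); [apply Rinv_0_lt_compat; lra|].
    replace (k * Rabs (t - t0) * / k) with (Rabs (t - t0)) by (field; lra). exact Ht. }
  assert (HT := Rabs_pos (t - t0)).
  set (h := t - t0) in *.
  assert (Hx : Rabs (x + al * h - x) < d).
  { replace (x + al * h - x) with (al * h) by ring. rewrite Rabs_mult. unfold k in Ht'. nra. }
  assert (Hy : Rabs (y + be * h - y) < d).
  { replace (y + be * h - y) with (be * h) by ring. rewrite Rabs_mult. unfold k in Ht'. nra. }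
  assert (HA := mean_value_affine (fun s => f s (y + be * h)) (fun s => f1 s (y + be * h))
    (f1 x y) (e / k) x d).
  assert (HA1 : Cmod (Cminus (Cminus (f (x + al * h) (y + be * h)) (f x (y + be * h)))
       (Cmult (RtoC (x + al * h - x)) (f1 x y))) <= e / k * Rabs (x + al * h - x)).
  { apply HA; auto.
    - intros; apply H1; lra.
    - intros. left. apply C1; auto; lra.
    - replace (x - x) with 0 by ring. rewrite Rabs_R0; lra. }
  assert (HB1 := C2 (y + be * h) I ltac:(lra)).
  replace (x + al * h - x) with (al * h) in HA1 by ring.
  replace (y + be * h - y) with (be * h) in HB1 by ring.
  replace (t0 - t0) with 0 by ring. rewrite !Rmult_0_r, !Rplus_0_r.
  replace (Cminus _ _) with
   (Cplus (Cminus (Cminus (f (x + al * h) (y + be * h)) (f x (y + be * h)))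
        (Cmult (RtoC (al * h)) (f1 x y)))
     (Cminus (Cminus (f x (y + be * h)) (f x y)) (Cmult (RtoC (be * h)) l2))).
  2:{ rewrite !RtoC_mult; ring. }
  eapply Rle_trans; [apply Cmod_triangle|].
  rewrite !Rabs_mult in *.
  apply Rle_trans with (e / k * (k * Rabs h)).
  - replace (k * Rabs h) with (Rabs h + Rabs al * Rabs h + Rabs be * Rabs h)
      by (unfold k; ring).
    set (q := e / k) in *. assert (0 <= q * Rabs h) by (apply Rmult_le_pos; lra). lra.
  - right. field. lra.
Qed.

(** * The power nonlinearity *)

(* [x^q] with the value [0] at [x = 0], where [Rpower] returns [1]. *)
Definition rp (q x : R) : R := if Rle_dec x 0 then 0 else Rpower x q.

Lemma rp_0 q : rp q 0 = 0.
Proof. unfold rp. destruct Rle_dec; lra. Qed.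

Lemma rp_pos q x : 0 < x -> rp q x = Rpower x q.
Proof. intros H; unfold rp. destruct Rle_dec; lra. Qed.

Lemma Rpower_gt_0 x q : 0 < Rpower x q.
Proof. apply exp_pos. Qed.

Lemma rp_ge_0 q x : 0 <= rp q x.
Proof. unfold rp. destruct Rle_dec; [lra|]. left; apply Rpower_gt_0. Qed.

Lemma rp_le q x y : 0 <= q -> x <= y -> rp q x <= rp q y.
Proof.
  intros Hq H. unfold rp. repeat destruct Rle_dec; try lra.
  - left; apply Rpower_gt_0.
  - apply Rle_Rpower_l; lra.
Qed.

Lemma rp_mult q x y : 0 <= x -> 0 <= y -> rp q (x * y) = rp q x * rp q y.
Proof.
  intros Hx Hy.
  destruct Hx as [Hx|<-]; [|rewrite Rmult_0_l, !rp_0; ring].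
  destruct Hy as [Hy|<-]; [|rewrite Rmult_0_r, !rp_0; ring].
  rewrite !rp_pos; auto. now rewrite Rpower_mult_distr. nra.
Qed.

Lemma rp_small q e : 0 < q -> 0 < e -> exists d, 0 < d /\ rp q d <= e.
Proof.
  intros Hq He. exists (Rpower e (/ q)). split; [apply Rpower_gt_0|].
  rewrite rp_pos by apply Rpower_gt_0. rewrite Rpower_mult, Rinv_l by lra.
  rewrite Rpower_1; lra.
Qed.

Lemma is_derive_Rpower q x : 0 < x -> is_derive (fun y => Rpower y q) x (q * Rpower x (q - 1)).
Proof. intros H. apply is_derive_Reals. now apply derivable_pt_lim_power. Qed.

Lemma Rpower_mvt q x y : 0 < x -> x <= y -> exists c, x <= c <= y /\
  Rpower y q - Rpower x q = q * Rpower c (q - 1) * (y - x).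
Proof.
  intros Hx [H| <-].
  - destruct (MVT_cor2 (fun z => Rpower z q) (fun z => q * Rpower z (q - 1)) x y H) as [c [H1 H2]].
    + intros c Hc. apply derivable_pt_lim_power; lra.
    + exists c; split; [lra|auto].
  - exists x. split; [lra|ring].
Qed.

Lemma Rpower_pred x q : 0 < x -> Rpower x (q - 1) * x = Rpower x q.
Proof.
  intros H. rewrite <- (Rpower_1 x) at 2; auto. rewrite <- Rpower_plus. f_equal; ring.
Qed.

(** The difference is q c^(q-1) (y - x) for some c in [x, y], and the factor x <= c raises the
    exponent to q. Multiplying by [x] keeps the estimate valid for q < 1, where the derivative of
    the power is unbounded at 0. *)
Lemma rp_diff q x y : 0 < q -> 0 <= x -> x <= y ->
  (rp q y - rp q x) * x <= q * rp q y * (y - x).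
Proof.
  intros Hq Hx Hxy. assert (H0 := rp_ge_0 q y).
  destruct Hx as [Hx|<-].
  2:{ rewrite Rmult_0_r. apply Rmult_le_pos; nra. }
  rewrite !rp_pos by lra.
  destruct (Rpower_mvt q x y Hx Hxy) as [c [Hc ->]].
  assert (H1 : Rpower c (q - 1) * x <= Rpower y q).
  { apply Rle_trans with (Rpower c (q - 1) * c).
    - apply Rmult_le_compat_l; [left; apply Rpower_gt_0|lra].
    - rewrite Rpower_pred by lra. apply Rle_Rpower_l; lra. }
  replace (q * Rpower c (q - 1) * (y - x) * x) with (q * (y - x) * (Rpower c (q - 1) * x)) by ring.
  replace (q * Rpower y q * (y - x)) with (q * (y - x) * Rpower y q) by ring.
  apply Rmult_le_compat_l; auto. apply Rmult_le_pos; lra.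
Qed.

Definition pw (p : R) (y : C) : C := Cmult (RtoC (Rpower (Cmod y) (p - 1))) y.

Lemma pw_rp p y : pw p y = Cmult (RtoC (rp (p - 1) (Cmod y))) y.
Proof.
  unfold pw. destruct (Rle_lt_or_eq_dec _ _ (Cmod_ge_0 y)) as [H|H].
  - now rewrite rp_pos.
  - symmetry in H. apply Cmod_eq_0 in H. subst y. ring.
Qed.

Lemma pw_0 p : pw p (RtoC 0) = RtoC 0.
Proof. unfold pw. ring. Qed.

Lemma pw_opp p y : pw p (Copp y) = Copp (pw p y).
Proof. unfold pw. rewrite Cmod_opp. ring. Qed.

Lemma Cmod_pw p y : Cmod (pw p y) = rp (p - 1) (Cmod y) * Cmod y.
Proof. rewrite pw_rp, Cmod_scal, Rabs_pos_eq; auto. apply rp_ge_0. Qed.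

Lemma pw_lip p m y z : 1 < p -> Cmod y <= m -> Cmod z <= m ->
  Cmod (Cminus (pw p y) (pw p z)) <= p * rp (p - 1) m * Cmod (Cminus y z).
Proof.
  intros Hp.
  assert (W : forall y z, Cmod y <= m -> Cmod z <= m -> Cmod z <= Cmod y ->
    Cmod (Cminus (pw p y) (pw p z)) <= p * rp (p - 1) m * Cmod (Cminus y z)).
  { clear y z. intros y z Hy Hz Hzy. rewrite !pw_rp.
    (* Since |z| <= |y|, the difference of the powers is put on the smaller factor [z], as [rp_diff]
       requires. The two terms contribute 1 and p - 1, whence the constant p. *)
    replace (Cminus _ _) with (Cplus (Cmult (RtoC (rp (p - 1) (Cmod y))) (Cminus y z))
      (Cmult (RtoC (rp (p - 1) (Cmod y) - rp (p - 1) (Cmod z))) z)).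
    2:{ rewrite RtoC_minus. ring. }
    eapply Rle_trans; [apply Cmod_triangle|]. rewrite !Cmod_scal.
    rewrite (Rabs_pos_eq (rp _ _)) by apply rp_ge_0.
    rewrite Rabs_pos_eq.
    2:{ assert (H := rp_le (p - 1) (Cmod z) (Cmod y) ltac:(lra) Hzy). lra. }
    assert (H1 := rp_diff (p - 1) (Cmod z) (Cmod y) ltac:(lra) (Cmod_ge_0 z) Hzy).
    assert (H2 := rp_le (p - 1) (Cmod y) m ltac:(lra) Hy).
    assert (H3 := Rle_trans _ _ _ (Rle_abs _) (Cmod_minus_abs y z)).
    assert (H4 := rp_ge_0 (p - 1) (Cmod y)). assert (H5 := Cmod_ge_0 (Cminus y z)).
    set (A := rp (p - 1) (Cmod y)) in *. set (D := Cmod (Cminus y z)) in *.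
    apply Rle_trans with (A * D + (p - 1) * A * D).
    - apply Rplus_le_compat_l. eapply Rle_trans; [exact H1|].
      apply Rmult_le_compat_l; auto. apply Rmult_le_pos; lra.
    - replace (A * D + (p - 1) * A * D) with (p * D * A) by ring.
      replace (p * rp (p - 1) m * D) with (p * D * rp (p - 1) m) by ring.
      apply Rmult_le_compat_l; auto. apply Rmult_le_pos; lra. }
  intros Hy Hz. destruct (Rle_dec (Cmod z) (Cmod y)).
  - now apply W.
  - rewrite Cmod_minus_sym, (Cmod_minus_sym y z). apply W; auto; lra.
Qed.

(** The real differential of y -> |y|^(p-1) y at [y] in the direction [x]; it is not complex linear.
    At y = 0 the quotient is meaningless, but the factor [rp] gives the value 0, the correct
    differential for p > 1. *)
Definition pw_der (p : R) (y x : C) : C :=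
  Cmult (RtoC (rp (p - 1) (Cmod y)))
    (Cplus x (Cmult (RtoC ((p - 1) * (Cdot x y / (Cmod y * Cmod y)))) y)).

Lemma pw_der_minus p y x x' : pw_der p y (Cminus x x') = Cminus (pw_der p y x) (pw_der p y x').
Proof.
  unfold pw_der.
  replace (Cdot (Cminus x x') y) with (Cdot x y - Cdot x' y)
    by (unfold Cdot, Cminus; simpl; ring).
  replace ((p - 1) * ((Cdot x y - Cdot x' y) / (Cmod y * Cmod y)))
    with ((p - 1) * (Cdot x y / (Cmod y * Cmod y)) - (p - 1) * (Cdot x' y / (Cmod y * Cmod y)))
    by (unfold Rdiv; ring).
  rewrite RtoC_minus. ring.
Qed.

Lemma pw_der_scal p y r x : pw_der p y (Cmult (RtoC r) x) = Cmult (RtoC r) (pw_der p y x).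
Proof.
  unfold pw_der.
  replace (Cdot (Cmult (RtoC r) x) y) with (r * Cdot x y)
    by (unfold Cdot, Cmult; simpl; ring).
  replace ((p - 1) * (r * Cdot x y / (Cmod y * Cmod y)))
    with (r * ((p - 1) * (Cdot x y / (Cmod y * Cmod y)))) by (unfold Rdiv; ring).
  rewrite RtoC_mult. ring.
Qed.

Lemma Cmod_pw_der p y x : 1 < p -> Cmod (pw_der p y x) <= p * rp (p - 1) (Cmod y) * Cmod x.
Proof.
  intros Hp. unfold pw_der. rewrite Cmod_scal, Rabs_pos_eq by apply rp_ge_0.
  assert (H : Cmod (Cplus x (RtoC ((p - 1) * (Cdot x y / (Cmod y * Cmod y))) * y)) <= p * Cmod x).
  { eapply Rle_trans; [apply Cmod_triangle|]. rewrite Cmod_scal, Rabs_mult, (Rabs_pos_eq (p - 1)) by lra.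
    assert (H : Rabs (Cdot x y / (Cmod y * Cmod y)) * Cmod y <= Cmod x).
    { destruct (Rle_lt_or_eq_dec _ _ (Cmod_ge_0 y)) as [H|H].
      2:{ rewrite <- H. rewrite Rmult_0_r. apply Cmod_ge_0. }
      unfold Rdiv. rewrite Rabs_mult, Rabs_inv, (Rabs_pos_eq (_ * _)) by nra.
      replace (Rabs (Cdot x y) * / (Cmod y * Cmod y) * Cmod y) with (Rabs (Cdot x y) * / Cmod y)
        by (field; lra).
      apply Rmult_le_reg_r with (Cmod y); auto.
      rewrite Rmult_assoc, Rinv_l, Rmult_1_r by lra. apply Cdot_le. }
    nra. }
  assert (H1 := rp_ge_0 (p - 1) (Cmod y)). nra.
Qed.

(** The squared modulus is a polynomial in the coordinates, so powers of |y| are handled as half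
    powers of |y|^2. *)
Lemma Rpower_sqr x q : 0 < x -> Rpower (x * x) (q / 2) = Rpower x q.
Proof.
  intros H. rewrite <- Rpower_mult_distr; auto. rewrite <- Rpower_plus. f_equal. field.
Qed.

Lemma Rpower_unif_cont q a b e : 0 < a -> 0 < e -> exists d, 0 < d /\
  forall x y, a <= x <= b -> a <= y <= b -> Rabs (x - y) < d -> Rabs (Rpower x q - Rpower y q) <= e.
Proof.
  intros Ha He.
  destruct (unifcont_1d (fun x => Rpower x q) a b) with (eps := mkposreal e He) as [d Hd].
  - intros x Hx. apply (ex_derive_continuous (fun y => Rpower y q)).
    eexists. apply is_derive_Rpower. lra.
  - exists d. split; [apply cond_pos|]. intros x y Hx Hy Hxy.
    specialize (Hd x y Hx Hy).
    destruct (Rle_dec (Rabs (Rpower x q - Rpower y q)) e) as [H|H]; auto.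
    exfalso. apply Hd.
    + unfold ball; simpl; unfold AbsRing_ball, abs, minus, plus, opp; simpl.
      fold (y - x). now rewrite Rabs_minus_sym.
    + unfold ball; simpl; unfold AbsRing_ball, abs, minus, plus, opp; simpl.
      fold (Rpower y q - Rpower x q). rewrite Rabs_minus_sym. lra.
Qed.

(** Strict differentiability, with [d] uniform over |y| <= M. Two points [u], [v] near one base
    point are what the comparison of difference quotients calls for. *)
Lemma pw_strict_der p M e : 1 < p -> 0 < M -> 0 < e -> exists d, 0 < d /\
  forall y u v, Cmod y <= M -> Cmod (Cminus u y) <= d -> Cmod (Cminus v y) <= d ->
    Cmod (Cminus (Cminus (pw p u) (pw p v)) (pw_der p y (Cminus u v))) <= e * Cmod (Cminus u v).
Proof.
  intros Hp HM He.
  set (q := p - 1).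
  destruct (rp_small q (e / (2 * p))) as [rh [Hrh Hrp]]; [unfold q; lra|apply Rdiv_lt_0_compat; lra|].
  set (rho := Rmin rh 1 / 2).
  assert (Hrho : 0 < rho) by (unfold rho; assert (0 < Rmin rh 1) by (apply Rmin_pos; lra); lra).
  assert (Hrho1 : 2 * rho <= rh) by (unfold rho; assert (H := Rmin_l rh 1); lra).
  assert (Hrho2 : 2 * rho <= 1) by (unfold rho; assert (H := Rmin_r rh 1); lra).
  (* The range of |u|^2, |v|^2 and |y|^2 when |y| lies between rho and M and [u], [v] are within rho
     / 2 of [y]: the moduli then lie between rho / 2 and M + 1. *)
  set (a := rho * rho / 4). set (b := (M + 1) * (M + 1)).
  assert (Ha : 0 < a) by (unfold a; nra).
  (* The exponent q / 2 - 1 may have either sign, so the power is bounded by the sum of its values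
     at both ends of [a, b]. *)
  set (D := 1 + Rpower a (q / 2 - 1) + Rpower b (q / 2 - 1)).
  assert (Hb : 0 < b) by (unfold b; nra).
  assert (HD1 : 1 < D).
  { unfold D. assert (H1 := Rpower_gt_0 a (q / 2 - 1)). assert (H2 := Rpower_gt_0 b (q / 2 - 1)). lra. }
  assert (HD : forall x, a <= x <= b -> 0 < Rpower x (q / 2 - 1) <= D).
  { intros x Hx. split; [apply Rpower_gt_0|]. unfold D.
    assert (H1 := Rpower_gt_0 a (q / 2 - 1)). assert (H2 := Rpower_gt_0 b (q / 2 - 1)).
    destruct (Rle_dec 0 (q / 2 - 1)) as [H|H].
    - assert (Rpower x (q / 2 - 1) <= Rpower b (q / 2 - 1)) by (apply Rle_Rpower_l; lra). lra.
    - assert (Rpower x (q / 2 - 1) <= Rpower a (q / 2 - 1)).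
      { replace (q / 2 - 1) with (- (1 - q / 2)) by ring. rewrite !Rpower_Ropp.
        apply Rinv_le_contravar; [apply Rpower_gt_0|]. apply Rle_Rpower_l; lra. }
      lra. }
  set (e1 := e / (8 * p * b)).
  assert (Hpb : 1 <= b) by (unfold b; nra).
  assert (He1 : 0 < e1) by (unfold e1; apply Rdiv_lt_0_compat; nra).
  assert (Hee1 : e = 8 * p * b * e1) by (unfold e1; field; lra).
  destruct (Rpower_unif_cont (q / 2) a b e1 Ha He1) as [d1 [Hd1 U1]].
  destruct (Rpower_unif_cont (q / 2 - 1) a b e1 Ha He1) as [d2 [Hd2 U2]].
  set (d3 := e1 / D).
  assert (Hd3 : 0 < d3) by (apply Rdiv_lt_0_compat; lra).
  assert (HDd3 : D * d3 = e1) by (unfold d3; field; lra).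
  set (d := Rmin (Rmin d1 d2 / (2 * (2 * M + 2))) (Rmin (rho / 2) d3)).
  assert (Hd12 : 0 < Rmin d1 d2) by (apply Rmin_pos; auto).
  assert (Hdd0 : 0 < Rmin d1 d2 / (2 * (2 * M + 2))) by (apply Rdiv_lt_0_compat; lra).
  exists d. split; [unfold d; repeat apply Rmin_pos; auto; lra|].
  intros y u v Hy Hu Hv.
  assert (Hdr : d <= rho / 2) by (unfold d; eapply Rle_trans; [apply Rmin_r|apply Rmin_l]).
  assert (Hdd3 : d <= d3) by (unfold d; eapply Rle_trans; [apply Rmin_r|apply Rmin_r]).
  assert (Hdd : d * (2 * M + 2) < Rmin d1 d2).
  { apply Rle_lt_trans with (Rmin d1 d2 / (2 * (2 * M + 2)) * (2 * M + 2)).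
    - apply Rmult_le_compat_r; [lra|]. apply Rmin_l.
    - replace (Rmin d1 d2 / (2 * (2 * M + 2)) * (2 * M + 2)) with (Rmin d1 d2 / 2) by (field; lra).
      lra. }
  assert (Hm1 := Rmin_l d1 d2). assert (Hm2 := Rmin_r d1 d2).
  assert (HuY := Cmod_minus_abs u y). assert (HvY := Cmod_minus_abs v y).
  assert (HuY' : Rabs (Cmod u - Cmod y) <= d) by lra.
  assert (HvY' : Rabs (Cmod v - Cmod y) <= d) by lra.
  apply Rabs_le_between in HuY'. apply Rabs_le_between in HvY'.
  assert (Hz := Cmod_ge_0 (Cminus u v)). set (z := Cminus u v) in *.
  (* Near [y = 0] both the increment and the derivative are [O(|.|^(p-1))]; away from it the
     nonlinearity is a smooth function of [|y|^2] times [y]. *)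
  destruct (Rle_dec (Cmod y) rho) as [Hs|Hs].
  { eapply Rle_trans; [apply Cmod_minus_le|].
    assert (H1 := pw_lip p (2 * rho) u v Hp ltac:(lra) ltac:(lra)). fold z in H1.
    assert (H2 := Cmod_pw_der p y z Hp).
    assert (H3 : rp (p - 1) (2 * rho) <= e / (2 * p)).
    { eapply Rle_trans; [|exact Hrp]. apply rp_le; unfold q; lra. }
    assert (H4 : rp (p - 1) (Cmod y) <= e / (2 * p)).
    { eapply Rle_trans; [|exact Hrp]. apply rp_le; unfold q; lra. }
    assert (H5 : p * rp (p - 1) (2 * rho) * Cmod z <= p * (e / (2 * p)) * Cmod z).
    { apply Rmult_le_compat_r; auto. apply Rmult_le_compat_l; lra. }
    assert (H6 : p * rp (p - 1) (Cmod y) * Cmod z <= p * (e / (2 * p)) * Cmod z).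
    { apply Rmult_le_compat_r; auto. apply Rmult_le_compat_l; lra. }
    replace (p * (e / (2 * p)) * Cmod z) with (e / 2 * Cmod z) in H5, H6 by (field; lra).
    lra. }
  apply Rnot_le_lt in Hs.
  set (A := Cmod u * Cmod u). set (B := Cmod v * Cmod v). set (Y := Cmod y * Cmod y).
  assert (Hsq : forall x, rho / 2 <= x <= M + 1 -> a <= x * x <= b).
  { intros x Hx. unfold a, b. replace (rho * rho / 4) with ((rho / 2) * (rho / 2)) by field.
    split; apply Rmult_le_compat; lra. }
  assert (HA : a <= A <= b) by (apply Hsq; lra).
  assert (HB : a <= B <= b) by (apply Hsq; lra).
  assert (HY : a <= Y <= b) by (apply Hsq; lra).
  assert (Hsq' : forall x, Rabs (x - Cmod y) <= d -> 0 <= x <= M + 1 ->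
    Rabs (x * x - Y) < Rmin d1 d2).
  { intros x Hx1 Hx2. apply Rle_lt_trans with (d * (2 * M + 2)); [|lra]. unfold Y.
    replace (x * x - Cmod y * Cmod y) with ((x - Cmod y) * (x + Cmod y)) by ring.
    assert (Hy0 := Cmod_ge_0 y).
    rewrite Rabs_mult. apply Rmult_le_compat; auto using Rabs_pos. rewrite Rabs_pos_eq; lra. }
  assert (HAY : Rabs (A - Y) < Rmin d1 d2).
  { apply Hsq'; lra. }
  assert (HBY : Rabs (B - Y) < Rmin d1 d2).
  { apply Hsq'; lra. }
  (* Mean value theorem for the half power of the squared modulus. The difference |u|^2 - |v|^2 is
     the inner product of u - v with u + v, which exhibits the increment [z] as a factor. *)
  assert (HX : exists c, a <= c <= b /\ Rabs (c - Y) < Rmin d1 d2 /\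
     Rpower A (q / 2) - Rpower B (q / 2) = q / 2 * Rpower c (q / 2 - 1) * Cdot z (Cplus u v)).
  { assert (HAB : A - B = Cdot z (Cplus u v)).
    { unfold A, B. rewrite !Cmod_sqr. unfold Cdot, z, Cminus, Cplus; simpl; ring. }
    rewrite <- HAB.
    apply Rabs_lt_between in HAY. apply Rabs_lt_between in HBY.
    destruct (Rle_dec A B) as [H|H].
    - destruct (Rpower_mvt (q / 2) A B) as [c [Hc E]]; try lra.
      exists c. split; [lra|]. split; [|lra]. apply Rabs_lt_between. lra.
    - destruct (Rpower_mvt (q / 2) B A) as [c [Hc E]]; try lra.
      exists c. split; [lra|]. split; [|lra]. apply Rabs_lt_between. lra. }
  destruct HX as [c [Hc [HcY HX]]].
  assert (Eu : pw p u = Cmult (RtoC (Rpower A (q / 2))) (Cplus v z)).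
  { replace (Cplus v z) with u by (unfold z; ring).
    unfold pw, A. rewrite Rpower_sqr by lra. reflexivity. }
  assert (Ev : pw p v = Cmult (RtoC (Rpower B (q / 2))) v).
  { unfold pw, B. rewrite Rpower_sqr by lra. reflexivity. }
  assert (Ed : pw_der p y z = Cplus (Cmult (RtoC (Rpower Y (q / 2))) z)
      (Cmult (RtoC (q / 2 * Rpower Y (q / 2 - 1) * Cdot z (Cplus y y))) y)).
  { unfold pw_der. rewrite rp_pos by lra. fold q. rewrite <- (Rpower_sqr (Cmod y) q) by lra.
    fold Y. rewrite <- (Rpower_pred Y (q / 2)) by lra.
    replace (Cdot z (Cplus y y)) with (2 * Cdot z y) by (unfold Cdot, Cplus; simpl; ring).
    replace (q / 2 * Rpower Y (q / 2 - 1) * (2 * Cdot z y))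
      with (Rpower Y (q / 2 - 1) * Y * (q * (Cdot z y / Y))) by (field; lra).
    rewrite (RtoC_mult (_ * Y)). ring. }
  set (P := Rpower c (q / 2 - 1)) in *. set (P0 := Rpower Y (q / 2 - 1)) in *.
  assert (HP0 := HD Y HY). fold P0 in HP0.
  assert (HPP : Rabs (P - P0) <= e1) by (apply U2; auto; lra).
  assert (HAA : Rabs (Rpower A (q / 2) - Rpower Y (q / 2)) <= e1) by (apply U1; auto; lra).
  set (w := Cplus u v) in *. 
  (* The four errors come from replacing, in this order, |u| by |y| in the first factor, [c] by
     |y|^2, u + v by 2 y, and [v] by [y]. *)
  replace (Cminus (Cminus (pw p u) (pw p v)) (pw_der p y z)) with
   (Cplus (Cplus (Cmult (RtoC (Rpower A (q / 2) - Rpower Y (q / 2))) z)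
                 (Cmult (RtoC (q / 2 * (P - P0) * Cdot z w)) v))
          (Cplus (Cmult (RtoC (q / 2 * P0 * Cdot z (Cminus w (Cplus y y)))) v)
                 (Cmult (RtoC (q / 2 * P0 * Cdot z (Cplus y y))) (Cminus v y)))).
  2:{ replace (Cdot z (Cminus w (Cplus y y))) with (Cdot z w - Cdot z (Cplus y y))
        by (unfold Cdot, Cminus; simpl; ring).
      rewrite Ed, Eu, Ev.
      replace (Rpower B (q / 2)) with (Rpower A (q / 2) - q / 2 * P * Cdot z w) by lra.
      repeat rewrite ?RtoC_minus, ?RtoC_mult. ring. }
  assert (Hw : Cmod w <= 2 * (M + 1)).
  { unfold w. eapply Rle_trans; [apply Cmod_triangle|]. lra. }
  assert (Hwy : Cmod (Cminus w (Cplus y y)) <= 2 * d).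
  { replace (Cminus w (Cplus y y)) with (Cplus (Cminus u y) (Cminus v y)) by (unfold w; ring).
    eapply Rle_trans; [apply Cmod_triangle|]. lra. }
  assert (Hyy : Cmod (Cplus y y) <= 2 * (M + 1)).
  { eapply Rle_trans; [apply Cmod_triangle|]. lra. }
  assert (Hv1 : Cmod v <= M + 1) by lra.
  assert (Hq2 : 0 < q / 2 <= p) by (unfold q; lra).
  eapply Rle_trans; [apply Cmod_triangle|].
  eapply Rle_trans; [apply Rplus_le_compat; apply Cmod_triangle|].
  rewrite !Cmod_scal.
  assert (G : forall X r n k1 k2 x1, 0 <= k1 -> 0 <= r -> Rabs X <= k1 -> Cmod n <= k2 -> 0 <= k2 -> 0 <= x1 -> r <= x1 ->
     Rabs (q / 2 * X * Cdot z n) * r <= p * k1 * k2 * x1 * Cmod z).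
  { intros X r n k1 k2 x1 Hk1 Hr H1 H2 Hk2 Hx1 H3. rewrite !Rabs_mult.
    rewrite (Rabs_pos_eq (q / 2)) by lra.
    assert (H4 := Cdot_le z n).
    assert (H5 : Rabs (Cdot z n) <= Cmod z * k2).
    { eapply Rle_trans; [exact H4|]. apply Rmult_le_compat_l; auto. }
    replace (p * k1 * k2 * x1 * Cmod z) with (p * k1 * (Cmod z * k2) * x1) by ring.
    apply Rmult_le_compat; auto.
    - repeat apply Rmult_le_pos; try apply Rabs_pos; lra.
    - apply Rmult_le_compat; auto.
      + apply Rmult_le_pos; try apply Rabs_pos; lra.
      + apply Rabs_pos.
      + apply Rmult_le_compat; auto; try apply Rabs_pos; lra. }
  assert (T1 := G (P - P0) (Cmod v) w e1 (2 * (M + 1)) (M + 1) ltac:(lra) (Cmod_ge_0 _) HPP Hw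
    ltac:(lra) ltac:(lra) Hv1).
  assert (T2 := G P0 (Cmod v) _ D (2 * d) (M + 1) ltac:(lra) (Cmod_ge_0 _)
    ltac:(rewrite Rabs_pos_eq; lra) Hwy ltac:(unfold d; apply Rmult_le_pos; [lra|];
    left; repeat apply Rmin_pos; lra) ltac:(lra) Hv1).
  assert (Hd0 : 0 < d) by (unfold d; repeat apply Rmin_pos; auto; lra).
  assert (T3 := G P0 _ _ D (2 * (M + 1)) d ltac:(lra) (Cmod_ge_0 _)
    ltac:(rewrite Rabs_pos_eq; lra) Hyy ltac:(lra) ltac:(lra) Hv).
  assert (T4 : Rabs (Rpower A (q / 2) - Rpower Y (q / 2)) * Cmod z <= e1 * Cmod z)
    by (apply Rmult_le_compat_r; auto).
  assert (HDd : D * d <= e1) by (rewrite <- HDd3; apply Rmult_le_compat_l; lra).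
  assert (T5 : e1 * Cmod z + p * e1 * (2 * (M + 1)) * (M + 1) * Cmod z
     + (p * D * (2 * d) * (M + 1) * Cmod z + p * D * (2 * (M + 1)) * d * Cmod z) <= e * Cmod z).
  { replace (e1 * Cmod z + p * e1 * (2 * (M + 1)) * (M + 1) * Cmod z
     + (p * D * (2 * d) * (M + 1) * Cmod z + p * D * (2 * (M + 1)) * d * Cmod z))
     with ((e1 + 2 * p * b * e1 + 4 * p * (M + 1) * (D * d)) * Cmod z) by (unfold b; ring).
    apply Rmult_le_compat_r; auto. rewrite Hee1.
    assert ((M + 1) * 1 <= b) by (apply Rmult_le_compat_l; lra).
    assert (p * (M + 1) * (D * d) <= p * b * e1).
    { apply Rmult_le_compat; [| |apply Rmult_le_compat_l; lra|exact HDd]; apply Rmult_le_pos; lra. }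
    assert (1 * 1 <= p * b) by (apply Rmult_le_compat; lra).
    assert (1 * e1 <= p * b * e1) by (apply Rmult_le_compat_r; lra). lra. }
  lra.
Qed.

(** * The singular source and its regularised weight *)

Definition kap (p eps s : R) : R := Rpower (Rabs s + eps) (1 - p).

(** At s = 0 the power has a default value. It does no harm: admissibility at s = 0 forces y = 0,
    and then [psi] vanishes. *)
Definition psi (p s : R) (y : C) : C := Cmult (RtoC (Rpower (Rabs s) (1 - p))) (pw p y).

(* [|y| <= c min(1, |s|/eps)]. *)
Definition adm (c eps s : R) (y : C) : Prop := Cmod y <= c /\ eps * Cmod y <= c * Rabs s.

Section Psi.

Variables (p c eps : R).
Hypotheses (Hp : 1 < p) (Hc : 0 <= c) (Heps : 0 < eps).

Let B := rp (p - 1) (2 * c).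

Lemma kap_pos s : 0 < kap p eps s.
Proof. apply Rpower_gt_0. Qed.

Lemma kap_le s : kap p eps s <= Rpower eps (1 - p).
Proof.
  unfold kap. replace (1 - p) with (- (p - 1)) by ring. rewrite !Rpower_Ropp.
  apply Rinv_le_contravar; [apply Rpower_gt_0|]. apply Rle_Rpower_l; try lra.
  assert (H := Rabs_pos s). lra.
Qed.

Lemma adm_0 y : adm c eps 0 y -> y = RtoC 0.
Proof.
  intros [_ H]. rewrite Rabs_R0, Rmult_0_r in H. apply Cmod_eq_0.
  assert (H1 := Cmod_ge_0 y). nra.
Qed.

(** Adding the two bounds of [adm] gives |y| (|s| + eps) <= 2 c |s|. This form of the minimum is
    chosen because its power p - 1 cancels |s|^(1-p) exactly and leaves the regularised weight. *)
Definition cap (s : R) : R := 2 * c * (Rabs s * / (Rabs s + eps)).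

Lemma adm_cap s y : adm c eps s y -> Cmod y <= cap s.
Proof.
  intros [H1 H2]. unfold cap. assert (H := Rabs_pos s).
  apply Rmult_le_reg_r with (Rabs s + eps); [lra|].
  replace (2 * c * (Rabs s * / (Rabs s + eps)) * (Rabs s + eps)) with (2 * c * Rabs s) by (field; lra).
  assert (H3 := Cmod_ge_0 y). nra.
Qed.

Lemma weight_cap s : s <> 0 -> Rpower (Rabs s) (1 - p) * rp (p - 1) (cap s) = B * kap p eps s.
Proof.
  intros Hs. assert (H := Rabs_pos_lt s Hs). unfold cap, B, kap.
  assert (H1 : 0 < / (Rabs s + eps)) by (apply Rinv_0_lt_compat; lra).
  assert (H2 : 0 < Rabs s * / (Rabs s + eps)) by (now apply Rmult_lt_0_compat).
  rewrite rp_mult by lra.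
  rewrite (rp_pos _ (Rabs s * / (Rabs s + eps))) by exact H2. rewrite <- Rpower_mult_distr; auto.
  replace (Rpower (/ (Rabs s + eps)) (p - 1)) with (Rpower (Rabs s + eps) (1 - p)).
  2:{ unfold Rpower. rewrite ln_Rinv by lra. f_equal; ring. }
  replace (Rpower (Rabs s) (1 - p)) with (/ Rpower (Rabs s) (p - 1)).
  2:{ rewrite <- Rpower_Ropp. f_equal; ring. }
  field. apply Rgt_not_eq, Rpower_gt_0.
Qed.

Lemma weight_adm s y : s <> 0 -> adm c eps s y ->
  Rpower (Rabs s) (1 - p) * rp (p - 1) (Cmod y) <= B * kap p eps s.
Proof.
  intros Hs Hy. rewrite <- weight_cap; auto.
  apply Rmult_le_compat_l; [left; apply Rpower_gt_0|].
  apply rp_le; [lra|]. now apply adm_cap.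
Qed.

Lemma B_ge_0 : 0 <= B.
Proof. apply rp_ge_0. Qed.

Lemma psi_0 s : psi p s (RtoC 0) = RtoC 0.
Proof. unfold psi. rewrite pw_0. ring. Qed.

Lemma psi_lip_same s y z : adm c eps s y -> adm c eps s z ->
  Cmod (Cminus (psi p s y) (psi p s z)) <= p * B * kap p eps s * Cmod (Cminus y z).
Proof.
  intros Hy Hz.
  assert (HB := B_ge_0). assert (HK := kap_pos s).
  destruct (Req_dec s 0) as [->|Hs].
  { rewrite (adm_0 _ Hy), (adm_0 _ Hz), psi_0.
    replace (Cminus (RtoC 0) (RtoC 0)) with (RtoC 0) by ring. rewrite Cmod_0. lra. }
  unfold psi. replace (Cminus _ _) with
    (Cmult (RtoC (Rpower (Rabs s) (1 - p))) (Cminus (pw p y) (pw p z))) by ring.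
  rewrite Cmod_scal, Rabs_pos_eq by (left; apply Rpower_gt_0).
  assert (H := pw_lip p (cap s) y z Hp (adm_cap _ _ Hy) (adm_cap _ _ Hz)).
  rewrite (Rmult_assoc p B), <- weight_cap; auto.
  assert (H1 := Rpower_gt_0 (Rabs s) (1 - p)).
  replace (p * (Rpower (Rabs s) (1 - p) * rp (p - 1) (cap s)) * Cmod (Cminus y z))
    with (Rpower (Rabs s) (1 - p) * (p * rp (p - 1) (cap s) * Cmod (Cminus y z))) by ring.
  apply Rmult_le_compat_l; lra.
Qed.

Lemma Cmod_psi_le s y : adm c eps s y -> Cmod (psi p s y) <= B * kap p eps s * Cmod y.
Proof.
  intros Hy. destruct (Req_dec s 0) as [->|Hs].
  { rewrite (adm_0 _ Hy), psi_0, Cmod_0. lra. }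
  unfold psi. rewrite Cmod_scal, Cmod_pw, Rabs_pos_eq by (left; apply Rpower_gt_0).
  rewrite <- Rmult_assoc. apply Rmult_le_compat_r; [apply Cmod_ge_0|]. now apply weight_adm.
Qed.

(** One may assume |s'| <= |s|. The variation of the weight then multiplies the field at the point
    nearer to the singularity, where admissibility gives |y'| <= c |s'| / eps; the factor |s'|
    compensates the derivative |s'|^(-p) of the weight. *)
Lemma psi_lip s s' y y' : adm c eps s y -> adm c eps s' y' ->
  Cmod (Cminus (psi p s y) (psi p s' y')) <=
  p * B * (kap p eps s + kap p eps s') * (Cmod (Cminus y y') + c / eps * Rabs (s - s')).
Proof.
  revert s s' y y'.
  assert (W : forall s s' y y', Rabs s' <= Rabs s -> adm c eps s y -> adm c eps s' y' ->
  Cmod (Cminus (psi p s y) (psi p s' y')) <=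
  p * B * (kap p eps s + kap p eps s') * (Cmod (Cminus y y') + c / eps * Rabs (s - s'))).
  { intros s s' y y' Hss Hy Hy'.
    assert (HB := B_ge_0). assert (HK := kap_pos s). assert (HK' := kap_pos s').
    assert (Hce : 0 <= c / eps).
    { unfold Rdiv. apply Rmult_le_pos; auto. left. now apply Rinv_0_lt_compat. }
    assert (Hd := Cmod_ge_0 (Cminus y y')).
    assert (Hsd := Rabs_pos (s - s')).
    assert (Hcd : 0 <= c / eps * Rabs (s - s')) by (apply Rmult_le_pos; auto).
    assert (HpB : 0 <= p * B) by (apply Rmult_le_pos; lra).
    destruct (Req_dec s' 0) as [->|Hs'].
    { rewrite (adm_0 _ Hy') in *. rewrite psi_0.
      replace (Cminus (psi p s y) (RtoC 0)) with (psi p s y) by ring.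
      replace (Cminus y (RtoC 0)) with y in * by ring.
      eapply Rle_trans; [apply Cmod_psi_le; auto|].
      assert (0 <= B * kap p eps s) by (apply Rmult_le_pos; lra).
      assert (0 <= B * kap p eps 0) by (apply Rmult_le_pos; lra).
      apply Rmult_le_compat; try lra; try apply Cmod_ge_0.
      replace (p * B * (kap p eps s + kap p eps 0))
        with (p * (B * kap p eps s + B * kap p eps 0)) by ring. nra. }
    assert (H0 : 0 < Rabs s') by (apply Rabs_pos_lt; auto).
    assert (Hs : s <> 0). { intros ->. rewrite Rabs_R0 in Hss. lra. }
    set (k := Rpower (Rabs s) (1 - p)). set (k' := Rpower (Rabs s') (1 - p)).
    assert (Hk : k <= k').
    { unfold k, k'. replace (1 - p) with (- (p - 1)) by ring. rewrite !Rpower_Ropp.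
      apply Rinv_le_contravar; [apply Rpower_gt_0|]. apply Rle_Rpower_l; lra. }
    assert (Hk' : 0 < k') by apply Rpower_gt_0.
    assert (Hdk : (k' - k) * Rabs s' <= (p - 1) * k' * (Rabs s - Rabs s')).
    { unfold k, k'. destruct (Rpower_mvt (1 - p) (Rabs s') (Rabs s) H0 Hss) as [x [Hx E]].
      replace (Rpower (Rabs s') (1 - p) - Rpower (Rabs s) (1 - p))
        with ((p - 1) * Rpower x (1 - p - 1) * (Rabs s - Rabs s')) by lra.
      assert (H1 : Rpower x (1 - p - 1) * Rabs s' <= Rpower (Rabs s') (1 - p)).
      { rewrite <- (Rpower_pred (Rabs s')) by lra.
        apply Rmult_le_compat_r; [lra|].
        replace (1 - p - 1) with (- p) by ring. rewrite !Rpower_Ropp.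
        apply Rinv_le_contravar; [apply Rpower_gt_0|]. apply Rle_Rpower_l; lra. }
      replace ((p - 1) * Rpower x (1 - p - 1) * (Rabs s - Rabs s') * Rabs s')
        with ((p - 1) * (Rabs s - Rabs s') * (Rpower x (1 - p - 1) * Rabs s')) by ring.
      replace ((p - 1) * Rpower (Rabs s') (1 - p) * (Rabs s - Rabs s'))
        with ((p - 1) * (Rabs s - Rabs s') * Rpower (Rabs s') (1 - p)) by ring.
      apply Rmult_le_compat_l; auto. apply Rmult_le_pos; lra. }
    assert (Hyc : Cmod y' <= c / eps * Rabs s').
    { destruct Hy' as [_ H]. apply Rmult_le_reg_l with eps; auto.
      replace (eps * (c / eps * Rabs s')) with (c * Rabs s') by (field; lra). auto. }
    unfold psi. fold k k'.
    replace (Cminus _ _) with (Cplus (Cmult (RtoC k) (Cminus (pw p y) (pw p y')))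
      (Copp (Cmult (RtoC (k' - k)) (pw p y')))).
    2:{ rewrite RtoC_minus. ring. }
    eapply Rle_trans; [apply Cmod_triangle|]. rewrite Cmod_opp, !Cmod_scal.
    rewrite (Rabs_pos_eq k) by (left; apply Rpower_gt_0). rewrite Rabs_pos_eq by lra.
    (* The cap increases with |s|, so [y'] also obeys the bound at [s] and the two fields can be
       compared under the weight at [s]. *)
    assert (Hcap : Cmod y' <= cap s).
    { eapply Rle_trans; [apply adm_cap; eauto|]. unfold cap.
      apply Rmult_le_compat_l; [lra|].
      assert (Hpos : 0 < Rabs s) by lra.
      apply Rmult_le_reg_r with ((Rabs s' + eps) * (Rabs s + eps)); [nra|].
      replace (Rabs s' * / (Rabs s' + eps) * ((Rabs s' + eps) * (Rabs s + eps)))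
        with (Rabs s' * (Rabs s + eps)) by (field; lra).
      replace (Rabs s * / (Rabs s + eps) * ((Rabs s' + eps) * (Rabs s + eps)))
        with (Rabs s * (Rabs s' + eps)) by (field; lra). nra. }
    assert (H1 : k * Cmod (Cminus (pw p y) (pw p y')) <= p * B * kap p eps s * Cmod (Cminus y y')).
    { assert (H := pw_lip p (cap s) y y' Hp (adm_cap _ _ Hy) Hcap).
      rewrite (Rmult_assoc p B), <- weight_cap; auto. fold k.
      replace (p * (k * rp (p - 1) (cap s)) * Cmod (Cminus y y'))
        with (k * (p * rp (p - 1) (cap s) * Cmod (Cminus y y'))) by ring.
      apply Rmult_le_compat_l; [left; apply Rpower_gt_0|auto]. }
    assert (H2 : (k' - k) * Cmod (pw p y') <= (p - 1) * B * kap p eps s' * (c / eps * Rabs (s - s'))).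
    { rewrite Cmod_pw. assert (Hr := rp_ge_0 (p - 1) (Cmod y')).
      apply Rle_trans with ((k' - k) * (rp (p - 1) (Cmod y') * (c / eps * Rabs s'))).
      { apply Rmult_le_compat_l; [lra|]. apply Rmult_le_compat_l; auto. }
      replace ((k' - k) * (rp (p - 1) (Cmod y') * (c / eps * Rabs s')))
        with ((k' - k) * Rabs s' * (rp (p - 1) (Cmod y') * (c / eps))) by ring.
      apply Rle_trans with ((p - 1) * k' * (Rabs s - Rabs s') * (rp (p - 1) (Cmod y') * (c / eps))).
      { apply Rmult_le_compat_r; auto. apply Rmult_le_pos; auto. }
      assert (H := weight_adm s' y' Hs' Hy'). fold k' in H.
      replace ((p - 1) * k' * (Rabs s - Rabs s') * (rp (p - 1) (Cmod y') * (c / eps)))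
        with (k' * rp (p - 1) (Cmod y') * ((p - 1) * (c / eps * (Rabs s - Rabs s')))) by ring.
      replace ((p - 1) * B * kap p eps s' * (c / eps * Rabs (s - s')))
        with (B * kap p eps s' * ((p - 1) * (c / eps * Rabs (s - s')))) by ring.
      assert (Hst : Rabs s - Rabs s' <= Rabs (s - s')) by apply Rabs_triang_inv.
      apply Rmult_le_compat; auto.
      - apply Rmult_le_pos; [left; apply Rpower_gt_0|auto].
      - apply Rmult_le_pos; [lra|]. apply Rmult_le_pos; [exact Hce|lra].
      - apply Rmult_le_compat_l; [lra|]. apply Rmult_le_compat_l; auto. }
    set (X := Cmod (Cminus y y')) in *. set (Z := c / eps * Rabs (s - s')) in *.
    set (K := kap p eps s) in *. set (K' := kap p eps s') in *.
    clearbody X Z K K'.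
    assert (0 <= B * K) by (apply Rmult_le_pos; lra).
    assert (0 <= B * K') by (apply Rmult_le_pos; lra).
    assert (0 <= B * K * Z) by (apply Rmult_le_pos; lra).
    assert (0 <= B * K' * Z) by (apply Rmult_le_pos; lra).
    assert (0 <= p * (B * K' * X)) by (apply Rmult_le_pos; [lra|apply Rmult_le_pos; lra]).
    assert (0 <= p * (B * K * Z)) by (apply Rmult_le_pos; lra).
    lra. }
  intros s s' y y' Hy Hy'. destruct (Rle_dec (Rabs s') (Rabs s)).
  - now apply W.
  - rewrite Cmod_minus_sym, (Cmod_minus_sym y), Rabs_minus_sym,
      (Rplus_comm (kap p eps s)). apply W; auto; lra.
Qed.

End Psi.

(** * Limits and integrals *)

Lemma cont_in_continuous (f : R -> C) x : cont_in full f x -> continuous (U := CR) f x.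
Proof.
  intros H. apply (filterlim_locally_ball_norm (U := CR)). intros e.
  destruct (H e (cond_pos e)) as [d [Hd H1]]. exists (mkposreal d Hd).
  intros y Hy. unfold ball_norm. rewrite minus_CR, norm_CR. apply H1; auto.
Qed.

Lemma is_derive_der_in (f : R -> C) x l : is_derive (V := CR) f x l -> der_in full f x l.
Proof.
  intros [_ H] e He. specialize (H x (fun P HP => HP) (mkposreal e He)).
  destruct H as [d Hd]. exists d. split; [apply cond_pos|]. intros y _ Hy.
  specialize (Hd y Hy). simpl in Hd.
  rewrite !minus_CR, norm_CR, scal_CR in Hd. exact Hd.
Qed.

Lemma C_complete (u : nat -> C) :
  (forall e, 0 < e -> exists N, forall n m, (N <= n)%nat -> (N <= m)%nat -> Cmod (Cminus (u n) (u m)) <= e) ->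
  exists l, forall e, 0 < e -> exists N, forall n, (N <= n)%nat -> Cmod (Cminus (u n) l) <= e.
Proof.
  intros H.
  assert (HR : forall f : C -> R, (forall z w, Rabs (f z - f w) <= Cmod (Cminus z w)) ->
     exists l, Un_cv (fun n => f (u n)) l).
  { intros f Hf. destruct (Rcomplete.R_complete (fun n => f (u n))) as [l Hl]; [|now exists l].
    intros e He. destruct (H (e / 2)) as [N HN]; [lra|]. exists N. intros n m Hn Hm.
    unfold Rdist. eapply Rle_lt_trans; [apply Hf|]. specialize (HN n m Hn Hm). lra. }
  destruct (HR fst) as [l1 H1].
  { intros z w. eapply Rle_trans; [|apply (Rmax_Cmod (Cminus z w))]. apply Rmax_l. }
  destruct (HR snd) as [l2 H2].
  { intros z w. eapply Rle_trans; [|apply (Rmax_Cmod (Cminus z w))]. apply Rmax_r. }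
  exists (l1, l2). intros e He.
  destruct (H1 (e / 2)) as [N1 HN1]; [lra|]. destruct (H2 (e / 2)) as [N2 HN2]; [lra|].
  exists (Nat.max N1 N2). intros n Hn.
  specialize (HN1 n ltac:(lia)). specialize (HN2 n ltac:(lia)). unfold Rdist in *.
  destruct (u n) as [a b]. simpl in *.
  replace (Cminus (a, b) (l1, l2)) with
    (Cplus (RtoC (a - l1)) (Cmult (RtoC (b - l2)) (0, 1))).
  2:{ unfold Cminus, Cplus, Copp, Cmult, RtoC; simpl. f_equal; ring. }
  eapply Rle_trans; [apply Cmod_triangle|].
  rewrite Cmod_scal, Cmod_R.
  replace (Cmod (0, 1)) with 1. lra.
  unfold Cmod; simpl. rewrite <- sqrt_1 at 1. f_equal. ring.
Qed.

Lemma choice2 {A B X : Type} (P : A -> B -> X -> Prop) :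
  (forall a b, exists x, P a b x) -> exists f, forall a b, P a b (f a b).
Proof.
  intros H. exists (fun a b => proj1_sig (constructive_indefinite_description _ (H a b))).
  intros a b. apply (proj2_sig (constructive_indefinite_description _ (H a b))).
Qed.

Lemma C_geometric_limit (u : nat -> C) D : 0 <= D ->
  (forall n, Cmod (Cminus (u (S n)) (u n)) <= D * (/ 2) ^ n) ->
  exists l, forall n, Cmod (Cminus (u n) l) <= 2 * D * (/ 2) ^ n.
Proof.
  intros HD H.
  assert (H1 : forall n k, Cmod (Cminus (u (n + k)%nat) (u n)) <= 2 * D * (/ 2) ^ n - 2 * D * (/ 2) ^ (n + k)).
  { intros n k. induction k as [|k IH].
    - rewrite Nat.add_0_r. replace (Cminus _ _) with (RtoC 0) by ring. rewrite Cmod_0. lra.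
    - rewrite Nat.add_succ_r. eapply Rle_trans; [apply (Cmod_minus_triangle _ (u (n + k)%nat))|].
      specialize (H (n + k)%nat). simpl pow. lra. }
  assert (Hp : forall n, 0 <= 2 * D * (/ 2) ^ n).
  { intros n. apply Rmult_le_pos; [lra|]. apply pow_le. lra. }
  assert (Hlim : forall e, 0 < e -> exists N, forall n, (N <= n)%nat -> 2 * D * (/ 2) ^ n <= e).
  { intros e He. destruct (pow_lt_1_zero (/ 2) ltac:(rewrite Rabs_pos_eq; lra) (e / (2 * D + 1))) as [N HN].
    { apply Rdiv_lt_0_compat; lra. }
    exists N. intros n Hn. specialize (HN n Hn). rewrite Rabs_pos_eq in HN by (apply pow_le; lra).
    apply Rle_trans with (2 * D * (e / (2 * D + 1))); [apply Rmult_le_compat_l; lra|].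
    apply Rmult_le_reg_r with (2 * D + 1); [lra|].
    replace (2 * D * (e / (2 * D + 1)) * (2 * D + 1)) with (2 * D * e) by (field; lra).
    assert (0 <= D * e) by (apply Rmult_le_pos; lra). lra. }
  destruct (C_complete u) as [l Hl].
  { intros e He. destruct (Hlim (e / 2)) as [N HN]; [lra|]. exists N. intros n m Hn Hm.
    eapply Rle_trans; [apply (Cmod_minus_triangle _ (u N))|].
    rewrite (Cmod_minus_sym (u N) (u m)).
    assert (G := H1 N (n - N)%nat). replace (N + (n - N))%nat with n in G by lia.
    assert (G' := H1 N (m - N)%nat). replace (N + (m - N))%nat with m in G' by lia.
    assert (Hn' := Hp n). assert (Hm' := Hp m). specialize (HN N (Nat.le_refl N)). lra. }
  exists l. intros n. apply Rnot_lt_le. intros Hlt.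
  set (e := (Cmod (Cminus (u n) l) - 2 * D * (/ 2) ^ n) / 2).
  destruct (Hl e) as [N HN]; [unfold e; lra|].
  specialize (HN (n + N)%nat ltac:(lia)). specialize (H1 n N). specialize (Hp (n + N)%nat).
  assert (G := Cmod_minus_triangle (u n) (u (n + N)%nat) l).
  rewrite (Cmod_minus_sym (u n) (u (n + N)%nat)) in G. unfold e in HN. lra.
Qed.

(** Carries an inequality satisfied by all iterates up to a geometrically small error over to the
    limit. *)
Lemma le_of_geometric A B D : (forall n, A <= B + D * (/ 2) ^ n) -> A <= B.
Proof.
  intros H. apply Rnot_lt_le. intros Hlt.
  destruct (pow_lt_1_zero (/ 2) ltac:(rewrite Rabs_pos_eq; lra) ((A - B) / (1 + Rabs D))) as [N HN].
  { assert (G := Rabs_pos D). apply Rdiv_lt_0_compat; lra. }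
  specialize (HN N (Nat.le_refl N)). specialize (H N).
  assert (G := Rabs_pos D). assert (G1 := Rle_abs D).
  assert (G2 : 0 <= (/ 2) ^ N) by (apply pow_le; lra).
  rewrite Rabs_pos_eq in HN by auto.
  assert (G3 : (1 + Rabs D) * (/ 2) ^ N < A - B).
  { apply Rlt_le_trans with ((1 + Rabs D) * ((A - B) / (1 + Rabs D))).
    - apply Rmult_lt_compat_l; lra.
    - right. field. lra. }
  nra.
Qed.

(** * Integrals from 0 to a time of either sign *)

Definition CInt (f : R -> C) (t : R) : C := RInt (V := CR) f 0 t.

Section Integrals.

Implicit Types f g : R -> C.
Implicit Types h k : R -> R.

Definition ccont f := forall x, cont_in full f x.
Definition rcont h := forall x, continuous h x.

Lemma ccont_ex_RInt f a b : ccont f -> ex_RInt (V := CR) f a b.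
Proof.
  intros H. apply (ex_RInt_continuous (V := CR)). intros z _. now apply cont_in_continuous.
Qed.

Lemma rcont_ex_RInt h a b : rcont h -> ex_RInt h a b.
Proof. intros H. apply (ex_RInt_continuous (V := R_CompleteNormedModule)). intros; apply H. Qed.

Lemma RInt_abs_nonneg h t : rcont h -> (forall x, 0 <= h x) ->
  Rabs (RInt h 0 t) = if Rle_dec 0 t then RInt h 0 t else RInt h t 0.
Proof.
  intros Hc Hp. destruct Rle_dec as [H|H].
  - apply Rabs_pos_eq. apply RInt_ge_0; auto. now apply rcont_ex_RInt.
  - rewrite <- opp_RInt_swap by (now apply rcont_ex_RInt). unfold opp; simpl.
    rewrite Rabs_Ropp. apply Rabs_pos_eq. apply RInt_ge_0; auto; try lra. now apply rcont_ex_RInt.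
Qed.

(** The bound is asked for |x| <= |t| only, because the closeness of difference quotients is known
    on bounded time intervals only. *)
Lemma Cmod_RInt_le_in f h t : ccont f -> rcont h -> (forall x, 0 <= h x) ->
  (forall x, Rabs x <= Rabs t -> Cmod (f x) <= h x) ->
  Cmod (CInt f t) <= Rabs (RInt h 0 t).
Proof.
  intros Hf Hh Hp Hfh. unfold CInt.
  rewrite RInt_abs_nonneg; auto.
  assert (W : forall a b, a <= b -> (forall x, a <= x <= b -> Rabs x <= Rabs t) ->
    Cmod (RInt (V := CR) f a b) <= RInt h a b).
  { intros a b Hab Hin. rewrite <- norm_CR.
    apply (norm_RInt_le (V := CR) f h a b); auto.
    - intros x Hx. rewrite norm_CR. apply Hfh. auto.
    - apply (RInt_correct (V := CR)). now apply ccont_ex_RInt.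
    - apply (RInt_correct (V := R_CompleteNormedModule)). now apply rcont_ex_RInt. }
  destruct Rle_dec as [H|H].
  - apply W; auto. intros x Hx. rewrite !Rabs_pos_eq; lra.
  - rewrite <- (opp_RInt_swap (V := CR)) by (now apply ccont_ex_RInt).
    change (opp (RInt (V := CR) f t 0)) with (Copp (RInt (V := CR) f t 0)).
    rewrite Cmod_opp. apply W; [lra|]. intros x Hx. rewrite !Rabs_left1; lra.
Qed.

Lemma Cmod_RInt_le f h t : ccont f -> rcont h -> (forall x, Cmod (f x) <= h x) ->
  Cmod (CInt f t) <= Rabs (RInt h 0 t).
Proof.
  intros Hf Hh Hfh. apply Cmod_RInt_le_in; auto.
  intros x. eapply Rle_trans; [apply Cmod_ge_0|apply Hfh].
Qed.

Lemma Rabs_RInt_le h k t : rcont h -> rcont k -> (forall x, 0 <= h x <= k x) ->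
  Rabs (RInt h 0 t) <= Rabs (RInt k 0 t).
Proof.
  intros Hh Hk H.
  rewrite !RInt_abs_nonneg; auto.
  - destruct Rle_dec as [Ht|Ht]; apply RInt_le; try lra;
      try (now apply rcont_ex_RInt); intros; apply H.
  - intros x; specialize (H x); lra.
  - intros x; specialize (H x); lra.
Qed.

Lemma Rabs_RInt_scal h t r : rcont h ->
  Rabs (RInt (fun x => r * h x) 0 t) = Rabs r * Rabs (RInt h 0 t).
Proof.
  intros Hh. rewrite <- Rabs_mult. f_equal.
  apply (RInt_scal (V := R_CompleteNormedModule) h 0 t r). now apply rcont_ex_RInt.
Qed.

Lemma Rabs_RInt_plus h k t : rcont h -> rcont k ->
  Rabs (RInt (fun x => h x + k x) 0 t) <= Rabs (RInt h 0 t) + Rabs (RInt k 0 t).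
Proof.
  intros Hh Hk.
  replace (RInt (fun x => h x + k x) 0 t) with (RInt h 0 t + RInt k 0 t).
  - apply Rabs_triang.
  - symmetry. apply (RInt_plus (V := R_CompleteNormedModule) h k); now apply rcont_ex_RInt.
Qed.

Lemma rcont_plus h k : rcont h -> rcont k -> rcont (fun x => h x + k x).
Proof. intros Hh Hk x. apply (continuous_plus (V := R_NormedModule) h k x); auto. Qed.

Lemma rcont_mult h k : rcont h -> rcont k -> rcont (fun x => h x * k x).
Proof. intros Hh Hk x. apply (continuous_mult h k x); auto. Qed.

Lemma rcont_const (r : R) : rcont (fun _ => r).
Proof. intros x. apply continuous_const. Qed.

Lemma rcont_Cmod f : ccont f -> rcont (fun x => Cmod (f x)).
Proof.
  intros H x. apply (filterlim_locally (U := R_UniformSpace)). intros e.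
  destruct (H x e (cond_pos e)) as [d [Hd H1]]. exists (mkposreal d Hd).
  intros y Hy. unfold ball; simpl; unfold AbsRing_ball, abs, minus, plus, opp; simpl.
  fold (Cmod (f y) - Cmod (f x)). eapply Rle_lt_trans; [apply Cmod_minus_abs|]. apply H1; auto.
Qed.

Lemma rcont_nonneg_lip1 h : (forall s, 0 <= h s) ->
  (forall s t, Rabs (h s - h t) <= Rabs (s - t)) -> rcont h.
Proof.
  intros Hh H s. apply (continuous_ext (fun s => Cmod (RtoC (h s)))).
  - intros u. rewrite Cmod_R. now apply Rabs_pos_eq.
  - apply rcont_Cmod. intros u e He. exists e. split; auto. intros v _ Hv.
    rewrite <- RtoC_minus, Cmod_R. eapply Rle_lt_trans; [apply H|auto].
Qed.

Lemma rcont_kap p eps x : 0 < eps -> rcont (fun t => kap p eps (x - t)).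
Proof.
  intros He t. unfold kap.
  apply (continuous_comp (fun t => Rabs (x - t) + eps) (fun u => Rpower u (1 - p))).
  - apply (continuous_plus (V := R_NormedModule) (fun t => Rabs (x - t)) (fun _ => eps)).
    + apply (continuous_comp (fun t => x - t) Rabs).
      * apply (continuous_minus (V := R_NormedModule) (fun _ => x) (fun t => t)).
        apply continuous_const. apply continuous_id.
      * apply continuous_Rabs.
    + apply continuous_const.
  - apply (ex_derive_continuous (fun u => Rpower u (1 - p))). eexists. apply is_derive_Rpower.
    assert (H := Rabs_pos (x - t)). lra.
Qed.

Lemma RInt_CR_minus f g t : ccont f -> ccont g ->
  Cminus (CInt f t) (CInt g t) = CInt (fun x => Cminus (f x) (g x)) t.
Proof.
  intros Hf Hg. symmetry. apply (RInt_minus (V := CR) f g); now apply ccont_ex_RInt.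
Qed.

Lemma ccont_minus f g : ccont f -> ccont g -> ccont (fun x => Cminus (f x) (g x)).
Proof.
  intros Hf Hg x e He.
  destruct (Hf x (e / 2)) as [d1 [Hd1 H1]]; [lra|]. destruct (Hg x (e / 2)) as [d2 [Hd2 H2]]; [lra|].
  exists (Rmin d1 d2). split; [now apply Rmin_pos|]. intros y _ Hy.
  replace (Cminus _ _) with (Cminus (Cminus (f y) (f x)) (Cminus (g y) (g x))) by ring.
  eapply Rle_lt_trans; [apply Cmod_minus_le|].
  assert (Hy1 := Rlt_le_trans _ _ _ Hy (Rmin_l _ _)).
  assert (Hy2 := Rlt_le_trans _ _ _ Hy (Rmin_r _ _)).
  specialize (H1 y I Hy1). specialize (H2 y I Hy2). lra.
Qed.

Lemma ccont_scal (r : R) f : ccont f -> ccont (fun x => Cmult (RtoC r) (f x)).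
Proof.
  intros Hf x e He. assert (Hr := Rabs_pos r).
  destruct (Hf x (e / (1 + Rabs r))) as [d [Hd H]]; [apply Rdiv_lt_0_compat; lra|].
  exists d. split; auto. intros y _ Hy. specialize (H y I Hy).
  replace (Cminus _ _) with (Cmult (RtoC r) (Cminus (f y) (f x))) by ring.
  rewrite Cmod_scal.
  assert (H0 := Cmod_ge_0 (Cminus (f y) (f x))).
  apply Rle_lt_trans with (Rabs r * (e / (1 + Rabs r))); [apply Rmult_le_compat_l; lra|].
  replace (Rabs r * (e / (1 + Rabs r))) with (e - e / (1 + Rabs r)) by (field; lra).
  assert (0 < e / (1 + Rabs r)) by (apply Rdiv_lt_0_compat; lra). lra.
Qed.

Lemma RInt_CR_scal (r : R) f t : ccont f ->
  CInt (fun x => Cmult (RtoC r) (f x)) t = Cmult (RtoC r) (CInt f t).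
Proof.
  intros Hf. unfold CInt. rewrite <- scal_CR.
  transitivity (RInt (V := CR) (fun x => scal (V := CR) r (f x)) 0 t).
  - apply (RInt_ext (V := CR)). intros x _. symmetry. apply scal_CR.
  - apply (RInt_scal (V := CR)). now apply ccont_ex_RInt.
Qed.

Lemma RInt_CR_der f t : ccont f -> der_in full (CInt f) t (f t).
Proof.
  intros Hf. apply is_derive_der_in. apply (is_derive_RInt (V := CR)) with 0.
  - exists (mkposreal 1 Rlt_0_1). intros y _. apply (RInt_correct (V := CR)). now apply ccont_ex_RInt.
  - now apply cont_in_continuous.
Qed.

End Integrals.

(** * The fixed point *)

Section FixedPoint.

Variables (p eps M Lam J : R) (lam b : R -> C).
Hypotheses (Hp : 1 < p) (Heps : 0 < eps) (HM : 0 <= M).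
Hypothesis lam_cont : ccont lam.
Hypothesis lam_le : forall t, Cmod (lam t) <= Lam.
Hypothesis b_le : forall x, Cmod (b x) <= M.
Hypothesis b_lip : forall x y, Cmod (Cminus (b x) (b y)) <= M / eps * Rabs (x - y).
Hypothesis HJ : forall x t, Rabs (RInt (fun s => Cmod (lam s) * kap p eps (x - s)) 0 t) <= J.

(** The constant of the estimates for [psi] with c = 4 M, the size of the jump of a function bounded
    by 2 M. *)
Definition psi_const := rp (p - 1) (2 * (4 * M)).
Definition kap_sup := Rpower eps (1 - p).
(** A pointwise bound for the time derivative, with the maximum of the weight in place of its
    integral. For Lam of order eps^alpha, eps times it is of order eps^(alpha + 2 - p). *)
Definition time_lip := Lam * (psi_const * kap_sup * (4 * M)).

Hypothesis small : 16 * p * psi_const * J <= 1.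

(** The first two bounds are twice those of [b], which leaves room for the integral term. All three
    conditions survive pointwise limits; differentiability would not. *)
Definition in_class (W : R -> R -> C) : Prop :=
  (forall t x, Cmod (W t x) <= 2 * M) /\
  (forall t x y, Cmod (Cminus (W t x) (W t y)) <= 2 * M / eps * Rabs (x - y)) /\
  (forall t s x, Cmod (Cminus (W t x) (W s x)) <= time_lip * Rabs (t - s)).

(** In the coordinate x = s + t the reflection s -> -s is x -> 2 t - x, so this is, up to sign, the
    sum of the two components at radius |x - t|. *)
Definition jump (W : R -> R -> C) (t x : R) : C := Cminus (W t x) (W t (2 * t - x)).

Definition rhs (W : R -> R -> C) (t x : R) : C := Cmult (lam t) (psi p (x - t) (jump W t x)).

Definition picard (W : R -> R -> C) (t x : R) : C :=
  Cplus (b x) (CInt (fun s => rhs W s x) t).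

Lemma psi_const_ge_0 : 0 <= psi_const.
Proof. apply rp_ge_0. Qed.

Lemma kap_sup_pos : 0 < kap_sup.
Proof. apply Rpower_gt_0. Qed.

Lemma Lam_ge_0 : 0 <= Lam.
Proof. eapply Rle_trans; [apply Cmod_ge_0|apply (lam_le 0)]. Qed.

Lemma J_ge_0 : 0 <= J.
Proof. eapply Rle_trans; [apply Rabs_pos|apply (HJ 0 0)]. Qed.

Lemma Meps_ge_0 : 0 <= M / eps.
Proof. unfold Rdiv. apply Rmult_le_pos; auto. left. now apply Rinv_0_lt_compat. Qed.

Lemma time_lip_ge_0 : 0 <= time_lip.
Proof.
  unfold time_lip. assert (H := psi_const_ge_0). assert (H1 := kap_sup_pos). assert (H2 := Lam_ge_0).
  repeat apply Rmult_le_pos; lra.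
Qed.

Lemma weight_rcont x : rcont (fun s => Cmod (lam s) * kap p eps (x - s)).
Proof. apply rcont_mult. now apply rcont_Cmod. now apply rcont_kap. Qed.

(** The two arguments of the jump are 2 |x - t| apart, which turns the Lipschitz constant 2 M / eps
    into 4 M / eps; the same 4 M bounds the jump itself. *)
Lemma jump_adm W t x : in_class W -> adm (4 * M) eps (x - t) (jump W t x).
Proof.
  intros [H1 [H2 _]]. unfold jump. split.
  - eapply Rle_trans; [apply Cmod_minus_le|]. assert (H := H1 t x). assert (H' := H1 t (2 * t - x)). lra.
  - specialize (H2 t x (2 * t - x)).
    replace (x - (2 * t - x)) with (2 * (x - t)) in H2 by ring.
    rewrite Rabs_mult, (Rabs_pos_eq 2) in H2 by lra.
    apply Rle_trans with (eps * (2 * M / eps * (2 * Rabs (x - t)))).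
    + apply Rmult_le_compat_l; lra.
    + right. field. lra.
Qed.

Lemma jump_lip W t s x y : in_class W ->
  Cmod (Cminus (jump W t x) (jump W s y)) <=
    (2 * time_lip + 4 * (M / eps)) * Rabs (t - s) + 4 * (M / eps) * Rabs (x - y).
Proof.
  intros [_ [H2 H3]]. unfold jump.
  assert (E : forall x y, Cmod (Cminus (W t x) (W s y)) <= time_lip * Rabs (t - s) + 2 * M / eps * Rabs (x - y)).
  { intros x' y'. eapply Rle_trans; [apply (Cmod_minus_triangle _ (W s x'))|].
    apply Rplus_le_compat; auto. }
  replace (Cminus _ _) with (Cminus (Cminus (W t x) (W s y)) (Cminus (W t (2 * t - x)) (W s (2 * s - y)))) by ring.
  eapply Rle_trans; [apply Cmod_minus_le|].
  assert (E1 := E x y). assert (E2 := E (2 * t - x) (2 * s - y)).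
  assert (Rabs (2 * t - x - (2 * s - y)) <= 2 * Rabs (t - s) + Rabs (x - y)).
  { replace (2 * t - x - (2 * s - y)) with (2 * (t - s) - (x - y)) by ring.
    eapply Rle_trans; [apply Rabs_triang|]. rewrite Rabs_Ropp, Rabs_mult, (Rabs_pos_eq 2); lra. }
  assert (HMe := Meps_ge_0).
  replace (2 * M / eps) with (2 * (M / eps)) in * by (unfold Rdiv; ring).
  assert (2 * (M / eps) * Rabs (2 * t - x - (2 * s - y)) <= 2 * (M / eps) * (2 * Rabs (t - s) + Rabs (x - y))).
  { apply Rmult_le_compat_l; lra. }
  lra.
Qed.

Lemma rhs_le W t x : in_class W ->
  Cmod (rhs W t x) <= psi_const * (4 * M) * (Cmod (lam t) * kap p eps (x - t)).
Proof.
  intros H. unfold rhs. rewrite Cmod_mult.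
  assert (HA := jump_adm W t x H).
  assert (H1 := Cmod_psi_le p (4 * M) eps Hp ltac:(lra) Heps (x - t) _ HA).
  fold psi_const in H1. destruct HA as [HA _].
  assert (HB := psi_const_ge_0). assert (HK := kap_pos p eps (x - t)).
  replace (psi_const * (4 * M) * (Cmod (lam t) * kap p eps (x - t)))
    with (Cmod (lam t) * (psi_const * kap p eps (x - t) * (4 * M))) by ring.
  apply Rmult_le_compat_l; [apply Cmod_ge_0|].
  eapply Rle_trans; [exact H1|]. apply Rmult_le_compat_l; auto. apply Rmult_le_pos; lra.
Qed.

Lemma rhs_le_time_lip W t x : in_class W -> Cmod (rhs W t x) <= time_lip.
Proof.
  intros H. eapply Rle_trans; [now apply rhs_le|]. unfold time_lip.
  assert (HB := psi_const_ge_0). assert (HK := kap_pos p eps (x - t)).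
  assert (HK' := kap_le p eps Hp Heps (x - t)). fold kap_sup in HK'.
  assert (HL := lam_le t). assert (HL' := Cmod_ge_0 (lam t)).
  replace (Lam * (psi_const * kap_sup * (4 * M))) with (psi_const * (4 * M) * (Lam * kap_sup)) by ring.
  apply Rmult_le_compat_l; [apply Rmult_le_pos; lra|].
  apply Rmult_le_compat; lra.
Qed.

(** Of the 8, one half is the Lipschitz constant of the jump and the other the explicit dependence
    on x - t in [psi_lip]. The weight occurs at both points, so integration produces the 16 of the
    hypothesis [small]. *)
Lemma rhs_lip W t x y : in_class W ->
  Cmod (Cminus (rhs W t x) (rhs W t y)) <=
    8 * p * psi_const * (M / eps) * Rabs (x - y) *
    (Cmod (lam t) * kap p eps (x - t) + Cmod (lam t) * kap p eps (y - t)).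
Proof.
  intros H. unfold rhs.
  replace (Cminus _ _) with (Cmult (lam t) (Cminus (psi p (x - t) (jump W t x)) (psi p (y - t) (jump W t y)))) by ring.
  rewrite Cmod_mult.
  assert (H1 := psi_lip p (4 * M) eps Hp ltac:(lra) Heps _ _ _ _ (jump_adm W t x H) (jump_adm W t y H)).
  fold psi_const in H1.
  assert (H2 := jump_lip W t t x y H).
  replace (x - t - (y - t)) with (x - y) in H1 by ring.
  replace (t - t) with 0 in H2 by ring. rewrite Rabs_R0 in H2.
  replace (4 * M / eps) with (4 * (M / eps)) in H1 by (unfold Rdiv; ring).
  assert (HB := psi_const_ge_0). assert (HK := kap_pos p eps (x - t)). assert (HK' := kap_pos p eps (y - t)).
  assert (HpB : 0 <= p * psi_const * (kap p eps (x - t) + kap p eps (y - t))) by (repeat apply Rmult_le_pos; lra).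
  assert (H3 : Cmod (Cminus (psi p (x - t) (jump W t x)) (psi p (y - t) (jump W t y))) <=
    p * psi_const * (kap p eps (x - t) + kap p eps (y - t)) * (8 * (M / eps) * Rabs (x - y))).
  { eapply Rle_trans; [exact H1|]. apply Rmult_le_compat_l; auto. lra. }
  apply Rle_trans with (Cmod (lam t) * (p * psi_const * (kap p eps (x - t) + kap p eps (y - t)) * (8 * (M / eps) * Rabs (x - y)))).
  - apply Rmult_le_compat_l; auto. apply Cmod_ge_0.
  - right. ring.
Qed.

(** A qualitative statement: the weight is replaced by its maximum, so the modulus of continuity
    degenerates as eps tends to 0. *)
Lemma rhs_cont W t x : in_class W -> cont2_in full2 (rhs W) t x.
Proof.
  intros H e He.
  set (Q := p * psi_const * (2 * kap_sup) * (2 * time_lip + 12 * (M / eps))).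
  assert (HB := psi_const_ge_0). assert (HT := kap_sup_pos). assert (HL := Lam_ge_0).
  assert (HMe := Meps_ge_0). assert (HLt := time_lip_ge_0).
  assert (HQ : 0 <= Q) by (unfold Q; repeat apply Rmult_le_pos; lra).
  assert (HP : forall s y, Cmod (Cminus (psi p (y - s) (jump W s y)) (psi p (x - t) (jump W t x)))
     <= Q * (Rabs (s - t) + Rabs (y - x))).
  { intros s y.
    assert (H1 := psi_lip p (4 * M) eps Hp ltac:(lra) Heps _ _ _ _ (jump_adm W s y H) (jump_adm W t x H)).
    fold psi_const in H1. assert (H2 := jump_lip W s t y x H).
    eapply Rle_trans; [exact H1|].
    assert (HK := kap_pos p eps (x - t)). assert (HK' := kap_pos p eps (y - s)).
    assert (HL1 := kap_le p eps Hp Heps (x - t)). assert (HL2 := kap_le p eps Hp Heps (y - s)).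
    fold kap_sup in HL1, HL2.
    assert (H3 : Rabs (y - s - (x - t)) <= Rabs (s - t) + Rabs (y - x)).
    { replace (y - s - (x - t)) with ((y - x) - (s - t)) by ring.
      eapply Rle_trans; [apply Rabs_triang|]. rewrite Rabs_Ropp. lra. }
    replace (4 * M / eps) with (4 * (M / eps)) by (unfold Rdiv; ring).
    assert (A1 := Rabs_pos (s - t)). assert (A2 := Rabs_pos (y - x)).
    assert (H4 : 4 * (M / eps) * Rabs (y - s - (x - t)) <= 4 * (M / eps) * (Rabs (s - t) + Rabs (y - x)))
      by (apply Rmult_le_compat_l; lra).
    unfold Q. rewrite (Rmult_assoc (p * psi_const * (2 * kap_sup))).
    assert (0 <= M / eps * Rabs (s - t)) by (apply Rmult_le_pos; auto).
    assert (0 <= M / eps * Rabs (y - x)) by (apply Rmult_le_pos; auto).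
    assert (0 <= time_lip * Rabs (y - x)) by (apply Rmult_le_pos; auto).
    assert (A3 := Cmod_ge_0 (Cminus (jump W s y) (jump W t x))).
    assert (A4 := Rabs_pos (y - s - (x - t))).
    apply Rmult_le_compat.
    - repeat apply Rmult_le_pos; lra.
    - apply Rplus_le_le_0_compat; auto. apply Rmult_le_pos; lra.
    - apply Rmult_le_compat_l; [apply Rmult_le_pos; lra|lra].
    - lra. }
  set (P0 := Cmod (psi p (x - t) (jump W t x))).
  assert (HP0 : 0 <= P0) by apply Cmod_ge_0.
  destruct (lam_cont t (e / (2 * (1 + P0)))) as [d1 [Hd1 C1]]; [apply Rdiv_lt_0_compat; lra|].
  set (d2 := e / (4 * (1 + Lam * Q))).
  assert (HLQ : 0 <= Lam * Q) by (apply Rmult_le_pos; auto).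
  assert (Hd2 : 0 < d2) by (apply Rdiv_lt_0_compat; lra).
  exists (Rmin d1 d2). split; [now apply Rmin_pos|].
  intros s y _ Hs Hy.
  assert (Hs1 := Rlt_le_trans _ _ _ Hs (Rmin_l _ _)).
  assert (Hs2 := Rlt_le_trans _ _ _ Hs (Rmin_r _ _)).
  assert (Hy2 := Rlt_le_trans _ _ _ Hy (Rmin_r _ _)).
  specialize (C1 s I Hs1). specialize (HP s y).
  unfold rhs.
  replace (Cminus _ _) with (Cplus (Cmult (lam s) (Cminus (psi p (y - s) (jump W s y)) (psi p (x - t) (jump W t x))))
     (Cmult (Cminus (lam s) (lam t)) (psi p (x - t) (jump W t x)))) by ring.
  eapply Rle_lt_trans; [apply Cmod_triangle|]. rewrite !Cmod_mult. fold P0.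
  assert (G1 : Cmod (lam s) * Cmod (Cminus (psi p (y - s) (jump W s y)) (psi p (x - t) (jump W t x)))
     <= Lam * (Q * (d2 + d2))).
  { apply Rmult_le_compat; auto using Cmod_ge_0. eapply Rle_trans; [exact HP|].
    apply Rmult_le_compat_l; lra. }
  assert (G2 : Cmod (Cminus (lam s) (lam t)) * P0 <= e / (2 * (1 + P0)) * P0)
    by (apply Rmult_le_compat_r; lra).
  replace (e / (2 * (1 + P0)) * P0) with (e / 2 - e / (2 * (1 + P0))) in G2 by (field; lra).
  assert (0 < e / (2 * (1 + P0))) by (apply Rdiv_lt_0_compat; lra).
  replace (Lam * (Q * (d2 + d2))) with (e / 2 - 2 * d2) in G1 by (unfold d2; field; lra).
  lra.
Qed.

Lemma rhs_ccont W x : in_class W -> ccont (fun t => rhs W t x).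
Proof.
  intros H t e He. destruct (rhs_cont W t x H e He) as [d [Hd H1]]. exists d; split; auto.
  intros y _ Hy. apply H1; auto. replace (x - x) with 0 by ring. now rewrite Rabs_R0.
Qed.

Lemma picard_bound W t x : in_class W -> Cmod (Cminus (picard W t x) (b x)) <= 4 * psi_const * M * J.
Proof.
  intros H. unfold picard. replace (Cminus _ _) with (CInt (fun s => rhs W s x) t) by ring.
  assert (HB := psi_const_ge_0).
  eapply Rle_trans.
  { apply (Cmod_RInt_le _ (fun s => psi_const * (4 * M) * (Cmod (lam s) * kap p eps (x - s)))).
    - now apply rhs_ccont.
    - apply rcont_mult; [apply rcont_const|apply weight_rcont].
    - intros s. now apply rhs_le. }
  rewrite Rabs_RInt_scal by apply weight_rcont.
  rewrite Rabs_pos_eq by (apply Rmult_le_pos; lra).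
  replace (4 * psi_const * M * J) with (psi_const * (4 * M) * J) by ring.
  apply Rmult_le_compat_l; [apply Rmult_le_pos; lra|apply HJ].
Qed.

(** Stated for the deviation from [b], so that it serves twice: for the invariance of the class, and
    later for the size of the derivative of W - b. *)
Lemma picard_lip W t x y : in_class W ->
  Cmod (Cminus (Cminus (picard W t x) (b x)) (Cminus (picard W t y) (b y)))
    <= 16 * p * psi_const * J * (M / eps) * Rabs (x - y).
Proof.
  intros H. unfold picard. replace (Cminus _ _) with
    (Cminus (CInt (fun s => rhs W s x) t) (CInt (fun s => rhs W s y) t)) by ring.
  rewrite RInt_CR_minus by (now apply rhs_ccont).
  assert (HB := psi_const_ge_0). assert (HMe := Meps_ge_0). assert (HA := Rabs_pos (x - y)).
  eapply Rle_trans.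
  { apply (Cmod_RInt_le _ (fun s => 8 * p * psi_const * (M / eps) * Rabs (x - y) *
       (Cmod (lam s) * kap p eps (x - s) + Cmod (lam s) * kap p eps (y - s)))).
    - apply ccont_minus; now apply rhs_ccont.
    - apply rcont_mult; [apply rcont_const|apply rcont_plus; apply weight_rcont].
    - intros s. now apply rhs_lip. }
  assert (HC : 0 <= 8 * p * psi_const * (M / eps) * Rabs (x - y)).
  { apply Rmult_le_pos; auto. apply Rmult_le_pos; auto. repeat apply Rmult_le_pos; lra. }
  rewrite Rabs_RInt_scal by (apply rcont_plus; apply weight_rcont).
  rewrite Rabs_pos_eq by auto.
  assert (H1 := Rabs_RInt_plus _ _ t (weight_rcont x) (weight_rcont y)).
  assert (H2 := HJ x t). assert (H3 := HJ y t).
  replace (16 * p * psi_const * J * (M / eps) * Rabs (x - y))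
    with (8 * p * psi_const * (M / eps) * Rabs (x - y) * (J + J)) by ring.
  apply Rmult_le_compat_l; auto. lra.
Qed.

Lemma picard_class W : in_class W -> in_class (picard W).
Proof.
  intros H. assert (HB := psi_const_ge_0). assert (HJ0 := J_ge_0). assert (HMe := Meps_ge_0).
  assert (HBJ : 0 <= psi_const * J) by (apply Rmult_le_pos; auto).
  assert (HBJ1 : psi_const * J <= 1 / 16).
  { assert (1 * (psi_const * J) <= p * (psi_const * J)) by (apply Rmult_le_compat_r; lra). lra. }
  split; [|split].
  - intros t x. assert (H1 := picard_bound W t x H).
    assert (H2 := b_le x).
    replace (picard W t x) with (Cplus (Cminus (picard W t x) (b x)) (b x)) by ring.
    eapply Rle_trans; [apply Cmod_triangle|].
    assert (4 * psi_const * M * J <= M).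
    { replace (4 * psi_const * M * J) with (4 * (psi_const * J) * M) by ring. nra. }
    lra.
  - intros t x y. assert (H1 := picard_lip W t x y H). assert (H2 := b_lip x y).
    replace (Cminus (picard W t x) (picard W t y)) with
      (Cplus (Cminus (Cminus (picard W t x) (b x)) (Cminus (picard W t y) (b y))) (Cminus (b x) (b y))) by ring.
    eapply Rle_trans; [apply Cmod_triangle|].
    assert (HA := Rabs_pos (x - y)).
    assert (16 * p * psi_const * J * (M / eps) * Rabs (x - y) <= 1 * (M / eps) * Rabs (x - y)).
    { apply Rmult_le_compat_r; auto. apply Rmult_le_compat_r; auto. }
    replace (2 * M / eps * Rabs (x - y)) with (2 * (M / eps * Rabs (x - y))) by (unfold Rdiv; ring). lra.
  - assert (HD : forall x t, der_in full (CInt (fun s => rhs W s x)) t (rhs W t x)).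
    { intros x t. exact (RInt_CR_der (fun s => rhs W s x) t (rhs_ccont W x H)). }
    assert (HW : forall x s t, s <= t -> Cmod (Cminus (picard W t x) (picard W s x)) <= time_lip * Rabs (t - s)).
    { intros x s t Hst. unfold picard.
      replace (Cminus _ _) with (Cminus (CInt (fun s => rhs W s x) t)
        (CInt (fun s => rhs W s x) s)) by ring.
      rewrite Rabs_pos_eq by lra.
      replace (time_lip * (t - s)) with ((fun u => time_lip * u) t - (fun u => time_lip * u) s) by ring.
      apply (mean_value_ineq _ (fun u => rhs W u x) (fun u => time_lip * u) (fun _ => time_lip)); auto.
      - intros u _. assert (G := der_in_cont _ _ _ _ (HD x u)).
        intros e He. destruct (G e He) as [d [Hd G1]]. exists d; split; auto.
      - intros u. auto_derive; auto; ring.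
      - intros u _. now apply rhs_le_time_lip. }
    intros t s x. destruct (Rle_dec s t) as [Hst|Hst]; [now apply HW|].
    rewrite Cmod_minus_sym, Rabs_minus_sym. apply HW. lra.
Qed.

(** The two terms of the jump give the bound 2 p [psi_const] J D, at most D / 8; the weaker factor
    1/2 is enough for the geometric series. *)
Lemma picard_contract W V D : in_class W -> in_class V -> 
  (forall t x, Cmod (Cminus (W t x) (V t x)) <= D) ->
  forall t x, Cmod (Cminus (picard W t x) (picard V t x)) <= / 2 * D.
Proof.
  intros HW HV HD t x.
  assert (HD0 : 0 <= D) by (eapply Rle_trans; [apply Cmod_ge_0|apply (HD 0 0)]).
  unfold picard. replace (Cminus _ _) with
    (Cminus (CInt (fun s => rhs W s x) t) (CInt (fun s => rhs V s x) t)) by ring.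
  rewrite RInt_CR_minus by (now apply rhs_ccont).
  assert (HB := psi_const_ge_0).
  assert (HC : 0 <= p * psi_const * (2 * D)) by (repeat apply Rmult_le_pos; lra).
  eapply Rle_trans.
  { apply (Cmod_RInt_le _ (fun s => p * psi_const * (2 * D) * (Cmod (lam s) * kap p eps (x - s)))).
    - apply ccont_minus; now apply rhs_ccont.
    - apply rcont_mult; [apply rcont_const|apply weight_rcont].
    - intros s. unfold rhs.
      replace (Cminus _ _) with (Cmult (lam s) (Cminus (psi p (x - s) (jump W s x)) (psi p (x - s) (jump V s x)))) by ring.
      rewrite Cmod_mult.
      assert (H1 := psi_lip_same p (4 * M) eps Hp ltac:(lra) Heps _ _ _ (jump_adm W s x HW) (jump_adm V s x HV)).
      fold psi_const in H1.
      assert (H2 : Cmod (Cminus (jump W s x) (jump V s x)) <= 2 * D).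
      { unfold jump. replace (Cminus _ _) with
         (Cminus (Cminus (W s x) (V s x)) (Cminus (W s (2 * s - x)) (V s (2 * s - x)))) by ring.
        eapply Rle_trans; [apply Cmod_minus_le|]. assert (G := HD s x). assert (G' := HD s (2 * s - x)). lra. }
      assert (HK := kap_pos p eps (x - s)).
      replace (p * psi_const * (2 * D) * (Cmod (lam s) * kap p eps (x - s)))
        with (Cmod (lam s) * (p * psi_const * kap p eps (x - s) * (2 * D))) by ring.
      apply Rmult_le_compat_l; [apply Cmod_ge_0|].
      eapply Rle_trans; [exact H1|]. apply Rmult_le_compat_l; auto. repeat apply Rmult_le_pos; lra. }
  rewrite Rabs_RInt_scal by apply weight_rcont. rewrite Rabs_pos_eq by auto.
  apply Rle_trans with (p * psi_const * (2 * D) * J).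
  - apply Rmult_le_compat_l; auto.
  - replace (p * psi_const * (2 * D) * J) with (16 * p * psi_const * J * (/ 8 * D)) by field.
    assert (0 <= D) by auto. nra.
Qed.

Fixpoint iterate (n : nat) : R -> R -> C :=
  match n with O => fun _ x => b x | S n => picard (iterate n) end.

Lemma iterate_class n : in_class (iterate n).
Proof.
  induction n as [|n IH]; [|now apply picard_class].
  simpl. split; [|split].
  - intros _ x. assert (H := b_le x). lra.
  - intros _ x y. eapply Rle_trans; [apply b_lip|]. apply Rmult_le_compat_r; [apply Rabs_pos|].
    assert (H := Meps_ge_0). replace (2 * M / eps) with (2 * (M / eps)) by (unfold Rdiv; ring). lra.
  - intros t s x. replace (Cminus (b x) (b x)) with (RtoC 0) by ring. rewrite Cmod_0.
    apply Rmult_le_pos; [apply time_lip_ge_0|apply Rabs_pos].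
Qed.

Lemma iterate_step n t x : Cmod (Cminus (iterate (S n) t x) (iterate n t x)) <= 4 * M * (/ 2) ^ n.
Proof.
  revert t x. induction n as [|n IH]; intros t x.
  - eapply Rle_trans; [apply Cmod_minus_le|].
    destruct (iterate_class 1) as [H1 _]. destruct (iterate_class 0) as [H0 _].
    specialize (H1 t x). specialize (H0 t x). simpl pow. lra.
  - change (iterate (S (S n))) with (picard (iterate (S n))).
    change (iterate (S n) t x) with (picard (iterate n) t x).
    replace (4 * M * (/ 2) ^ S n) with (/ 2 * (4 * M * (/ 2) ^ n)) by (simpl; ring).
    apply picard_contract; auto using iterate_class.
Qed.

(** The pointwise limit of the iterates stays in the class, so the contraction estimate applies to
    the limit itself and identifies it as a fixed point. *)
Lemma fixed_point_exists : exists W, in_class W /\ forall t x, W t x = picard W t x.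
Proof.
  destruct (choice2 (fun t x l => forall n, Cmod (Cminus (iterate n t x) l) <= 2 * (4 * M) * (/ 2) ^ n)) as [W HW].
  { intros t x. apply C_geometric_limit; [lra|]. intros n. apply iterate_step. }
  exists W.
  assert (HC : in_class W).
  { split; [|split].
    - intros t x. apply le_of_geometric with (2 * (4 * M)). intros n. specialize (HW t x n).
      destruct (iterate_class n) as [H1 _]. specialize (H1 t x).
      assert (G := Cmod_minus_le (iterate n t x) (Cminus (iterate n t x) (W t x))).
      replace (Cminus _ (Cminus _ _)) with (W t x) in G by ring. lra.
    - intros t x y. apply le_of_geometric with (2 * (2 * (4 * M))). intros n.
      destruct (iterate_class n) as [_ [H1 _]]. specialize (H1 t x y).
      assert (H2 := HW t x n). assert (H3 := HW t y n).
      assert (G1 := Cmod_minus_triangle (W t x) (iterate n t x) (W t y)).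
      assert (G2 := Cmod_minus_triangle (iterate n t x) (iterate n t y) (W t y)).
      rewrite (Cmod_minus_sym (W t x) (iterate n t x)) in G1. lra.
    - intros t s x. apply le_of_geometric with (2 * (2 * (4 * M))). intros n.
      destruct (iterate_class n) as [_ [_ H1]]. specialize (H1 t s x).
      assert (H2 := HW t x n). assert (H3 := HW s x n).
      assert (G1 := Cmod_minus_triangle (W t x) (iterate n t x) (W s x)).
      assert (G2 := Cmod_minus_triangle (iterate n t x) (iterate n s x) (W s x)).
      rewrite (Cmod_minus_sym (W t x) (iterate n t x)) in G1. lra. }
  split; auto.
  intros t x. 
  assert (H0 : Cmod (Cminus (W t x) (picard W t x)) <= 0).
  { apply le_of_geometric with (2 * (2 * (4 * M))). intros n.
    assert (H1 := picard_contract (iterate n) W _ (iterate_class n) HC (fun t x => HW t x n) t x).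
    assert (H2 := HW t x (S n)). change (iterate (S n)) with (picard (iterate n)) in H2.
    assert (G := Cmod_minus_triangle (W t x) (picard (iterate n) t x) (picard W t x)).
    rewrite (Cmod_minus_sym (W t x) (picard (iterate n) t x)) in G. simpl pow in H2.
    assert (0 <= M * (/ 2) ^ n) by (apply Rmult_le_pos; [auto|apply pow_le; lra]). lra. }
  assert (H1 := Cmod_ge_0 (Cminus (W t x) (picard W t x))).
  assert (H2 : Cminus (W t x) (picard W t x) = RtoC 0) by (apply Cmod_eq_0; lra).
  replace (W t x) with (Cplus (Cminus (W t x) (picard W t x)) (picard W t x)) by ring.
  rewrite H2. ring.
Qed.

End FixedPoint.

(** * Differentiability of the fixed point *)

Lemma Rpower_neg_le m x q : q <= 0 -> 0 < m <= x -> Rpower x q <= Rpower m q.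
Proof.
  intros Hq H. replace q with (- (- q)) by ring. rewrite !(Rpower_Ropp _ (- q)).
  apply Rinv_le_contravar; [apply Rpower_gt_0|]. apply Rle_Rpower_l; lra.
Qed.

Lemma Rpower_neg_lip m x y q : q <= 0 -> 0 < m <= x -> m <= y ->
  Rabs (Rpower x q - Rpower y q) <= - q * Rpower m (q - 1) * Rabs (x - y).
Proof.
  intros Hq. revert x y.
  assert (W : forall x y, 0 < m <= x -> x <= y ->
    Rabs (Rpower x q - Rpower y q) <= - q * Rpower m (q - 1) * Rabs (x - y)).
  { intros x y Hx Hy. rewrite Rabs_minus_sym.
    destruct (Rpower_mvt q x y) as [c [Hc ->]]; try lra.
    rewrite !Rabs_mult, (Rabs_minus_sym y x), (Rabs_left1 q) by auto.
    rewrite (Rabs_pos_eq (Rpower _ _)) by (left; apply Rpower_gt_0).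
    apply Rmult_le_compat_r; [apply Rabs_pos|]. apply Rmult_le_compat_l; [lra|].
    apply Rpower_neg_le; lra. }
  intros x y Hx Hy. destruct (Rle_dec x y); [now apply W|].
  rewrite Rabs_minus_sym, (Rabs_minus_sym x). apply W; lra.
Qed.

(** The derivative of |s|^(1-p) away from s = 0. *)
Definition rho' (p s : R) : R := (1 - p) * Rpower (Rabs s) (- p) * sign s.

(** Since |s| >= 2 m and d <= m, the points [s1], [s2] are on the same side of 0 as [s] and at
    distance at least m from it, where the second derivative of the weight is at most (p - 1) p
    m^(-p-1). The negative side follows by reflection. *)
Lemma rho_strict_der p m s s1 s2 d : 1 < p -> 0 < m -> 2 * m <= Rabs s -> d <= m ->
  Rabs (s1 - s) <= d -> Rabs (s2 - s) <= d ->
  Rabs (Rpower (Rabs s1) (1 - p) - Rpower (Rabs s2) (1 - p) - rho' p s * (s1 - s2))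
    <= (p - 1) * p * Rpower m (- p - 1) * d * Rabs (s1 - s2).
Proof.
  intros Hp Hm Hs Hd H1 H2.
  assert (W : forall s s1 s2, 2 * m <= s -> Rabs (s1 - s) <= d -> Rabs (s2 - s) <= d ->
     Rabs (Rpower s1 (1 - p) - Rpower s2 (1 - p) - (1 - p) * Rpower s (- p) * (s1 - s2))
      <= (p - 1) * p * Rpower m (- p - 1) * d * Rabs (s1 - s2)).
  { clear - Hp Hm Hd. intros s s1 s2 Hs H1 H2.
    apply Rabs_le_between in H1. apply Rabs_le_between in H2.
    assert (E : exists c, m <= c /\ Rabs (c - s) <= d /\
      Rpower s1 (1 - p) - Rpower s2 (1 - p) = (1 - p) * Rpower c (- p) * (s1 - s2)).
    { destruct (Rle_dec s1 s2).
      - destruct (Rpower_mvt (1 - p) s1 s2) as [c [Hc E]]; try lra.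
        replace (1 - p - 1) with (- p) in E by ring.
        exists c. split; [lra|]. split; [apply Rabs_le; lra|lra].
      - destruct (Rpower_mvt (1 - p) s2 s1) as [c [Hc E]]; try lra.
        replace (1 - p - 1) with (- p) in E by ring.
        exists c. split; [lra|]. split; [apply Rabs_le; lra|lra]. }
    destruct E as [c [Hc [Hcs ->]]].
    replace ((1 - p) * Rpower c (- p) * (s1 - s2) - (1 - p) * Rpower s (- p) * (s1 - s2))
      with ((1 - p) * (Rpower c (- p) - Rpower s (- p)) * (s1 - s2)) by ring.
    rewrite !Rabs_mult, (Rabs_left1 (1 - p)) by lra.
    apply Rmult_le_compat_r; [apply Rabs_pos|].
    assert (G := Rpower_neg_lip m c s (- p) ltac:(lra) ltac:(lra) ltac:(lra)).
    replace (- - p) with p in G by ring.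
    replace (- (1 - p)) with (p - 1) by ring.
    rewrite !(Rmult_assoc (p - 1)). apply Rmult_le_compat_l; [lra|].
    eapply Rle_trans; [exact G|]. rewrite Rmult_assoc.
    rewrite (Rmult_assoc p). apply Rmult_le_compat_l; [lra|].
    apply Rmult_le_compat_l; [left; apply Rpower_gt_0|auto]. }
  unfold rho'. 
  destruct (Rle_dec 0 s) as [Hs0|Hs0].
  - rewrite (Rabs_pos_eq s) in * by auto.
    assert (0 < s) by lra. rewrite sign_eq_1 by auto.
    assert (A1 := H1). apply Rabs_le_between in A1. assert (A2 := H2). apply Rabs_le_between in A2.
    rewrite (Rabs_pos_eq s1), (Rabs_pos_eq s2) by lra. rewrite Rmult_1_r. now apply W.
  - rewrite (Rabs_left s) in * by lra. rewrite sign_eq_m1 by lra.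
    assert (A1 := H1). apply Rabs_le_between in A1. assert (A2 := H2). apply Rabs_le_between in A2.
    rewrite (Rabs_left1 s1), (Rabs_left1 s2) by lra.
    replace ((1 - p) * Rpower (- s) (- p) * -1 * (s1 - s2)) with
      ((1 - p) * Rpower (- s) (- p) * (- s1 - - s2)) by ring.
    rewrite <- (Rabs_Ropp (s1 - s2)). replace (- (s1 - s2)) with (- s1 - - s2) by ring.
    apply W; auto.
    + rewrite <- Rabs_Ropp. now replace (- (- s1 - - s)) with (s1 - s) by ring.
    + rewrite <- Rabs_Ropp. now replace (- (- s2 - - s)) with (s2 - s) by ring.
Qed.

(** The differential of [psi] at (s, y) in the direction (h, z). *)
Definition psi_der (p s : R) (y : C) (h : R) (z : C) : C :=
  Cplus (Cmult (RtoC (rho' p s * h)) (pw p y))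
        (Cmult (RtoC (Rpower (Rabs s) (1 - p))) (pw_der p y z)).

(** Product rule for strict differentials, uniform as long as [s] keeps the distance 2 m from the
    singularity; [d <= m] keeps the displaced points away from it as well. *)
Lemma psi_strict_der p m c e : 1 < p -> 0 < m -> 0 < c -> 0 < e -> exists d, 0 < d /\ d <= m /\
  forall s s1 s2 y y1 y2, 2 * m <= Rabs s -> Cmod y <= c ->
    Rabs (s1 - s) <= d -> Rabs (s2 - s) <= d -> Cmod (Cminus y1 y) <= d -> Cmod (Cminus y2 y) <= d ->
    Cmod (Cminus (Cminus (psi p s1 y1) (psi p s2 y2)) (psi_der p s y (s1 - s2) (Cminus y1 y2)))
      <= e * (Rabs (s1 - s2) + Cmod (Cminus y1 y2)).
Proof.
  intros Hp Hm Hc He.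
  set (R0 := Rpower m (1 - p)). set (R1 := (p - 1) * Rpower m (- p)).
  set (R2 := (p - 1) * p * Rpower m (- p - 1)).
  set (Q := rp (p - 1) (c + 1)).
  assert (HR0 : 0 < R0) by apply Rpower_gt_0.
  assert (HR1 : 0 < R1) by (unfold R1; apply Rmult_lt_0_compat; [lra|apply Rpower_gt_0]).
  assert (HR2 : 0 < R2) by (unfold R2; apply Rmult_lt_0_compat; [nra|apply Rpower_gt_0]).
  assert (HQ : 0 <= Q) by apply rp_ge_0.
  destruct (pw_strict_der p c (e / (2 * R0)) Hp Hc) as [d0 [Hd0 S]]; [apply Rdiv_lt_0_compat; lra|].
  set (K := R2 * (Q * (c + 1)) + R1 * (p * Q) + R1 * (p * Q)).
  assert (HpQ : 0 <= p * Q) by (apply Rmult_le_pos; lra).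
  assert (HQc : 0 <= Q * (c + 1)) by (apply Rmult_le_pos; lra).
  assert (HK : 0 <= K).
  { unfold K. assert (0 <= R2 * (Q * (c + 1))) by (apply Rmult_le_pos; lra).
    assert (0 <= R1 * (p * Q)) by (apply Rmult_le_pos; lra). lra. }
  set (d := Rmin (Rmin d0 m) (Rmin 1 (e / (2 * (1 + K))))).
  assert (He2 : 0 < e / (2 * (1 + K))) by (apply Rdiv_lt_0_compat; lra).
  assert (Hd : 0 < d) by (unfold d; repeat apply Rmin_pos; lra).
  assert (D0 : d <= d0) by (unfold d; eapply Rle_trans; [apply Rmin_l|apply Rmin_l]).
  assert (D1 : d <= m) by (unfold d; eapply Rle_trans; [apply Rmin_l|apply Rmin_r]).
  assert (D2 : d <= 1) by (unfold d; eapply Rle_trans; [apply Rmin_r|apply Rmin_l]).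
  assert (D3 : d <= e / (2 * (1 + K))) by (unfold d; eapply Rle_trans; [apply Rmin_r|apply Rmin_r]).
  assert (D4 : K * d <= e / 2).
  { apply Rle_trans with (K * (e / (2 * (1 + K)))); [apply Rmult_le_compat_l; auto|].
    replace (K * (e / (2 * (1 + K)))) with (e / 2 - e / (2 * (1 + K))) by (field; lra). lra. }
  exists d. split; auto. split; auto.
  intros s s1 s2 y y1 y2 Hs Hy Hs1 Hs2 Hy1 Hy2.
  assert (T1 := rho_strict_der p m s s1 s2 d Hp Hm Hs D1 Hs1 Hs2). fold R2 in T1.
  assert (A1 := Hs1). apply Rabs_le_between in A1. assert (A2 := Hs2). apply Rabs_le_between in A2.
  assert (B2 : m <= Rabs s2).
  { assert (G := Rabs_triang_inv s (s - s2)). replace (s - (s - s2)) with s2 in G by ring.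
    rewrite Rabs_minus_sym in Hs2. lra. }
  assert (E2 := Rpower_neg_le m (Rabs s2) (1 - p) ltac:(lra) ltac:(lra)). fold R0 in E2.
  assert (E2' := Rpower_gt_0 (Rabs s2) (1 - p)).
  assert (E3 : Rabs (Rpower (Rabs s2) (1 - p) - Rpower (Rabs s) (1 - p)) <= R1 * d).
  { eapply Rle_trans; [apply (Rpower_neg_lip m); lra|].
    replace (1 - p - 1) with (- p) by ring. replace (- (1 - p)) with (p - 1) by ring. fold R1.
    apply Rmult_le_compat_l; [lra|]. eapply Rle_trans; [apply Rabs_triang_inv2|auto]. }
  assert (E4 : Rabs (rho' p s) <= R1).
  { unfold rho'. rewrite !Rabs_mult.
    assert (Rabs (sign s) <= 1).
    { destruct (total_order_T s 0) as [[H| ->]|H].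
      - rewrite sign_eq_m1 by auto. rewrite Rabs_left; lra.
      - rewrite sign_0, Rabs_R0; lra.
      - rewrite sign_eq_1 by auto. rewrite Rabs_R1; lra. }
    rewrite (Rabs_left1 (1 - p)) by lra. rewrite Rabs_pos_eq by (left; apply Rpower_gt_0).
    assert (G := Rpower_neg_le m (Rabs s) (- p) ltac:(lra) ltac:(lra)).
    assert (G1 := Rpower_gt_0 (Rabs s) (- p)). unfold R1.
    replace (- (1 - p)) with (p - 1) by ring.
    assert (G2 : (p - 1) * Rpower (Rabs s) (- p) <= (p - 1) * Rpower m (- p)) by (apply Rmult_le_compat_l; lra).
    assert (0 <= (p - 1) * Rpower (Rabs s) (- p)) by (apply Rmult_le_pos; lra).
    rewrite <- (Rmult_1_r ((p - 1) * Rpower m (- p))).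
    apply Rmult_le_compat; auto using Rabs_pos. }
  assert (C1 : Cmod y1 <= c + 1).
  { assert (G := Cmod_minus_abs y1 y). apply Rabs_le_between in G.
    assert (Rabs (Cmod y1 - Cmod y) <= d) by (eapply Rle_trans; [apply Cmod_minus_abs|auto]).
    apply Rabs_le_between in H. lra. }
  assert (P1 : Cmod (pw p y1) <= Q * (c + 1)).
  { rewrite Cmod_pw. apply Rmult_le_compat; auto using rp_ge_0, Cmod_ge_0. apply rp_le; lra. }
  assert (P2 : Cmod (Cminus (pw p y1) (pw p y)) <= p * Q * d).
  { eapply Rle_trans; [apply (pw_lip p (c + 1)); lra|]. fold Q. apply Rmult_le_compat_l; lra. }
  assert (P3 := Cmod_pw_der p y (Cminus y1 y2) Hp).
  assert (P4 : rp (p - 1) (Cmod y) <= Q) by (apply rp_le; lra).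
  assert (P5 := S y y1 y2 Hy ltac:(lra) ltac:(lra)).
  set (X := Rabs (s1 - s2)) in *. set (Z := Cmod (Cminus y1 y2)) in *.
  assert (HX : 0 <= X) by apply Rabs_pos. assert (HZ : 0 <= Z) by apply Cmod_ge_0.
  unfold psi, psi_der.
  set (r1 := Rpower (Rabs s1) (1 - p)) in *. set (r2 := Rpower (Rabs s2) (1 - p)) in *.
  set (r := Rpower (Rabs s) (1 - p)) in *.
  replace (Cminus _ _) with
   (Cplus (Cplus (Cmult (RtoC (r1 - r2 - rho' p s * (s1 - s2))) (pw p y1))
                 (Cmult (RtoC (rho' p s * (s1 - s2))) (Cminus (pw p y1) (pw p y))))
          (Cplus (Cmult (RtoC r2) (Cminus (Cminus (pw p y1) (pw p y2)) (pw_der p y (Cminus y1 y2))))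
                 (Cmult (RtoC (r2 - r)) (pw_der p y (Cminus y1 y2))))).
  2:{ repeat rewrite ?RtoC_minus, ?RtoC_mult. ring. }
  eapply Rle_trans; [apply Cmod_triangle|].
  eapply Rle_trans; [apply Rplus_le_compat; apply Cmod_triangle|].
  rewrite !Cmod_scal, (Rabs_mult (rho' p s)). fold X.
  rewrite (Rabs_pos_eq r2) by lra.
  assert (U1 : Rabs (r1 - r2 - rho' p s * (s1 - s2)) * Cmod (pw p y1) <= (R2 * d * X) * (Q * (c + 1))).
  { apply Rmult_le_compat; auto using Rabs_pos, Cmod_ge_0. }
  assert (U2 : Rabs (rho' p s) * X * Cmod (Cminus (pw p y1) (pw p y)) <= R1 * X * (p * Q * d)).
  { apply Rmult_le_compat; auto using Cmod_ge_0.
    - apply Rmult_le_pos; auto using Rabs_pos.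
    - apply Rmult_le_compat_r; auto. }
  assert (U3 : r2 * Cmod (Cminus (Cminus (pw p y1) (pw p y2)) (pw_der p y (Cminus y1 y2))) <= R0 * (e / (2 * R0) * Z)).
  { apply Rmult_le_compat; auto using Cmod_ge_0; lra. }
  replace (R0 * (e / (2 * R0) * Z)) with (e / 2 * Z) in U3 by (field; lra).
  assert (U4 : Rabs (r2 - r) * Cmod (pw_der p y (Cminus y1 y2)) <= R1 * d * (p * Q * Z)).
  { apply Rmult_le_compat; auto using Rabs_pos, Cmod_ge_0.
    eapply Rle_trans; [exact P3|]. apply Rmult_le_compat_r; auto. apply Rmult_le_compat_l; lra. }
  assert (U5 : K * d * (X + Z) <= e / 2 * (X + Z)) by (apply Rmult_le_compat_r; lra).
  clearbody R0 R1 R2 Q.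
  assert (U6 : 0 <= R2 * (Q * (c + 1)) * d * Z) by (repeat apply Rmult_le_pos; lra).
  assert (U7 : 0 <= R1 * (p * Q) * d * Z) by (repeat apply Rmult_le_pos; lra).
  assert (U8 : 0 <= R1 * (p * Q) * d * X) by (repeat apply Rmult_le_pos; lra).
  assert (U9 : 0 <= e / 2 * X) by (apply Rmult_le_pos; lra).
  unfold K in U5. lra.
Qed.

(** For a common displacement [h] the term with the derivative of the weight cancels, and only the
    part linear in the field remains. *)
Lemma psi_der_minus p s y h z z' :
  Cminus (psi_der p s y h z) (psi_der p s y h z') =
  Cmult (RtoC (Rpower (Rabs s) (1 - p))) (pw_der p y (Cminus z z')).
Proof. unfold psi_der. rewrite pw_der_minus. ring. Qed.

Lemma psi_der_scal p s y r h z :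
  Cmult (RtoC r) (psi_der p s y h z) = psi_der p s y (r * h) (Cmult (RtoC r) z).
Proof.
  unfold psi_der. rewrite pw_der_scal.
  replace (rho' p s * (r * h)) with (r * (rho' p s * h)) by ring. rewrite (RtoC_mult r). ring.
Qed.

(* A majorant of the indicator function of [|s| <= d] with an explicit primitive. *)
Definition bump (d s : R) : R := 2 * (/ (1 + (s / d) * (s / d))).

Lemma bump_ge_1 d s : 0 < d -> Rabs s <= d -> 1 <= bump d s.
Proof.
  intros Hd Hs. unfold bump.
  assert (H : (s / d) * (s / d) <= 1).
  { assert (Rabs (s / d) <= 1).
    { unfold Rdiv. rewrite Rabs_mult, Rabs_inv, (Rabs_pos_eq d) by lra.
      apply Rmult_le_reg_r with d; auto. rewrite Rmult_assoc, Rinv_l; lra. }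
    apply Rabs_le_between in H. nra. }
  assert (0 <= (s / d) * (s / d)) by apply Rle_0_sqr.
  assert (/ 2 <= / (1 + s / d * (s / d))) by (apply Rinv_le_contravar; lra). lra.
Qed.

Lemma bump_ge_0 d s : 0 <= bump d s.
Proof.
  unfold bump. assert (0 <= (s / d) * (s / d)) by apply Rle_0_sqr.
  assert (0 < / (1 + s / d * (s / d))) by (apply Rinv_0_lt_compat; lra). lra.
Qed.

Lemma bump_derive d x t : 0 < d ->
  is_derive (fun t => - 2 * d * atan ((x - t) / d)) t (bump d (x - t)).
Proof.
  intros Hd. unfold bump. auto_derive; auto.
  assert (0 <= (x - t) * (x - t)) by apply Rle_0_sqr.
  field. split; nra.
Qed.

Lemma bump_rcont d x : 0 < d -> rcont (fun t => bump d (x - t)).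
Proof.
  intros Hd t. apply (ex_derive_continuous (fun t => bump d (x - t))).
  unfold bump. auto_derive. assert (0 <= (x - t) * / d * ((x - t) * / d)) by apply Rle_0_sqr.
  unfold Rminus, Rdiv in *. lra.
Qed.

(** The primitive is -2 d atan, and the total oscillation of atan is pi <= 4. *)
Lemma bump_integral_le d x t : 0 < d -> Rabs (RInt (fun t => bump d (x - t)) 0 t) <= 8 * d.
Proof.
  intros Hd.
  rewrite (is_RInt_unique _ _ _ _ (is_RInt_derive (fun t => - 2 * d * atan ((x - t) / d))
     (fun t => bump d (x - t)) 0 t (fun u _ => bump_derive d x u Hd) (fun u _ => bump_rcont d x Hd u))).
  unfold minus, plus, opp; simpl.
  assert (A := atan_bound ((x - t) / d)). assert (B := atan_bound ((x - 0) / d)).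
  assert (P := PI_4).
  apply Rabs_le. split; nra.
Qed.

(** * Difference quotients of the fixed point *)

Section Regularity.

Variables (p eps M Lam J : R) (lam b b' : R -> C) (W : R -> R -> C).
Hypotheses (Hp : 1 < p) (Heps : 0 < eps) (HM : 0 < M).
Hypothesis lam_cont : ccont lam.
Hypothesis lam_le : forall t, Cmod (lam t) <= Lam.
Hypothesis b_der : forall x, der_in full b x (b' x).
Hypothesis b'_unif : forall e, 0 < e -> exists d, 0 < d /\
  forall x y, Rabs (x - y) <= d -> Cmod (Cminus (b' x) (b' y)) <= e.
Hypothesis HJ : forall x t, Rabs (RInt (fun s => Cmod (lam s) * kap p eps (x - s)) 0 t) <= J.
Hypothesis small : 16 * p * psi_const p M * J <= 1.
Hypothesis W_class : in_class p eps M Lam W.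
Hypothesis W_fix : forall t x, W t x = picard p lam b W t x.

Definition quot (h t x : R) : C := Cmult (RtoC (/ h)) (Cminus (W t (x + h)) (W t x)).

Definition rquot (h t x : R) : C := Cmult (RtoC (/ h)) (Cminus (rhs p lam W t (x + h)) (rhs p lam W t x)).

Lemma M_ge_0 : 0 <= M.
Proof. lra. Qed.

Let HMe : 0 <= M / eps := Meps_ge_0 eps M Heps M_ge_0.

Lemma quot_le h t x : h <> 0 -> Cmod (quot h t x) <= 2 * (M / eps).
Proof.
  intros Hh. unfold quot. rewrite Cmod_scal, Rabs_inv.
  destruct W_class as [_ [H _]]. specialize (H t (x + h) x).
  replace (x + h - x) with h in H by ring.
  assert (G := Rabs_pos_lt h Hh).
  apply Rmult_le_reg_l with (Rabs h); auto.
  rewrite <- Rmult_assoc, Rinv_r, Rmult_1_l by lra. 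
  replace (2 * M / eps) with (2 * (M / eps)) in H by (unfold Rdiv; ring). lra.
Qed.

Lemma rquot_le h t x : h <> 0 -> Cmod (rquot h t x) <= 16 * p * psi_const p M * (M / eps) * (Lam * kap_sup p eps).
Proof.
  intros Hh. unfold rquot. rewrite Cmod_scal, Rabs_inv.
  assert (H := rhs_lip p eps M Lam lam Hp Heps M_ge_0 W t (x + h) x W_class).
  replace (x + h - x) with h in H by ring.
  assert (G := Rabs_pos_lt h Hh).
  apply Rmult_le_reg_l with (Rabs h); auto.
  rewrite <- Rmult_assoc, Rinv_r, Rmult_1_l by lra.
  eapply Rle_trans; [exact H|].
  assert (K : forall y, Cmod (lam t) * kap p eps (y - t) <= Lam * kap_sup p eps).
  { intros y. apply Rmult_le_compat; auto using Cmod_ge_0.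
    left; apply kap_pos. now apply kap_le. }
  assert (K1 := K (x + h)). assert (K2 := K x).
  assert (HB := psi_const_ge_0 p M).
  assert (HC : 0 <= 8 * p * psi_const p M * (M / eps) * Rabs h).
  { apply Rmult_le_pos; [|lra]. apply Rmult_le_pos; auto. apply Rmult_le_pos; lra. }
  replace (Rabs h * (16 * p * psi_const p M * (M / eps) * (Lam * kap_sup p eps)))
    with (8 * p * psi_const p M * (M / eps) * Rabs h * (Lam * kap_sup p eps + Lam * kap_sup p eps)) by ring.
  apply Rmult_le_compat_l; auto. lra.
Qed.

Lemma rhs_W_ccont x : ccont (fun t => rhs p lam W t x).
Proof. apply (rhs_ccont p eps M Lam lam Hp Heps M_ge_0 lam_cont lam_le W x W_class). Qed.

Lemma rquot_ccont h x : ccont (fun t => rquot h t x).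
Proof. apply ccont_scal, ccont_minus; apply rhs_W_ccont. Qed.

Lemma quot_eq h t x : quot h t x =
  Cplus (Cmult (RtoC (/ h)) (Cminus (b (x + h)) (b x))) (CInt (fun s => rquot h s x) t).
Proof.
  unfold quot, rquot. rewrite !W_fix. unfold picard.
  rewrite RInt_CR_scal by (apply ccont_minus; apply rhs_W_ccont).
  rewrite <- RInt_CR_minus by apply rhs_W_ccont. ring.
Qed.

(** The reflection x -> 2 s - x reverses increments, so the reflected quotient has step [-h]. This
    is why steps of both signs are compared throughout. *)
Lemma jump_quot h s x : h <> 0 ->
  Cminus (jump W s (x + h)) (jump W s x) =
  Cmult (RtoC h) (Cplus (quot h s x) (quot (- h) s (2 * s - x))).
Proof.
  intros Hh. unfold quot, jump.
  replace (2 * s - (x + h)) with (2 * s - x + - h) by ring.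
  assert (E : Cmult (RtoC h) (RtoC (/ h)) = RtoC 1) by (rewrite <- RtoC_mult, Rinv_r; auto).
  replace (/ - h) with (- / h) by (field; auto). rewrite (RtoC_opp (/ h)).
  transitivity (Cmult (Cmult (RtoC h) (RtoC (/ h)))
    (Cminus (Cminus (W s (x + h)) (W s x)) (Cminus (W s (2 * s - x + - h)) (W s (2 * s - x))))).
  - rewrite E. ring.
  - ring.
Qed.

(** At distance d1 from the crossing the quotients satisfy the linearised equation up to a multiple
    of eta, so their difference is driven by the differences of the quotients at [x] and at its
    reflection. The radius [d] depends on d1 and eta, not on [Om]. *)
Lemma rquot_close d1 eta : 0 < d1 -> 0 < eta -> exists d, 0 < d /\
  forall s x x' h k Om, d1 <= Rabs (x - s) -> Rabs (x - x') <= d ->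
    h <> 0 -> Rabs h <= d -> k <> 0 -> Rabs k <= d ->
    Cmod (Cminus (quot h s x) (quot k s x')) <= Om ->
    Cmod (Cminus (quot (- h) s (2 * s - x)) (quot (- k) s (2 * s - x'))) <= Om ->
    Cmod (Cminus (rquot h s x) (rquot k s x')) <=
      Lam * eta + 2 * p * psi_const p M * Om * (Cmod (lam s) * kap p eps (x - s)).
Proof.
  intros Hd1 Heta.
  set (e := eta / (2 * (1 + 4 * (M / eps)))).
  assert (He : 0 < e) by (apply Rdiv_lt_0_compat; lra).
  destruct (psi_strict_der p (d1 / 2) (4 * M) e Hp ltac:(lra) ltac:(lra) He) as [d0 [Hd0 [_ S]]].
  set (d := d0 / (2 * (1 + 4 * (M / eps)))).
  assert (Hd : 0 < d) by (apply Rdiv_lt_0_compat; lra).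
  assert (Hdd : 2 * d + 4 * (M / eps) * (2 * d) = d0) by (unfold d; field; lra).
  assert (Hmd : 0 <= 4 * (M / eps) * d) by (apply Rmult_le_pos; lra).
  exists d. split; auto.
  intros s x x' h k Om Hxs Hxx Hh Hhd Hk Hkd HO1 HO2.
  set (y := jump W s x).
  assert (Hy : adm (4 * M) eps (x - s) y) by (apply (jump_adm p eps M Lam); auto using M_ge_0).
  assert (HOm : 0 <= Om) by (eapply Rle_trans; [apply Cmod_ge_0|apply HO1]).
  assert (Hjl : forall z, Rabs (z - x) <= 2 * d -> Cmod (Cminus (jump W s z) y) <= d0).
  { intros z Hz. unfold y.
    assert (G := jump_lip p eps M Lam Heps M_ge_0 W s s z x W_class).
    replace (s - s) with 0 in G by ring. rewrite Rabs_R0 in G.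
    assert (4 * (M / eps) * Rabs (z - x) <= 4 * (M / eps) * (2 * d)) by (apply Rmult_le_compat_l; lra).
    lra. }
  (* Both quotients are expanded at the same base point, so that only the linearity of the
     derivative is used, not its modulus of continuity. *)
  assert (Key : forall z l, l <> 0 -> Rabs l <= d -> Rabs (z - x) <= d ->
     Cmod (Cminus (rquot l s z) (Cmult (lam s) (psi_der p (x - s) y 1 (Cplus (quot l s z) (quot (- l) s (2 * s - z))))))
       <= Cmod (lam s) * (eta / 2)).
  { intros z l Hl Hld Hz. unfold rquot, rhs.
    assert (Hl0 := Rabs_pos_lt l Hl).
    set (xi := Cplus (quot l s z) (quot (- l) s (2 * s - z))).
    assert (Hxi : Cmod xi <= 4 * (M / eps)).
    { unfold xi. eapply Rle_trans; [apply Cmod_triangle|].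
      assert (G1 := quot_le l s z Hl). assert (G2 := quot_le (- l) s (2 * s - z) ltac:(lra)). lra. }
    assert (A1 := Hz). apply Rabs_le_between in A1.
    assert (A2 := Hld). apply Rabs_le_between in A2.
    assert (G := S (x - s) (z + l - s) (z - s) y (jump W s (z + l)) (jump W s z) ltac:(lra)
       ltac:(apply Hy)).
    rewrite (jump_quot l s z Hl) in G. fold xi in G.
    replace (z + l - s - (z - s)) with (l * 1) in G by ring.
    rewrite <- psi_der_scal in G. rewrite Rmult_1_r, Cmod_scal in G.
    assert (G' : Cmod (Cminus (Cminus (psi p (z + l - s) (jump W s (z + l))) (psi p (z - s) (jump W s z)))
       (Cmult (RtoC l) (psi_der p (x - s) y 1 xi))) <= e * (Rabs l + Rabs l * Cmod xi)).
    { apply G.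
      - apply Rabs_le; lra.
      - apply Rabs_le; lra.
      - apply Hjl. apply Rabs_le; lra.
      - apply Hjl. apply Rabs_le; lra. }
    replace (Cminus _ _) with (Cmult (lam s) (Cmult (RtoC (/ l))
      (Cminus (Cminus (psi p (z + l - s) (jump W s (z + l))) (psi p (z - s) (jump W s z)))
       (Cmult (RtoC l) (psi_der p (x - s) y 1 xi))))).
    2:{ assert (E : Cmult (RtoC (/ l)) (RtoC l) = RtoC 1) by (rewrite <- RtoC_mult, Rinv_l; auto).
        transitivity (Cminus (Cmult (RtoC (/ l)) (Cminus (Cmult (lam s) (psi p (z + l - s) (jump W s (z + l))))
          (Cmult (lam s) (psi p (z - s) (jump W s z)))))
          (Cmult (Cmult (RtoC (/ l)) (RtoC l)) (Cmult (lam s) (psi_der p (x - s) y 1 xi)))).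
        - ring.
        - rewrite E. ring. }
    rewrite Cmod_mult. apply Rmult_le_compat_l; [apply Cmod_ge_0|].
    rewrite Cmod_scal, Rabs_inv.
    apply Rmult_le_reg_l with (Rabs l); auto.
    rewrite <- Rmult_assoc, Rinv_r, Rmult_1_l by lra.
    eapply Rle_trans; [exact G'|].
    replace (e * (Rabs l + Rabs l * Cmod xi)) with (Rabs l * (e * (1 + Cmod xi))) by ring.
    apply Rmult_le_compat_l; [lra|].
    replace (eta / 2) with (e * (1 + 4 * (M / eps))) by (unfold e; field; lra).
    apply Rmult_le_compat_l; lra. }
  assert (K1 := Key x h Hh Hhd ltac:(replace (x - x) with 0 by ring; rewrite Rabs_R0; lra)).
  assert (K2 := Key x' k Hk Hkd ltac:(rewrite Rabs_minus_sym; auto)).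
  set (xi := Cplus (quot h s x) (quot (- h) s (2 * s - x))) in *.
  set (xi' := Cplus (quot k s x') (quot (- k) s (2 * s - x'))) in *.
  assert (Hxi : Cmod (Cminus xi xi') <= 2 * Om).
  { replace (Cminus xi xi') with (Cplus (Cminus (quot h s x) (quot k s x'))
      (Cminus (quot (- h) s (2 * s - x)) (quot (- k) s (2 * s - x')))) by (unfold xi, xi'; ring).
    eapply Rle_trans; [apply Cmod_triangle|]. lra. }
  assert (K3 : Cmod (Cminus (psi_der p (x - s) y 1 xi) (psi_der p (x - s) y 1 xi'))
     <= 2 * p * psi_const p M * Om * kap p eps (x - s)).
  { rewrite psi_der_minus, Cmod_scal, Rabs_pos_eq by (left; apply Rpower_gt_0).
    assert (Hw := weight_adm p (4 * M) eps Hp ltac:(lra) Heps (x - s) y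
       ltac:(intros E; rewrite E, Rabs_R0 in Hxs; lra) Hy). fold (psi_const p M) in Hw.
    assert (Hr := Rpower_gt_0 (Rabs (x - s)) (1 - p)). assert (Hrp := rp_ge_0 (p - 1) (Cmod y)).
    set (r := Rpower (Rabs (x - s)) (1 - p)) in *.
    assert (HL := Cmod_pw_der p y (Cminus xi xi') Hp).
    assert (H1 : r * Cmod (pw_der p y (Cminus xi xi')) <= r * (p * rp (p - 1) (Cmod y) * (2 * Om))).
    { apply Rmult_le_compat_l; [lra|]. eapply Rle_trans; [exact HL|].
      apply Rmult_le_compat_l; auto. apply Rmult_le_pos; lra. }
    assert (H2 : r * rp (p - 1) (Cmod y) * (2 * p * Om) <= psi_const p M * kap p eps (x - s) * (2 * p * Om)).
    { apply Rmult_le_compat_r; auto. apply Rmult_le_pos; lra. }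
    lra. }
  assert (HLs := lam_le s). assert (HL0 := Cmod_ge_0 (lam s)).
  set (A := Cmult (lam s) (psi_der p (x - s) y 1 xi)) in *.
  set (A' := Cmult (lam s) (psi_der p (x - s) y 1 xi')) in *.
  replace (Cminus (rquot h s x) (rquot k s x')) with
    (Cplus (Cminus (Cminus (rquot h s x) A) (Cminus (rquot k s x') A')) (Cminus A A')) by ring.
  eapply Rle_trans; [apply Cmod_triangle|].
  assert (T1 := Cmod_minus_le (Cminus (rquot h s x) A) (Cminus (rquot k s x') A')).
  assert (T2 : Cmod (Cminus A A') <= Cmod (lam s) * (2 * p * psi_const p M * Om * kap p eps (x - s))).
  { unfold A, A'. replace (Cminus _ _) with (Cmult (lam s) (Cminus (psi_der p (x - s) y 1 xi) (psi_der p (x - s) y 1 xi'))) by ring.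
    rewrite Cmod_mult. apply Rmult_le_compat_l; auto. }
  assert (T3 : Cmod (lam s) * eta <= Lam * eta) by (apply Rmult_le_compat_r; lra).
  lra.
Qed.

(** All small steps of either sign and all nearby base points are compared at once, which makes the
    condition invariant under the reflection sending (x, h) to (2 t - x, -h). *)
Definition quot_close (T d Om : R) : Prop :=
  forall t x x' h k, Rabs t <= T -> Rabs (x - x') <= d ->
    h <> 0 -> Rabs h <= d -> k <> 0 -> Rabs k <= d ->
    Cmod (Cminus (quot h t x) (quot k t x')) <= Om.

(** Each quotient of [b] is close to [b'] at its base point by the mean value inequality, and [b']
    is uniformly continuous. *)
Lemma b_quot_close e : 0 < e -> exists d, 0 < d /\ forall x x' h k,
  Rabs (x - x') <= d -> h <> 0 -> Rabs h <= d -> k <> 0 -> Rabs k <= d ->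
  Cmod (Cminus (Cmult (RtoC (/ h)) (Cminus (b (x + h)) (b x)))
               (Cmult (RtoC (/ k)) (Cminus (b (x' + k)) (b x')))) <= e.
Proof.
  intros He. destruct (b'_unif (e / 3)) as [d [Hd U]]; [lra|].
  exists (d / 2). split; [lra|]. intros x x' h k Hx Hh Hhd Hk Hkd.
  assert (K : forall z l, l <> 0 -> Rabs l <= d / 2 ->
     Cmod (Cminus (Cmult (RtoC (/ l)) (Cminus (b (z + l)) (b z))) (b' z)) <= e / 3).
  { intros z l Hl Hld. assert (Hl0 := Rabs_pos_lt l Hl).
    assert (G := mean_value_affine b b' (b' z) (e / 3) z d (fun u _ => b_der u)
       (fun u Hu => U u z (Rlt_le _ _ Hu)) z (z + l)).
    replace (z - z) with 0 in G by ring. replace (z + l - z) with l in G by ring.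
    rewrite Rabs_R0 in G. specialize (G ltac:(lra) ltac:(lra)).
    replace (Cminus _ _) with (Cmult (RtoC (/ l)) (Cminus (Cminus (b (z + l)) (b z)) (Cmult (RtoC l) (b' z)))).
    2:{ assert (E : Cmult (RtoC (/ l)) (RtoC l) = RtoC 1) by (rewrite <- RtoC_mult, Rinv_l; auto).
        transitivity (Cminus (Cmult (RtoC (/ l)) (Cminus (b (z + l)) (b z)))
           (Cmult (Cmult (RtoC (/ l)) (RtoC l)) (b' z))); [ring|rewrite E; ring]. }
    rewrite Cmod_scal, Rabs_inv. apply Rmult_le_reg_l with (Rabs l); auto.
    rewrite <- Rmult_assoc, Rinv_r, Rmult_1_l by lra. lra. }
  assert (K1 := K x h Hh Hhd). assert (K2 := K x' k Hk Hkd).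
  assert (K3 := U x x' ltac:(lra)).
  eapply Rle_trans; [apply (Cmod_minus_triangle _ (b' x))|].
  assert (G := Cmod_minus_triangle (b' x) (b' x') (Cmult (RtoC (/ k)) (Cminus (b (x' + k)) (b x')))).
  rewrite (Cmod_minus_sym (b' x') (Cmult _ _)) in G. lra.
Qed.

(** The radius [d] is chosen before [Om]; this allows the gain of a factor 1/2 to be iterated
    without shrinking [d]. *)
Lemma quot_close_step T e : 0 < T -> 0 < e -> exists d, 0 < d /\
  forall Om, 0 <= Om -> quot_close T d Om -> quot_close T d (e + Om / 2).
Proof.
  intros HT He.
  set (C0 := 16 * p * psi_const p M * (M / eps) * (Lam * kap_sup p eps)).
  assert (HL : 0 <= Lam) by (apply (Lam_ge_0 Lam lam lam_le)).
  assert (HB := psi_const_ge_0 p M). assert (Hpt := kap_sup_pos p eps).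
  assert (HC0 : 0 <= C0).
  { unfold C0. apply Rmult_le_pos; [|apply Rmult_le_pos; lra].
    apply Rmult_le_pos; auto. apply Rmult_le_pos; lra. }
  (* The crossing costs at most 2 C0 times the integral of the bump, that is 16 C0 d1, which must
     stay below e / 3. *)
  set (d1 := e / (48 * (1 + C0))). assert (Hd1 : 0 < d1) by (apply Rdiv_lt_0_compat; lra).
  set (eta := e / (3 * (1 + T * Lam))).
  assert (HTL : 0 <= T * Lam) by (apply Rmult_le_pos; lra).
  assert (Heta : 0 < eta) by (apply Rdiv_lt_0_compat; lra).
  destruct (rquot_close d1 eta Hd1 Heta) as [d2 [Hd2 C2]].
  destruct (b_quot_close (e / 3)) as [d3 [Hd3 C3]]; [lra|].
  exists (Rmin d2 d3). split; [now apply Rmin_pos|].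
  intros Om HOm HP t x x' h k Ht Hx Hh Hhd Hk Hkd.
  assert (M2 := Rmin_l d2 d3). assert (M3 := Rmin_r d2 d3).
  rewrite !quot_eq.
  set (Bx := Cmult (RtoC (/ h)) (Cminus (b (x + h)) (b x))).
  set (Bx' := Cmult (RtoC (/ k)) (Cminus (b (x' + k)) (b x'))).
  assert (HBx : Cmod (Cminus Bx Bx') <= e / 3) by (apply C3; auto; lra).
  replace (Cminus _ _) with (Cplus (Cminus Bx Bx')
     (Cminus (CInt (fun s => rquot h s x) t) (CInt (fun s => rquot k s x') t))) by ring.
  eapply Rle_trans; [apply Cmod_triangle|].
  rewrite RInt_CR_minus by apply rquot_ccont.
  set (H1 := fun s : R => Lam * eta).
  set (H2 := fun s : R => 2 * p * psi_const p M * Om * (Cmod (lam s) * kap p eps (x - s))).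
  set (H3 := fun s : R => 2 * C0 * bump d1 (x - s)).
  assert (HpO : 0 <= 2 * p * psi_const p M * Om) by (apply Rmult_le_pos; auto; apply Rmult_le_pos; lra).
  assert (Q1 : rcont H1) by apply rcont_const.
  assert (Q2 : rcont H2) by (apply rcont_mult; [apply rcont_const|apply weight_rcont; auto]).
  assert (Q3 : rcont H3) by (apply rcont_mult; [apply rcont_const|apply bump_rcont; auto]).
  assert (N1 : 0 <= Lam * eta) by (apply Rmult_le_pos; lra).
  assert (N2 : forall s, 0 <= H2 s).
  { intros s. apply Rmult_le_pos; auto. apply Rmult_le_pos; [apply Cmod_ge_0|left; apply kap_pos]. }
  assert (N3 : forall s, 0 <= H3 s).
  { intros s. apply Rmult_le_pos; [lra|apply bump_ge_0]. }
  assert (I0 : Cmod (CInt (fun s => Cminus (rquot h s x) (rquot k s x')) t)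
     <= Rabs (RInt (fun s => H1 s + (H2 s + H3 s)) 0 t)).
  { apply Cmod_RInt_le_in.
    - apply ccont_minus; apply rquot_ccont.
    - apply rcont_plus; [|apply rcont_plus]; assumption.
    - intros s. specialize (N2 s). specialize (N3 s). unfold H1. lra.
    (* Away from the crossing the linearised estimate gives [H1] and [H2]; near it only the uniform
       bound [C0] is available, and the bump in [H3] pays for it. *)
    - intros s Hs. destruct (Rle_dec d1 (Rabs (x - s))) as [Hf|Hn].
      + assert (G := C2 s x x' h k Om Hf ltac:(lra) Hh ltac:(lra) Hk ltac:(lra)
          (HP s x x' h k ltac:(lra) Hx Hh Hhd Hk Hkd)).
        assert (G1 : Cmod (Cminus (quot (- h) s (2 * s - x)) (quot (- k) s (2 * s - x'))) <= Om).
        { apply HP; try rewrite Rabs_Ropp; auto; try lra.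
          replace (2 * s - x - (2 * s - x')) with (- (x - x')) by ring. now rewrite Rabs_Ropp. }
        specialize (G G1). specialize (N3 s). unfold H1, H2. unfold H2 in G. lra.
      + assert (G := bump_ge_1 d1 (x - s) Hd1 ltac:(lra)).
        assert (G1 := rquot_le h s x Hh). assert (G2 := rquot_le k s x' Hk). fold C0 in G1, G2.
        assert (G3 := Cmod_minus_le (rquot h s x) (rquot k s x')). specialize (N2 s).
        assert (2 * C0 * 1 <= H3 s) by (apply Rmult_le_compat_l; lra). unfold H1. lra. }
  assert (I1 := Rabs_RInt_plus H1 (fun s => H2 s + H3 s) t Q1 (rcont_plus _ _ Q2 Q3)).
  assert (I2 := Rabs_RInt_plus H2 H3 t Q2 Q3).
  assert (J1 : Rabs (RInt H1 0 t) <= e / 3).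
  { unfold H1. rewrite RInt_const. unfold scal; simpl; unfold mult; simpl.
    rewrite Rabs_mult, Rminus_0_r, (Rabs_pos_eq (Lam * eta)) by auto.
    apply Rle_trans with (T * (Lam * eta)); [apply Rmult_le_compat_r; auto|].
    replace (T * (Lam * eta)) with (e / 3 - eta) by (unfold eta; field; lra). lra. }
  assert (J2 : Rabs (RInt H2 0 t) <= Om / 2).
  { unfold H2. rewrite Rabs_RInt_scal by (apply weight_rcont; auto).
    rewrite Rabs_pos_eq by auto.
    apply Rle_trans with (2 * p * psi_const p M * Om * J); [apply Rmult_le_compat_l; auto|].
    replace (2 * p * psi_const p M * Om * J) with (16 * p * psi_const p M * J * (Om / 8)) by field.
    apply Rle_trans with (1 * (Om / 8)); [apply Rmult_le_compat_r; lra|lra]. }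
  assert (J3 : Rabs (RInt H3 0 t) <= e / 3).
  { unfold H3. rewrite Rabs_RInt_scal by (apply bump_rcont; auto).
    rewrite Rabs_pos_eq by lra.
    apply Rle_trans with (2 * C0 * (8 * d1)); [apply Rmult_le_compat_l; [lra|now apply bump_integral_le]|].
    replace (2 * C0 * (8 * d1)) with (e / 3 - 16 * d1) by (unfold d1; field; lra). lra. }
  lra.
Qed.

(** The recursion Om -> e / 2 + Om / 2 has the fixed point e, approached geometrically from an
    initial value given by the a priori bound 4 M / eps. *)
Lemma quot_cauchy T e : 0 < T -> 0 < e -> exists d, 0 < d /\ quot_close T d e.
Proof.
  intros HT He. destruct (quot_close_step T (e / 2) HT ltac:(lra)) as [d [Hd S]].
  exists d. split; auto.
  assert (HI : forall n, quot_close T d (e + 4 * (M / eps) * (/ 2) ^ n)).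
  { induction n as [|n IH].
    - intros t x x' h k _ _ Hh _ Hk _. eapply Rle_trans; [apply Cmod_minus_le|].
      assert (G1 := quot_le h t x Hh). assert (G2 := quot_le k t x' Hk). simpl. lra.
    - assert (0 <= (/ 2) ^ n) by (apply pow_le; lra).
      assert (0 <= 4 * (M / eps) * (/ 2) ^ n) by (apply Rmult_le_pos; lra).
      assert (G := S (e + 4 * (M / eps) * (/ 2) ^ n) ltac:(lra) IH).
      intros t x x' h k H1 H2 H3 H4 H5 H6. simpl pow.
      specialize (G t x x' h k H1 H2 H3 H4 H5 H6). lra. }
  intros t x x' h k H1 H2 H3 H4 H5 H6. apply le_of_geometric with (4 * (M / eps)).
  intros n. now apply HI.
Qed.

(** The limit is selected along the steps 1 / (n + 1); the Cauchy property then extends the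
    convergence to all steps, uniformly for bounded times. *)
Lemma quot_limit : exists H : R -> R -> C, forall T e, 0 < T -> 0 < e -> exists d, 0 < d /\
  forall t x h, Rabs t <= T -> h <> 0 -> Rabs h <= d -> Cmod (Cminus (quot h t x) (H t x)) <= e.
Proof.
  set (hn := fun n => / (INR n + 1)).
  assert (Hn0 : forall n, 0 < hn n).
  { intros n. apply Rinv_0_lt_compat. assert (G := pos_INR n). lra. }
  assert (Hn1 : forall d, 0 < d -> exists N, forall n, (N <= n)%nat -> hn n <= d).
  { intros d Hd. destruct (archimed_cor1 d Hd) as [N [HN HN0]]. exists N. intros n Hn.
    apply Rle_trans with (/ INR N); [|lra]. apply Rinv_le_contravar.
    - now apply lt_0_INR.
    - apply le_INR in Hn. lra. }
  destruct (choice2 (fun t x l => forall e, 0 < e -> exists N, forall n, (N <= n)%nat ->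
     Cmod (Cminus (quot (hn n) t x) l) <= e)) as [H HH].
  { intros t x. apply C_complete. intros e He.
    assert (HT : 0 < 1 + Rabs t) by (assert (G := Rabs_pos t); lra).
    destruct (quot_cauchy (1 + Rabs t) e HT He) as [d [Hd Q]].
    destruct (Hn1 d Hd) as [N HN]. exists N. intros n m Hn Hm.
    assert (A1 := Hn0 n). assert (A2 := Hn0 m).
    apply Q; try (rewrite Rabs_pos_eq by lra); auto; try lra. }
  exists H. intros T e HT He. destruct (quot_cauchy T (e / 2) HT ltac:(lra)) as [d [Hd Q]].
  exists d. split; auto. intros t x h Ht Hh Hhd.
  destruct (HH t x (e / 2) ltac:(lra)) as [N1 HN1]. destruct (Hn1 d Hd) as [N2 HN2].
  set (n := Nat.max N1 N2). specialize (HN1 n ltac:(lia)). specialize (HN2 n ltac:(lia)).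
  eapply Rle_trans; [apply (Cmod_minus_triangle _ (quot (hn n) t x))|].
  assert (A1 := Hn0 n).
  assert (Cmod (Cminus (quot h t x) (quot (hn n) t x)) <= e / 2); [|lra].
  apply Q; auto; try lra.
  - replace (x - x) with 0 by ring. rewrite Rabs_R0. lra.
  - rewrite Rabs_pos_eq; lra.
Qed.

(** The step is fixed here, so the Lipschitz bounds of the class suffice, with a constant that grows
    like 1 / |h|. *)
Lemma quot_cont2 h t x : cont2_in full2 (quot h) t x.
Proof.
  intros e He.
  destruct W_class as [_ [L1 L2]].
  assert (HL : 0 <= time_lip p eps M Lam) by (apply (time_lip_ge_0 p eps M Lam lam M_ge_0 lam_le)).
  assert (Hi := Rabs_pos (/ h)).
  set (L := time_lip p eps M Lam + 2 * (M / eps)).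
  set (Q := 1 + Rabs (/ h) * (2 * L)).
  assert (HLL : 0 <= L) by (unfold L; lra).
  assert (HQ0 : 0 <= Rabs (/ h) * (2 * L)) by (apply Rmult_le_pos; lra).
  assert (HQ : 0 < Q) by (unfold Q; lra).
  exists (e / Q). split; [apply Rdiv_lt_0_compat; lra|].
  intros s y _ Hs Hy. unfold quot.
  assert (G : forall l, Cmod (Cminus (W s (y + l)) (W t (x + l))) <= L * (e / Q)).
  { intros l. eapply Rle_trans; [apply (Cmod_minus_triangle _ (W t (y + l)))|].
    assert (E1 := L2 s t (y + l)). assert (E2 := L1 t (y + l) (x + l)).
    replace (y + l - (x + l)) with (y - x) in E2 by ring.
    replace (2 * M / eps) with (2 * (M / eps)) in E2 by (unfold Rdiv; ring).
    assert (F1 : time_lip p eps M Lam * Rabs (s - t) <= time_lip p eps M Lam * (e / Q)) by (apply Rmult_le_compat_l; lra).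
    assert (F2 : 2 * (M / eps) * Rabs (y - x) <= 2 * (M / eps) * (e / Q)) by (apply Rmult_le_compat_l; lra).
    unfold L. lra. }
  replace (Cminus _ _) with (Cmult (RtoC (/ h)) (Cminus (Cminus (W s (y + h)) (W t (x + h)))
     (Cminus (W s y) (W t x)))) by ring.
  rewrite Cmod_scal.
  assert (G1 := G h). assert (G2 := G 0). rewrite !Rplus_0_r in G2.
  assert (G3 := Cmod_minus_le (Cminus (W s (y + h)) (W t (x + h))) (Cminus (W s y) (W t x))).
  assert (G4 : Rabs (/ h) * Cmod (Cminus (Cminus (W s (y + h)) (W t (x + h))) (Cminus (W s y) (W t x)))
    <= Rabs (/ h) * (2 * L * (e / Q))) by (apply Rmult_le_compat_l; lra).
  replace (Rabs (/ h) * (2 * L * (e / Q))) with (e - e / Q) in G4 by (unfold Q; field; fold Q; lra).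
  assert (0 < e / Q) by (apply Rdiv_lt_0_compat; lra). lra.
Qed.

(** Continuity is inherited from the difference quotients, which converge uniformly on bounded time
    intervals. The last bound is the Lipschitz estimate for W - b passed to the derivative. *)
Lemma space_derivative : exists H : R -> R -> C,
  (forall t x, der_in full (W t) x (H t x)) /\
  (forall t x, cont2_in full2 H t x) /\
  (forall t x, Cmod (Cminus (H t x) (b' x)) <= 16 * p * psi_const p M * J * (M / eps)).
Proof.
  destruct quot_limit as [H HH]. exists H.
  assert (HD : forall t x, der_in full (W t) x (H t x)).
  { intros t x e He.
    assert (HT : 0 < 1 + Rabs t) by (assert (G := Rabs_pos t); lra).
    destruct (HH (1 + Rabs t) e HT He) as [d [Hd Q]].
    exists d. split; auto. intros y _ Hy.
    destruct (Req_dec y x) as [->|Hyx].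
    { replace (x - x) with 0 by ring. rewrite Rabs_R0, Rmult_0_r.
      replace (Cminus _ _) with (RtoC 0) by ring. rewrite Cmod_0. lra. }
    assert (Hh : y - x <> 0) by lra.
    specialize (Q t x (y - x) ltac:(lra) Hh ltac:(lra)). unfold quot in Q.
    replace (x + (y - x)) with y in Q by ring.
    replace (Cminus _ _) with (Cmult (RtoC (y - x))
      (Cminus (Cmult (RtoC (/ (y - x))) (Cminus (W t y) (W t x))) (H t x))).
    2:{ assert (E : Cmult (RtoC (y - x)) (RtoC (/ (y - x))) = RtoC 1) by (rewrite <- RtoC_mult, Rinv_r; auto).
        transitivity (Cminus (Cmult (Cmult (RtoC (y - x)) (RtoC (/ (y - x)))) (Cminus (W t y) (W t x)))
          (Cmult (RtoC (y - x)) (H t x))); [ring|rewrite E; ring]. }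
    rewrite Cmod_scal, Rmult_comm. apply Rmult_le_compat_r; [apply Rabs_pos|auto]. }
  split; auto. split.
  - intros t x e He.
    assert (HT : 0 < 2 + Rabs t) by (assert (G := Rabs_pos t); lra).
    destruct (HH (2 + Rabs t) (e / 4) HT) as [d [Hd Q]]; [lra|].
    destruct (quot_cont2 d t x (e / 4)) as [d1 [Hd1 C]]; [lra|].
    exists (Rmin d1 1). split; [apply Rmin_pos; lra|].
    intros s y _ Hs Hy.
    assert (Hs1 := Rlt_le_trans _ _ _ Hs (Rmin_l _ _)).
    assert (Hs2 := Rlt_le_trans _ _ _ Hs (Rmin_r _ _)).
    assert (Hy1 := Rlt_le_trans _ _ _ Hy (Rmin_l _ _)).
    specialize (C s y I Hs1 Hy1).
    assert (Habs : Rabs s <= 2 + Rabs t).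
    { replace s with ((s - t) + t) by ring. eapply Rle_trans; [apply Rabs_triang|]. lra. }
    assert (Q1 := Q s y d Habs ltac:(lra) ltac:(rewrite Rabs_pos_eq; lra)).
    assert (Q2 := Q t x d ltac:(lra) ltac:(lra) ltac:(rewrite Rabs_pos_eq; lra)).
    rewrite Cmod_minus_sym in Q1.
    eapply Rle_lt_trans; [apply (Cmod_minus_triangle _ (quot d s y))|].
    assert (G := Cmod_minus_triangle (quot d s y) (quot d t x) (H t x)). lra.
  - intros t x.
    set (L := 16 * p * psi_const p M * J * (M / eps)).
    apply Rnot_lt_le. intros Hlt.
    (* A quarter of the supposed excess over [L]: the two difference quotients cost 2 e together,
       which is less than the excess. *)
    set (e := (Cmod (Cminus (H t x) (b' x)) - L) / 4).
    assert (He : 0 < e) by (unfold e; lra).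
    destruct (HD t x e He) as [d1 [Hd1 D1]]. destruct (b_der x e He) as [d2 [Hd2 D2]].
    set (h := Rmin d1 d2 / 2).
    assert (M1 := Rmin_l d1 d2). assert (M2 := Rmin_r d1 d2).
    assert (0 < Rmin d1 d2) by (now apply Rmin_pos).
    assert (Hh : 0 < h) by (unfold h; lra).
    specialize (D1 (x + h) I). specialize (D2 (x + h) I).
    replace (x + h - x) with h in D1, D2 by ring. rewrite Rabs_pos_eq in D1, D2 by lra.
    specialize (D1 ltac:(unfold h; lra)). specialize (D2 ltac:(unfold h; lra)).
    assert (G := picard_lip p eps M Lam J lam b Hp Heps M_ge_0 lam_cont lam_le HJ W t (x + h) x W_class).
    rewrite <- !W_fix in G. fold L in G. replace (x + h - x) with h in G by ring.
    rewrite Rabs_pos_eq in G by lra.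
    assert (E : h * Cmod (Cminus (H t x) (b' x)) <= (L + 2 * e) * h).
    { rewrite <- (Rabs_pos_eq h) at 1 by lra. rewrite <- Cmod_scal.
      replace (Cmult (RtoC h) (Cminus (H t x) (b' x))) with
        (Cminus (Cminus (Cminus (W t (x + h)) (b (x + h))) (Cminus (W t x) (b x)))
          (Cminus (Cminus (Cminus (W t (x + h)) (W t x)) (Cmult (RtoC h) (H t x)))
                  (Cminus (Cminus (b (x + h)) (b x)) (Cmult (RtoC h) (b' x))))) by ring.
      eapply Rle_trans; [apply Cmod_minus_le|].
      assert (G1 := Cmod_minus_le (Cminus (Cminus (W t (x + h)) (W t x)) (Cmult (RtoC h) (H t x)))
                  (Cminus (Cminus (b (x + h)) (b x)) (Cmult (RtoC h) (b' x)))).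
      lra. }
    assert (E1 : Cmod (Cminus (H t x) (b' x)) <= L + 2 * e).
    { apply Rmult_le_reg_l with h; auto. lra. }
    unfold e in E1. lra.
Qed.

End Regularity.

(** * Derivatives and continuity relative to a subset *)

Lemma is_filter_lim_within_id (D : R -> Prop) (x : R) :
  is_filter_lim (within D (locally x)) x.
Proof.
  intros P [d Hd]. exists d. intros y Hy _. now apply Hd.
Qed.

(** The notion [filterdiff] quantifies over all limit points of its filter; within a set that
    contains [x], the point [x] is the only one. *)
Lemma is_filter_lim_within_unique (D : R -> Prop) (x y : R) :
  D x -> is_filter_lim (within D (locally x)) y -> x = y.
Proof.
  intros Dx H. destruct (Req_dec x y) as [E|E]; auto. exfalso.
  assert (Hd : 0 < Rabs (x - y)) by (apply Rabs_pos_lt; lra).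
  destruct (H (fun z => Rabs (z - y) < Rabs (x - y))) as [d G].
  - exists (mkposreal _ Hd). intros z Hz. exact Hz.
  - specialize (G x (ball_center x d) Dx). lra.
Qed.

Lemma filterdiff_within_der_in (D : R -> Prop) (f : R -> C) (x : R) (l : C) :
  D x ->
  filterdiff (V := CR) f (within D (locally x)) (fun h : R => scal h l) <-> der_in D f x l.
Proof.
  intros Dx. split.
  - intros [_ H] e He.
    destruct (H x (is_filter_lim_within_id D x) (mkposreal e He)) as [d Hd].
    exists d. split; [apply cond_pos|]. intros y Dy Hy. specialize (Hd y Hy Dy). simpl in Hd.
    rewrite !minus_CR, norm_CR, scal_CR in Hd. exact Hd.
  - intros H. split.
    + apply (is_linear_scal_l (V := CR)).
    + intros x' Hx'. apply is_filter_lim_within_unique in Hx'; auto. subst x'.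
      intros e. destruct (H e (cond_pos e)) as [d [Hd G]].
      exists (mkposreal d Hd). intros y Hy Dy. specialize (G y Dy Hy).
      rewrite !minus_CR, norm_CR, scal_CR. exact G.
Qed.

Lemma filterdiff_within_der_in_R (D : R -> Prop) (f : R -> R) (x l : R) :
  filterdiff (V := R_CompleteNormedModule) f (within D (locally x)) (fun h : R => scal h l) ->
  der_in D (fun s => RtoC (f s)) x (RtoC l).
Proof.
  intros [_ H] e He.
  destruct (H x (is_filter_lim_within_id D x) (mkposreal e He)) as [d Hd].
  exists d. split; [apply cond_pos|]. intros y Dy Hy. specialize (Hd y Hy Dy). simpl in Hd.
  rewrite <- RtoC_mult, <- !RtoC_minus, Cmod_R. exact Hd.
Qed.

Lemma der_in_unique (D : R -> Prop) f x l l' :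
  (forall d, 0 < d -> exists y, D y /\ y <> x /\ Rabs (y - x) < d) ->
  der_in D f x l -> der_in D f x l' -> l = l'.
Proof.
  intros HD H H'.
  assert (E : Cmod (Cminus l l') <= 0).
  { apply Rnot_lt_le. intros Hlt.
    set (e := Cmod (Cminus l l') / 3).
    destruct (H e) as [d [Hd G]]; [unfold e; lra|]. destruct (H' e) as [d' [Hd' G']]; [unfold e; lra|].
    destruct (HD (Rmin d d')) as [y [Dy [Hy Hyd]]]; [now apply Rmin_pos|].
    specialize (G y Dy (Rlt_le_trans _ _ _ Hyd (Rmin_l _ _))).
    specialize (G' y Dy (Rlt_le_trans _ _ _ Hyd (Rmin_r _ _))).
    assert (Hp : 0 < Rabs (y - x)) by (apply Rabs_pos_lt; lra).
    assert (K : Rabs (y - x) * Cmod (Cminus l l') <= 2 * e * Rabs (y - x)).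
    { rewrite <- Cmod_scal.
      replace (Cmult _ _) with (Cminus (Cminus (Cminus (f y) (f x)) (Cmult (RtoC (y - x)) l'))
        (Cminus (Cminus (f y) (f x)) (Cmult (RtoC (y - x)) l))) by ring.
      eapply Rle_trans; [apply Cmod_minus_le|]. lra. }
    assert (K1 : Cmod (Cminus l l') <= 2 * e) by (apply Rmult_le_reg_l with (Rabs (y - x)); lra).
    unfold e in K1. lra. }
  assert (E1 := Cmod_ge_0 (Cminus l l')).
  assert (E2 : Cminus l l' = RtoC 0) by (apply Cmod_eq_0; lra).
  replace l with (Cplus (Cminus l l') l') by ring. rewrite E2. ring.
Qed.

Lemma der_in_sub (D D' : R -> Prop) f x l :
  (forall y, D' y -> D y) -> der_in D f x l -> der_in D' f x l.
Proof.
  intros HD H e He. destruct (H e He) as [d [Hd G]]. exists d. split; auto.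
Qed.

Lemma der_in_full_sub (D : R -> Prop) f x l : der_in full f x l -> der_in D f x l.
Proof. now apply der_in_sub. Qed.

Lemma der_in_interior (D : R -> Prop) f x l r : 0 < r ->
  (forall y, Rabs (y - x) < r -> D y) -> der_in D f x l -> der_in full f x l.
Proof.
  intros Hr HD H e He. destruct (H e He) as [d [Hd G]].
  exists (Rmin d r). split; [now apply Rmin_pos|]. intros y _ Hy. apply G.
  - apply HD. eapply Rlt_le_trans; [exact Hy|apply Rmin_r].
  - eapply Rlt_le_trans; [exact Hy|apply Rmin_l].
Qed.

Lemma der_in_full_unique f x l l' : der_in full f x l -> der_in full f x l' -> l = l'.
Proof.
  apply der_in_unique. intros d Hd. exists (x + d / 2). repeat split; try lra.
  replace (x + d / 2 - x) with (d / 2) by ring. rewrite Rabs_pos_eq; lra.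
Qed.

(** Locates the supports of the partial derivatives of a profile: they vanish at every point around
    which the profile does. *)
Lemma der_in_full_locally_0 f x l d : 0 < d -> (forall y, Rabs (y - x) < d -> f y = RtoC 0) ->
  der_in full f x l -> l = RtoC 0.
Proof.
  intros Hd Hf Hl. apply (der_in_full_unique f x); auto.
  intros e He. exists d. split; auto. intros y _ Hy. rewrite (Hf y Hy), (Hf x).
  - replace (Cminus _ _) with (RtoC 0) by ring. rewrite Cmod_0.
    apply Rmult_le_pos; [lra|apply Rabs_pos].
  - rewrite Rminus_eq_0, Rabs_R0; auto.
Qed.

Lemma der_in_ext (D : R -> Prop) f h x l :
  (forall y, f y = h y) -> der_in D f x l -> der_in D h x l.
Proof.
  intros E H e He. destruct (H e He) as [d [Hd G]]. exists d. split; auto.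
  intros y Dy Hy. rewrite <- !E. auto.
Qed.

Lemma der_in_minus D f h x l m :
  der_in D f x l -> der_in D h x m -> der_in D (fun y => Cminus (f y) (h y)) x (Cminus l m).
Proof.
  intros H1 H2 e He.
  destruct (H1 (e / 2)) as [d1 [Hd1 G1]]; [lra|]. destruct (H2 (e / 2)) as [d2 [Hd2 G2]]; [lra|].
  exists (Rmin d1 d2). split; [now apply Rmin_pos|]. intros y Dy Hy.
  specialize (G1 y Dy (Rlt_le_trans _ _ _ Hy (Rmin_l _ _))).
  specialize (G2 y Dy (Rlt_le_trans _ _ _ Hy (Rmin_r _ _))).
  replace (Cminus _ _) with (Cminus (Cminus (Cminus (f y) (f x)) (Cmult (RtoC (y - x)) l))
    (Cminus (Cminus (h y) (h x)) (Cmult (RtoC (y - x)) m))) by ring.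
  eapply Rle_trans; [apply Cmod_minus_le|]. lra.
Qed.

Lemma der_in_opp D f x l : der_in D f x l -> der_in D (fun y => Copp (f y)) x (Copp l).
Proof.
  intros H e He. destruct (H e He) as [d [Hd G]]. exists d. split; auto.
  intros y Dy Hy. rewrite <- Cmod_opp.
  replace (Copp _) with (Cminus (Cminus (f y) (f x)) (Cmult (RtoC (y - x)) l)) by ring. auto.
Qed.

Lemma continuous_on_cont2_in (D : R * R -> Prop) (f : R * R -> C) :
  continuous_on (T := prod_UniformSpace R_UniformSpace R_UniformSpace) (U := CR) D f <->
  forall x y, D (x, y) -> cont2_in (fun u v => D (u, v)) (fun u v => f (u, v)) x y.
Proof.
  split.
  - intros H x y Hxy e He.
    assert (G := proj1 (filterlim_locally_ball_norm (U := CR) f (f (x, y))) (H (x, y) Hxy) (mkposreal e He)).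
    destruct G as [d Hd]. exists d. split; [apply cond_pos|].
    intros u v Duv Hu Hv. specialize (Hd (u, v) (conj Hu Hv) Duv).
    unfold ball_norm in Hd. rewrite minus_CR, norm_CR in Hd. exact Hd.
  - intros H [x y] Hxy. apply (filterlim_locally_ball_norm (U := CR)). intros e.
    destruct (H x y Hxy e (cond_pos e)) as [d [Hd G]]. exists (mkposreal d Hd).
    intros [u v] [Hu Hv] Duv. unfold ball_norm. rewrite minus_CR, norm_CR. now apply G.
Qed.

Lemma continuous_on_cont2_in_R (D : R * R -> Prop) (f : R * R -> R) :
  continuous_on (T := prod_UniformSpace R_UniformSpace R_UniformSpace) (U := R_CompleteNormedModule) D f ->
  forall x y, D (x, y) -> cont2_in (fun u v => D (u, v)) (fun u v => RtoC (f (u, v))) x y.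
Proof.
  intros H x y Hxy e He.
  assert (G := proj1 (filterlim_locally_ball_norm (U := R_NormedModule) f (f (x, y))) (H (x, y) Hxy) (mkposreal e He)).
  destruct G as [d Hd]. exists d. split; [apply cond_pos|].
  intros u v Duv Hu Hv. specialize (Hd (u, v) (conj Hu Hv) Duv).
  rewrite <- RtoC_minus, Cmod_R. exact Hd.
Qed.

Lemma cont2_in_interior (D : R -> R -> Prop) f x y r : 0 < r ->
  (forall u v, Rabs (u - x) < r -> Rabs (v - y) < r -> D u v) -> cont2_in D f x y -> cont2_in full2 f x y.
Proof.
  intros Hr HD H e He. destruct (H e He) as [d [Hd G]].
  exists (Rmin d r). split; [now apply Rmin_pos|]. intros u v _ Hu Hv. apply G.
  - apply HD; (eapply Rlt_le_trans; [eassumption|apply Rmin_r]).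
  - eapply Rlt_le_trans; [exact Hu|apply Rmin_l].
  - eapply Rlt_le_trans; [exact Hv|apply Rmin_l].
Qed.

Lemma cont2_in_plus D f h x y :
  cont2_in D f x y -> cont2_in D h x y -> cont2_in D (fun u v => Cplus (f u v) (h u v)) x y.
Proof.
  intros H1 H2 e He.
  destruct (H1 (e / 2)) as [d1 [Hd1 G1]]; [lra|]. destruct (H2 (e / 2)) as [d2 [Hd2 G2]]; [lra|].
  exists (Rmin d1 d2). split; [now apply Rmin_pos|]. intros u v Duv Hu Hv.
  specialize (G1 u v Duv (Rlt_le_trans _ _ _ Hu (Rmin_l _ _)) (Rlt_le_trans _ _ _ Hv (Rmin_l _ _))).
  specialize (G2 u v Duv (Rlt_le_trans _ _ _ Hu (Rmin_r _ _)) (Rlt_le_trans _ _ _ Hv (Rmin_r _ _))).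
  replace (Cminus _ _) with (Cplus (Cminus (f u v) (f x y)) (Cminus (h u v) (h x y))) by ring.
  eapply Rle_lt_trans; [apply Cmod_triangle|]. lra.
Qed.

Lemma cont2_in_opp D f x y : cont2_in D f x y -> cont2_in D (fun u v => Copp (f u v)) x y.
Proof.
  intros H e He. destruct (H e He) as [d [Hd G]]. exists d. split; auto.
  intros u v Duv Hu Hv. rewrite <- Cmod_opp.
  replace (Copp _) with (Cminus (f u v) (f x y)) by ring. auto.
Qed.

Lemma cont2_in_char D f s t r : Rabs s <= 1 ->
  cont2_in full2 f t (t + s * r) -> cont2_in D (fun t r => f t (t + s * r)) t r.
Proof.
  intros Hs H e He. destruct (H e He) as [d [Hd G]]. exists (d / 2). split; [lra|].
  intros u v _ Hu Hv. apply G; auto; [lra|].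
  replace (u + s * v - (t + s * r)) with ((u - t) + s * (v - r)) by ring.
  eapply Rle_lt_trans; [apply Rabs_triang|]. rewrite Rabs_mult.
  assert (Hv0 := Rabs_pos (v - r)). nra.
Qed.

(** Continuity is relative to [D], so the bound is obtained directly from a finite cover by boxes on
    each of which [f] varies by less than 1. *)
Lemma bounded_on_rectangle (D : R -> R -> Prop) (f : R -> R -> C) a b a' b' :
  (forall x y, a <= x <= b -> a' <= y <= b' -> D x y /\ cont2_in D f x y) ->
  exists B, 0 <= B /\ forall x y, a <= x <= b -> a' <= y <= b' -> Cmod (f x y) <= B.
Proof.
  intros H.
  destruct (choice2 (fun x y d => 0 < d /\ (a <= x <= b -> a' <= y <= b' ->
     forall u v, D u v -> Rabs (u - x) < d -> Rabs (v - y) < d -> Cmod (Cminus (f u v) (f x y)) < 1)))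
    as [dl Hdl].
  { intros x y.
    destruct (Rle_dec a x); [|exists 1; split; [lra|intros; lra]].
    destruct (Rle_dec x b); [|exists 1; split; [lra|intros; lra]].
    destruct (Rle_dec a' y); [|exists 1; split; [lra|intros; lra]].
    destruct (Rle_dec y b'); [|exists 1; split; [lra|intros; lra]].
    destruct (H x y) as [_ C]; auto. destruct (C 1 Rlt_0_1) as [d [Hd G]]. exists d. auto. }
  (* The finite cover given by [compactness_list] comes under a double negation, so the bound is
     obtained by contradiction. *)
  apply NNPP. intros HN.
  apply (compactness_list 2 (a, (a', tt)) (b, (b', tt))
    (fun t => mkposreal _ (proj1 (Hdl (fst t) (fst (snd t)))))).
  intros [l Hl]. apply HN.
  assert (HB : exists B, 0 <= B /\ forall t, List.In t l -> Cmod (f (fst t) (fst (snd t))) <= B).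
  { clear. induction l as [|t l [B [HB IH]]].
    - exists 0. split; [lra|]. intros t [].
    - exists (Rmax B (Cmod (f (fst t) (fst (snd t))))). split.
      + eapply Rle_trans; [exact HB|apply Rmax_l].
      + intros u [<-|Hu]; [apply Rmax_r|]. eapply Rle_trans; [now apply IH|apply Rmax_l]. }
  destruct HB as [B [HB0 HB]]. exists (B + 1). split; [lra|].
  intros x y Hx Hy. destruct (Hl (x, (y, tt))) as [[t1 [t2 []]] [Hin [[Ht1 [Ht2 _]] [C1 [C2 _]]]]].
  { simpl. auto. }
  specialize (HB _ Hin). simpl in *.
  destruct (Hdl t1 t2) as [Hp G]. specialize (G Ht1 Ht2 x y).
  destruct (H x y Hx Hy) as [Dxy _]. simpl in C1, C2. specialize (G Dxy C1 C2).
  assert (T := Cmod_minus_abs (f x y) (f t1 t2)).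
  assert (T1 := Rle_abs (Cmod (f x y) - Cmod (f t1 t2))). lra.
Qed.

(** * Functions of class C^1 on a slab *)

Section Slab.

Variable T : Rbar.
Hypothesis HT : Rbar_lt 0 T.

(** Since T > 0, each time slice accumulates at all its points; this makes the one-sided time
    derivatives at t = 0 and t = T unique. *)
Lemma slab_t_acc t r : slab T (t, r) ->
  forall d, 0 < d -> exists y, slab T (y, r) /\ y <> t /\ Rabs (y - t) < d.
Proof.
  unfold slab; simpl. intros [H1 [H2 H3]] d Hd.
  destruct (Req_dec t 0) as [->|Ht].
  - destruct T as [T'| |]; simpl in *; try contradiction.
    + exists (Rmin (d / 2) T'). assert (0 < Rmin (d / 2) T') by (apply Rmin_pos; lra).
      assert (G1 := Rmin_l (d / 2) T'). assert (G2 := Rmin_r (d / 2) T').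
      repeat split; try lra. rewrite Rminus_0_r, Rabs_pos_eq; lra.
    + exists (d / 2). repeat split; try lra. rewrite Rminus_0_r, Rabs_pos_eq; lra.
  - exists (Rmax 0 (t - d / 2)).
    assert (G1 := Rmax_l 0 (t - d / 2)). assert (G2 := Rmax_r 0 (t - d / 2)).
    assert (G3 : Rmax 0 (t - d / 2) < t) by (apply Rmax_lub_lt; lra).
    repeat split; try lra.
    + destruct T as [T'| |]; simpl in *; auto; lra.
    + rewrite Rabs_left; lra.
Qed.

Lemma slab_r_acc t r : slab T (t, r) ->
  forall d, 0 < d -> exists y, slab T (t, y) /\ y <> r /\ Rabs (y - r) < d.
Proof.
  unfold slab; simpl. intros [H1 [H2 H3]] d Hd. exists (r + d / 2).
  repeat split; auto; try lra. replace (r + d / 2 - r) with (d / 2) by ring. rewrite Rabs_pos_eq; lra.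
Qed.

Lemma is_partial1_slab f t r l : slab T (t, r) ->
  is_partial1 (V := CR) (slab T) f (t, r) l <-> der_in (fun s => slab T (s, r)) (fun s => f (s, r)) t l.
Proof. intros H. unfold is_partial1; simpl. now apply filterdiff_within_der_in. Qed.

Lemma is_partial2_slab f t r l : slab T (t, r) ->
  is_partial2 (V := CR) (slab T) f (t, r) l <-> der_in (fun s => slab T (t, s)) (fun s => f (t, s)) r l.
Proof. intros H. unfold is_partial2; simpl. now apply filterdiff_within_der_in. Qed.

(** The value selected by [iota] is known to be the derivative only once the derivative is unique,
    hence the accumulation lemma. *)
Lemma partial1_slab f t r l : slab T (t, r) ->
  der_in (fun s => slab T (s, r)) (fun s => f (s, r)) t l -> partial1 (V := CR) (slab T) f (t, r) = l.
Proof.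
  intros H Hl. unfold partial1.
  assert (G : is_partial1 (V := CR) (slab T) f (t, r) (iota (is_partial1 (V := CR) (slab T) f (t, r)))).
  { apply (iota_correct (V := CR)). exists l. split.
    - now apply is_partial1_slab.
    - intros l' Hl'. apply is_partial1_slab in Hl'; auto.
      eapply der_in_unique; eauto. now apply slab_t_acc. }
  apply is_partial1_slab in G; auto. eapply der_in_unique; eauto. now apply slab_t_acc.
Qed.

Lemma partial2_slab f t r l : slab T (t, r) ->
  der_in (fun s => slab T (t, s)) (fun s => f (t, s)) r l -> partial2 (V := CR) (slab T) f (t, r) = l.
Proof.
  intros H Hl. unfold partial2.
  assert (G : is_partial2 (V := CR) (slab T) f (t, r) (iota (is_partial2 (V := CR) (slab T) f (t, r)))).
  { apply (iota_correct (V := CR)). exists l. split.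
    - now apply is_partial2_slab.
    - intros l' Hl'. apply is_partial2_slab in Hl'; auto.
      eapply der_in_unique; eauto. now apply slab_r_acc. }
  apply is_partial2_slab in G; auto. eapply der_in_unique; eauto. now apply slab_r_acc.
Qed.

Lemma Ck_on_1_intro (f f1 f2 : R * R -> C) :
  (forall t r, slab T (t, r) -> der_in (fun s => slab T (s, r)) (fun s => f (s, r)) t (f1 (t, r))) ->
  (forall t r, slab T (t, r) -> der_in (fun s => slab T (t, s)) (fun s => f (t, s)) r (f2 (t, r))) ->
  (forall t r, slab T (t, r) -> cont2_in (fun u v => slab T (u, v)) (fun u v => f (u, v)) t r) ->
  (forall t r, slab T (t, r) -> cont2_in (fun u v => slab T (u, v)) (fun u v => f1 (u, v)) t r) ->
  (forall t r, slab T (t, r) -> cont2_in (fun u v => slab T (u, v)) (fun u v => f2 (u, v)) t r) ->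
  Ck_on (V := CR) 1 (slab T) f.
Proof.
  intros H1 H2 C0 C1 C2. split; [|split; [|split; [|split; split; auto]]].
  - now apply continuous_on_cont2_in.
  - intros [t r] H. exists (f1 (t, r)). apply is_partial1_slab; auto.
  - intros [t r] H. exists (f2 (t, r)). apply is_partial2_slab; auto.
  - apply continuous_on_ext with f1.
    + intros [t r] H. symmetry. apply partial1_slab; auto.
    + now apply continuous_on_cont2_in.
  - apply continuous_on_ext with f2.
    + intros [t r] H. symmetry. apply partial2_slab; auto.
    + now apply continuous_on_cont2_in.
Qed.

Lemma Ck_on_1_elim (f : R * R -> C) : Ck_on (V := CR) 1 (slab T) f ->
  (forall t r, slab T (t, r) ->
     der_in (fun s => slab T (s, r)) (fun s => f (s, r)) t (partial1 (V := CR) (slab T) f (t, r))) /\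
  (forall t r, slab T (t, r) ->
     der_in (fun s => slab T (t, s)) (fun s => f (t, s)) r (partial2 (V := CR) (slab T) f (t, r))) /\
  (forall t r, slab T (t, r) -> cont2_in (fun u v => slab T (u, v)) (fun u v => f (u, v)) t r) /\
  (forall t r, slab T (t, r) ->
     cont2_in (fun u v => slab T (u, v)) (fun u v => partial1 (V := CR) (slab T) f (u, v)) t r) /\
  (forall t r, slab T (t, r) ->
     cont2_in (fun u v => slab T (u, v)) (fun u v => partial2 (V := CR) (slab T) f (u, v)) t r).
Proof.
  intros [C0 [E1 [E2 [[C1 _] [C2 _]]]]]. split; [|split; [|split; [|split]]].
  - intros t r H. destruct (E1 _ H) as [l Hl]. apply is_partial1_slab in Hl; auto.
    rewrite (partial1_slab f t r l); auto.
  - intros t r H. destruct (E2 _ H) as [l Hl]. apply is_partial2_slab in Hl; auto.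
    rewrite (partial2_slab f t r l); auto.
  - now apply continuous_on_cont2_in.
  - now apply continuous_on_cont2_in.
  - now apply continuous_on_cont2_in.
Qed.

(** Characteristics meet the boundary of the slab at their end points only; there the mean value
    inequality asks for mere continuity, so interior points suffice here. *)
Lemma slab_line_der f t r s : Ck_on (V := CR) 1 (slab T) f ->
  0 < t -> Rbar_lt t T -> 0 < r ->
  der_in full (fun u => f (u, r + s * (u - t))) t
    (Cplus (partial1 (V := CR) (slab T) f (t, r)) (Cmult (RtoC s) (partial2 (V := CR) (slab T) f (t, r)))).
Proof.
  intros Hf Ht HtT Hr. destruct (Ck_on_1_elim f Hf) as [D1 [D2 [_ [C1 _]]]].
  assert (HI : exists e, 0 < e /\ forall u v, Rabs (u - t) < e -> Rabs (v - r) < e -> slab T (u, v)).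
  { assert (HTr : exists e, 0 < e /\ forall u, Rabs (u - t) < e -> Rbar_le u T).
    { destruct T as [T'| |]; simpl in *; try contradiction.
      - exists (T' - t). split; [lra|]. intros u Hu. apply Rabs_lt_between in Hu. lra.
      - exists 1. split; [lra|auto]. }
    destruct HTr as [e [He HTr]].
    exists (Rmin e (Rmin t r)). split; [repeat apply Rmin_pos; auto|].
    intros u v Hu Hv. assert (M1 := Rmin_l e (Rmin t r)). assert (M2 := Rmin_r e (Rmin t r)).
    assert (M3 := Rmin_l t r). assert (M4 := Rmin_r t r).
    unfold slab; simpl. split; [|split].
    - apply Rabs_lt_between in Hu. lra.
    - apply HTr. lra.
    - apply Rabs_lt_between in Hv. lra. }
  destruct HI as [e [He HI]].
  assert (Htr : slab T (t, r)).
  { apply HI; rewrite Rminus_eq_0, Rabs_R0; auto. }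
  assert (G := der_along_line (fun u v => f (u, v)) (fun u v => partial1 (V := CR) (slab T) f (u, v))
     (partial2 (V := CR) (slab T) f (t, r)) t r t 1 s e He).
  apply (der_in_ext _ _ (fun u => f (u, r + s * (u - t)))) in G.
  - rewrite Cmult_1_l in G. exact G.
  - intros y. do 2 f_equal; ring.
  - intros u v Hu Hv. apply (der_in_interior (fun s => slab T (s, v))) with (e - Rabs (u - t)).
    + lra.
    + intros y Hy. apply HI; auto. replace (y - t) with ((y - u) + (u - t)) by ring.
      eapply Rle_lt_trans; [apply Rabs_triang|]. lra.
    + apply D1. apply HI; auto.
  - apply (cont2_in_interior (fun u v => slab T (u, v))) with e; auto.
  - apply (der_in_interior (fun s => slab T (t, s))) with e; auto.
    intros y Hy. apply HI; auto. rewrite Rminus_eq_0, Rabs_R0; auto.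
Qed.

End Slab.

(** * Existence and uniqueness for the mixed problem *)

Section PlaneSolution.

Variables (T : Rbar) (F : R -> C -> C) (bm bp : R -> C) (W Wt Wx : R -> R -> C).
Hypothesis HT : Rbar_lt 0 T.
Hypothesis W_t : forall t x, der_in full (fun t => W t x) t (Wt t x).
Hypothesis W_x : forall t x, der_in full (W t) x (Wx t x).
Hypothesis W_cont : forall t x, cont2_in full2 W t x.
Hypothesis Wt_cont : forall t x, cont2_in full2 Wt t x.
Hypothesis Wx_cont : forall t x, cont2_in full2 Wx t x.

(** In the coordinate x = s + t the incoming component is read off at s = r, and the outgoing one,
    with a change of sign, at s = -r. *)
Definition incoming (W : R -> R -> C) (q : R * R) : C := W (fst q) (fst q + snd q).
Definition outgoing (W : R -> R -> C) (q : R * R) : C := Copp (W (fst q) (fst q - snd q)).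

(** Taking the slope [s] to be 1 or -1 treats both components at once. *)
Lemma char_der_t s t r :
  der_in full (fun u => W u (u + s * r)) t (Cplus (Wt t (t + s * r)) (Wx t (t + s * r))).
Proof.
  assert (G := der_along_line W Wt (Wx t (t + s * r)) t (t + s * r) t 1 1 1 Rlt_0_1
    (fun u v _ _ => W_t u v) (Wt_cont _ _) (W_x _ _)).
  rewrite !Cmult_1_l in G. eapply der_in_ext; [|exact G]. intros u; simpl. f_equal; ring.
Qed.

Lemma char_der_r s t r :
  der_in full (fun u => W t (t + s * u)) r (Cmult (RtoC s) (Wx t (t + s * r))).
Proof.
  assert (G := der_along_line W Wt (Wx t (t + s * r)) t (t + s * r) r 0 s 1 Rlt_0_1
    (fun u v _ _ => W_t u v) (Wt_cont _ _) (W_x _ _)).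
  replace (Cplus _ _) with (Cmult (RtoC s) (Wx t (t + s * r))) in G by ring.
  eapply der_in_ext; [|exact G]. intros u; simpl. f_equal; ring.
Qed.

Lemma char_plus (V : R -> R -> C) t r : V t (t + 1 * r) = V t (t + r).
Proof. f_equal; ring. Qed.

Lemma char_minus (V : R -> R -> C) t r : V t (t + -1 * r) = V t (t - r).
Proof. f_equal; ring. Qed.

Lemma incoming_der_t t r : der_in full (fun u => incoming W (u, r)) t (Cplus (Wt t (t + r)) (Wx t (t + r))).
Proof.
  assert (G := char_der_t 1 t r). rewrite !char_plus in G.
  eapply der_in_ext; [|exact G]. intros u. apply char_plus.
Qed.

Lemma incoming_der_r t r : der_in full (fun u => incoming W (t, u)) r (Wx t (t + r)).
Proof.
  assert (G := char_der_r 1 t r). rewrite !char_plus, Cmult_1_l in G.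
  eapply der_in_ext; [|exact G]. intros u. apply char_plus.
Qed.

Lemma outgoing_der_t t r :
  der_in full (fun u => outgoing W (u, r)) t (Copp (Cplus (Wt t (t - r)) (Wx t (t - r)))).
Proof.
  assert (G := char_der_t (-1) t r). rewrite !char_minus in G. apply der_in_opp in G.
  eapply der_in_ext; [|exact G]. intros u. unfold outgoing; simpl. now rewrite char_minus.
Qed.

Lemma outgoing_der_r t r : der_in full (fun u => outgoing W (t, u)) r (Wx t (t - r)).
Proof.
  assert (G := char_der_r (-1) t r). rewrite !char_minus in G. apply der_in_opp in G.
  replace (Copp _) with (Wx t (t - r)) in G.
  - eapply der_in_ext; [|exact G]. intros u. unfold outgoing; simpl. now rewrite char_minus.
  - change (-1)%R with (Ropp 1). rewrite RtoC_opp. ring.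
Qed.

Lemma partial1_incoming t r : slab T (t, r) ->
  partial1 (V := CR) (slab T) (incoming W) (t, r) = Cplus (Wt t (t + r)) (Wx t (t + r)).
Proof.
  intros H. apply partial1_slab; auto. apply der_in_full_sub, incoming_der_t.
Qed.

Lemma partial1_outgoing t r : slab T (t, r) ->
  partial1 (V := CR) (slab T) (outgoing W) (t, r) = Copp (Cplus (Wt t (t - r)) (Wx t (t - r))).
Proof.
  intros H. apply partial1_slab; auto. apply der_in_full_sub, outgoing_der_t.
Qed.

Lemma incoming_cont (V : R -> R -> C) D t r : (forall t x, cont2_in full2 V t x) ->
  cont2_in D (fun u v => incoming V (u, v)) t r.
Proof.
  intros H. assert (G := cont2_in_char D V 1 t r ltac:(rewrite Rabs_R1; lra) (H _ _)).
  intros e He. destruct (G e He) as [d [Hd K]]. exists d; split; auto.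
  intros u v Du Hu Hv. specialize (K u v Du Hu Hv). rewrite !char_plus in K. exact K.
Qed.

Lemma outgoing_cont (V : R -> R -> C) D t r : (forall t x, cont2_in full2 V t x) ->
  cont2_in D (fun u v => outgoing V (u, v)) t r.
Proof.
  intros H. assert (G := cont2_in_char D V (-1) t r ltac:(rewrite Rabs_left; lra) (H _ _)).
  apply cont2_in_opp in G.
  intros e He. destruct (G e He) as [d [Hd K]]. exists d; split; auto.
  intros u v Du Hu Hv. specialize (K u v Du Hu Hv). rewrite !char_minus in K. exact K.
Qed.

Hypothesis W_plus : forall t r, slab T (t, r) -> 0 < r ->
  Wt t (t + r) = F r (Cminus (W t (t + r)) (W t (t - r))).
Hypothesis W_minus : forall t r, slab T (t, r) -> 0 < r ->
  Wt t (t - r) = Copp (F r (Cminus (W t (t + r)) (W t (t - r)))).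
Hypothesis W_0 : forall r, 0 <= r -> W 0 r = bm r /\ W 0 (- r) = Copp (bp r).

(** The boundary condition holds by construction: at r = 0 both components are read at the same
    point x = t, with opposite signs. On its own component each transport operator reduces, up to
    sign, to the time derivative [Wt], since the x-derivatives cancel. *)
Lemma plane_solution : is_solution T F bm bp (incoming W) (outgoing W).
Proof.
  assert (Hsum : forall t r, Cplus (incoming W (t, r)) (outgoing W (t, r)) = Cminus (W t (t + r)) (W t (t - r))).
  { intros t r. unfold incoming, outgoing; simpl. ring. }
  assert (P2 : forall t r, slab T (t, r) -> partial2 (V := CR) (slab T) (incoming W) (t, r) = Wx t (t + r)).
  { intros t r H. apply partial2_slab; auto. apply der_in_full_sub, incoming_der_r. }
  assert (Q2 : forall t r, slab T (t, r) -> partial2 (V := CR) (slab T) (outgoing W) (t, r) = Wx t (t - r)).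
  { intros t r H. apply partial2_slab; auto. apply der_in_full_sub, outgoing_der_r. }
  split; [|split; [|split; [|split]]].
  - apply (Ck_on_1_intro T HT (incoming W) (fun q => Cplus (incoming Wt q) (incoming Wx q)) (incoming Wx)).
    + intros t r _. apply der_in_full_sub, incoming_der_t.
    + intros t r _. apply der_in_full_sub, incoming_der_r.
    + intros t r _. now apply incoming_cont.
    + intros t r _. apply cont2_in_plus; now apply incoming_cont.
    + intros t r _. now apply incoming_cont.
  - apply (Ck_on_1_intro T HT (outgoing W) (fun q => Cplus (outgoing Wt q) (outgoing Wx q)) (fun q => Copp (outgoing Wx q))).
    + intros t r _. apply der_in_full_sub.
      replace (Cplus _ _) with (Copp (Cplus (Wt t (t - r)) (Wx t (t - r)))) by (unfold outgoing; simpl; ring).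
      apply outgoing_der_t.
    + intros t r _. apply der_in_full_sub.
      replace (Copp (outgoing Wx (t, r))) with (Wx t (t - r)) by (unfold outgoing; simpl; ring).
      apply outgoing_der_r.
    + intros t r _. now apply outgoing_cont.
    + intros t r _. apply cont2_in_plus; now apply outgoing_cont.
    + intros t r _. apply cont2_in_opp; now apply outgoing_cont.
  - intros t r H Hr. rewrite Hsum.
    rewrite partial1_incoming, partial1_outgoing, P2, Q2; auto.
    split.
    + rewrite W_minus; auto. ring.
    + rewrite W_plus; auto. ring.
  - intros t _. rewrite Hsum. rewrite Rplus_0_r, Rminus_0_r. ring.
  - intros r Hr. destruct (W_0 r Hr) as [E1 E2]. unfold incoming, outgoing; simpl.
    rewrite Rplus_0_l, Rminus_0_l, E1, E2. split; [reflexivity|ring].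
Qed.

End PlaneSolution.

(** * Uniqueness on backward cones *)

Section Uniqueness.

Variables (T : Rbar) (F : R -> C -> C) (bm bp : R -> C).
Hypothesis HT : Rbar_lt 0 T.
(** A source such as r^(1-p) |y|^(p-1) y is Lipschitz uniformly in [r] on the sets |y| <= L r; the
    factor r there balances the singular coefficient. *)
Hypothesis F_lip : forall L, 0 <= L -> exists K, 0 <= K /\
  forall r y z, 0 < r -> Cmod y <= L * r -> Cmod z <= L * r ->
    Cmod (Cminus (F r y) (F r z)) <= K * Cmod (Cminus y z).

Lemma slab_le t0 t r : slab T (t0, 0) -> 0 <= t <= t0 -> 0 <= r -> slab T (t, r).
Proof.
  intros [_ [H _]] Ht Hr. unfold slab; simpl in *. split; [lra|]. split; auto.
  destruct T as [T'| |]; simpl in *; auto; lra.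
Qed.

(* At [r = 0] the sum of the two components vanishes, so it is [O(r)] on compact sets. *)
Lemma solution_bounds vm vp t0 R0 : is_solution T F bm bp vm vp -> slab T (t0, 0) ->
  exists B L, 0 <= B /\ 0 <= L /\ forall t r, 0 <= t <= t0 -> 0 <= r <= R0 ->
    Cmod (vm (t, r)) <= B /\ Cmod (vp (t, r)) <= B /\ Cmod (Cplus (vm (t, r)) (vp (t, r))) <= L * r.
Proof.
  intros [Hm [Hp [_ [H0 _]]]] Ht0.
  destruct (Ck_on_1_elim T HT vm Hm) as [_ [Dm [Cm [_ Cm2]]]].
  destruct (Ck_on_1_elim T HT vp Hp) as [_ [Dp [Cp [_ Cp2]]]].
  assert (HB : forall f : R * R -> C,
    (forall t r, slab T (t, r) -> cont2_in (fun u v => slab T (u, v)) (fun u v => f (u, v)) t r) ->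
    exists B, 0 <= B /\ forall t r, 0 <= t <= t0 -> 0 <= r <= R0 -> Cmod (f (t, r)) <= B).
  { intros f Hf. apply (bounded_on_rectangle (fun u v => slab T (u, v)) (fun u v => f (u, v))).
    intros t r Ht Hr. assert (slab T (t, r)) by (apply (slab_le t0); auto; lra). auto. }
  destruct (HB vm Cm) as [B1 [HB1 G1]]. destruct (HB vp Cp) as [B2 [HB2 G2]].
  destruct (HB _ Cm2) as [L1 [HL1 K1]]. destruct (HB _ Cp2) as [L2 [HL2 K2]].
  assert (HL : forall (f : R * R -> C) L t r, Ck_on (V := CR) 1 (slab T) f ->
     (forall t r, 0 <= t <= t0 -> 0 <= r <= R0 -> Cmod (partial2 (V := CR) (slab T) f (t, r)) <= L) ->
     0 <= t <= t0 -> 0 <= r <= R0 -> Cmod (Cminus (f (t, r)) (f (t, 0))) <= L * r).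
  { intros f L t r Hf HfL Ht Hr.
    destruct (Ck_on_1_elim T HT f Hf) as [_ [D [Cf _]]].
    replace (L * r) with ((fun s => L * s) r - (fun s => L * s) 0) by ring.
    apply (mean_value_ineq (fun s => f (t, s)) (fun s => partial2 (V := CR) (slab T) f (t, s))
      (fun s => L * s) (fun _ => L)).
    - lra.
    - intros x Hx. apply der_in_cont with (partial2 (V := CR) (slab T) f (t, x)).
      apply (der_in_sub (fun s => slab T (t, s))).
      + intros y Hy. apply (slab_le t0); auto; lra.
      + apply D. apply (slab_le t0); auto; lra.
    - intros x Hx. apply (der_in_interior (fun s => slab T (t, s))) with x; try lra.
      + intros y Hy. apply Rabs_lt_between in Hy. apply (slab_le t0); auto; lra.
      + apply D. apply (slab_le t0); auto; lra.
    - intros x. auto_derive; auto; ring.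
    - intros x Hx. apply HfL; lra. }
  exists (B1 + B2), (L1 + L2). split; [lra|]. split; [lra|].
  intros t r Ht Hr. assert (A1 := G1 t r Ht Hr). assert (A2 := G2 t r Ht Hr).
  split; [lra|]. split; [lra|].
  assert (E1 := HL vm L1 t r Hm K1 Ht Hr). assert (E2 := HL vp L2 t r Hp K2 Ht Hr).
  assert (E0 := H0 t (slab_le t0 t 0 Ht0 Ht (Rle_refl 0))).
  replace (Cplus (vm (t, r)) (vp (t, r))) with
    (Cplus (Cplus (Cminus (vm (t, r)) (vm (t, 0))) (Cminus (vp (t, r)) (vp (t, 0))))
           (Cplus (vm (t, 0)) (vp (t, 0)))) by ring.
  rewrite E0, Cplus_0_r. eapply Rle_trans; [apply Cmod_triangle|]. lra.
Qed.

Lemma pow_fact_lim B X e : 0 <= B -> 0 < e -> exists n, B * (X ^ n / INR (fact n)) <= e.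
Proof.
  intros HB He. destruct (cv_speed_pow_fact X (e / (1 + B))) as [N HN].
  { apply Rdiv_lt_0_compat; lra. }
  exists N. specialize (HN N (Nat.le_refl N)). unfold Rdist in HN. rewrite Rminus_0_r in HN.
  assert (H1 := Rle_abs (X ^ N / INR (fact N))).
  apply Rle_trans with (B * (e / (1 + B))); [apply Rmult_le_compat_l; lra|].
  replace (B * (e / (1 + B))) with (e - e / (1 + B)) by (field; lra).
  assert (0 < e / (1 + B)) by (apply Rdiv_lt_0_compat; lra). lra.
Qed.

(** Each bound of the induction is a primitive of K times the preceding one, so integration along a
    characteristic raises n by one. *)
Lemma pow_fact_der B K n x :
  is_derive (fun u => B * ((K * u) ^ S n / INR (fact (S n)))) x (K * (B * ((K * x) ^ n / INR (fact n)))).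
Proof.
  assert (H1 := INR_fact_neq_0 n).
  assert (E : INR (fact (S n)) = INR (S n) * INR (fact n)) by apply mult_INR.
  assert (H2 : INR (S n) <> 0) by (apply not_0_INR; lia).
  assert (E' : forall u : R, B / INR (fact (S n)) * (K * u) ^ S n = B * ((K * u) ^ S n / INR (fact (S n)))).
  { intros u. unfold Rdiv. ring. }
  apply (is_derive_ext _ _ _ _ E').
  replace (K * (B * ((K * x) ^ n / INR (fact n))))
    with (B / INR (fact (S n)) * (INR (S n) * (K * 1) * (K * x) ^ pred (S n))).
  2:{ rewrite E. simpl pred. field. auto. }
  apply (is_derive_scal (fun u => (K * u) ^ S n)).
  apply (is_derive_pow (fun u => K * u) (S n) x (K * 1)).
  apply (is_derive_scal (fun u => u)). apply (is_derive_id x).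
Qed.

Lemma Cplus_m1 (z w : C) : Cplus z (Cmult (RtoC (-1)) w) = Cminus z w.
Proof. change (-1) with (Ropp 1). rewrite RtoC_opp. ring. Qed.

Lemma uniqueness vm vp wm wp : is_solution T F bm bp vm vp -> is_solution T F bm bp wm wp ->
  forall q, slab T q -> wm q = vm q /\ wp q = vp q.
Proof.
  intros Hv Hw [t0 r0] Hq.
  assert (Ht0 : slab T (t0, 0)) by (unfold slab in *; simpl in *; intuition lra).
  (* The cone t + r <= t0 + r0 contains every backward characteristic issued from one of its points,
     including those reflected at r = 0. *)
  set (R0 := t0 + r0).
  destruct (solution_bounds vm vp t0 R0 Hv Ht0) as [B1 [L1 [HB1 [HL1 G1]]]].
  destruct (solution_bounds wm wp t0 R0 Hw Ht0) as [B2 [L2 [HB2 [HL2 G2]]]].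
  destruct (F_lip (L1 + L2)) as [K [HK FK]]; [lra|].
  destruct Hv as [Vm [Vp [Ve [V0 Vi]]]]. destruct Hw as [Wm [Wp [We [W0 Wi]]]].
  set (dm := fun q => Cminus (vm q) (wm q)). set (dp := fun q => Cminus (vp q) (wp q)).
  set (B := B1 + B2).
  set (bd := fun n t => B * ((2 * K * t) ^ n / INR (fact n))).
  set (Fd := fun t r => Cminus (F r (Cplus (vm (t, r)) (vp (t, r)))) (F r (Cplus (wm (t, r)) (wp (t, r))))).
  assert (HTt : forall t, 0 < t < t0 -> Rbar_lt t T).
  { intros t Ht. destruct Ht0 as [_ [H _]]. destruct T as [T'| |]; simpl in *; auto; lra. }
  assert (Dm : forall t r, 0 < t < t0 -> 0 < r -> der_in full (fun u => dm (u, r + -1 * (u - t))) t (Fd t r)).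
  { intros t r Ht Hr.
    assert (Hs : slab T (t, r)) by (apply (slab_le t0); auto; lra).
    assert (A1 := slab_line_der T HT vm t r (-1) Vm ltac:(lra) (HTt t Ht) Hr).
    assert (A2 := slab_line_der T HT wm t r (-1) Wm ltac:(lra) (HTt t Ht) Hr).
    assert (A := der_in_minus _ _ _ _ _ _ A1 A2). clear A1 A2.
    unfold Fd. rewrite <- (proj2 (Ve t r Hs Hr)), <- (proj2 (We t r Hs Hr)).
    rewrite !Cplus_m1 in A. exact A. }
  assert (Dp : forall t r, 0 < t < t0 -> 0 < r -> der_in full (fun u => dp (u, r + 1 * (u - t))) t (Fd t r)).
  { intros t r Ht Hr.
    assert (Hs : slab T (t, r)) by (apply (slab_le t0); auto; lra).
    assert (A1 := slab_line_der T HT vp t r 1 Vp ltac:(lra) (HTt t Ht) Hr).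
    assert (A2 := slab_line_der T HT wp t r 1 Wp ltac:(lra) (HTt t Ht) Hr).
    assert (A := der_in_minus _ _ _ _ _ _ A1 A2). clear A1 A2.
    unfold Fd. rewrite <- (proj1 (Ve t r Hs Hr)), <- (proj1 (We t r Hs Hr)).
    rewrite !Cmult_1_l in A. exact A. }
  assert (Cd : forall (f h : R * R -> C) a b x s c, Ck_on (V := CR) 1 (slab T) f -> Ck_on (V := CR) 1 (slab T) h ->
     Rabs s <= 1 -> 0 <= a -> b <= t0 -> (forall u, a <= u <= b -> 0 <= c + s * u) -> a <= x <= b ->
     cont_in (fun u => a <= u <= b) (fun u => Cminus (f (u, c + s * u)) (h (u, c + s * u))) x).
  { intros f h a b x s c Hf Hh Hs Ha Hb Hr Hx e He.
    assert (Hin : forall u, a <= u <= b -> slab T (u, c + s * u)).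
    { intros u Hu. apply (slab_le t0); auto; lra. }
    destruct (proj1 (proj2 (proj2 (Ck_on_1_elim T HT f Hf))) _ _ (Hin x Hx) (e / 2)) as [d1 [Hd1 E1]]; [lra|].
    destruct (proj1 (proj2 (proj2 (Ck_on_1_elim T HT h Hh))) _ _ (Hin x Hx) (e / 2)) as [d2 [Hd2 E2]]; [lra|].
    exists (Rmin d1 d2). split; [now apply Rmin_pos|]. intros u Hu Hux.
    assert (U1 := Rlt_le_trans _ _ _ Hux (Rmin_l _ _)). assert (U2 := Rlt_le_trans _ _ _ Hux (Rmin_r _ _)).
    assert (Us : Rabs (c + s * u - (c + s * x)) <= Rabs (u - x)).
    { replace (c + s * u - (c + s * x)) with (s * (u - x)) by ring. rewrite Rabs_mult.
      assert (P := Rabs_pos (u - x)). nra. }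
    specialize (E1 u _ (Hin u Hu) U1 (Rle_lt_trans _ _ _ Us U1)).
    specialize (E2 u _ (Hin u Hu) U2 (Rle_lt_trans _ _ _ Us U2)).
    replace (Cminus _ _) with (Cminus (Cminus (f (u, c + s * u)) (f (x, c + s * x)))
      (Cminus (h (u, c + s * u)) (h (x, c + s * x)))) by ring.
    eapply Rle_lt_trans; [apply Cmod_minus_le|]. lra. }
  assert (HI : forall n t r, 0 <= t <= t0 -> 0 <= r -> t + r <= R0 ->
     Cmod (dm (t, r)) <= bd n t /\ Cmod (dp (t, r)) <= bd n t).
  { induction n as [|n IH].
    - intros t r Ht Hr Htr. unfold bd; simpl.
      destruct (G1 t r) as [A1 [A2 _]]; try lra. destruct (G2 t r) as [A3 [A4 _]]; try lra.
      unfold dm, dp, B. replace ((B1 + B2) * (1 / 1)) with (B1 + B2) by field.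
      split; eapply Rle_trans; try apply Cmod_minus_le; lra.
    - assert (HF : forall t r, 0 <= t <= t0 -> 0 < r -> t + r <= R0 -> Cmod (Fd t r) <= 2 * K * bd n t).
      { intros t r Ht Hr Htr. unfold Fd.
        destruct (G1 t r) as [_ [_ A1]]; try lra. destruct (G2 t r) as [_ [_ A2]]; try lra.
        destruct (IH t r Ht ltac:(lra) Htr) as [I1 I2].
        assert (0 <= L1 * r) by (apply Rmult_le_pos; lra). assert (0 <= L2 * r) by (apply Rmult_le_pos; lra).
        eapply Rle_trans; [apply FK; auto; lra|].
        replace (Cminus _ _) with (Cplus (dm (t, r)) (dp (t, r))) by (unfold dm, dp; ring).
        rewrite (Rmult_comm 2 K), Rmult_assoc. apply Rmult_le_compat_l; auto.
        eapply Rle_trans; [apply Cmod_triangle|]. lra. }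
      assert (H0 : bd (S n) 0 = 0).
      { unfold bd. rewrite Rmult_0_r. simpl pow. unfold Rdiv. ring. }
      (* Followed backwards, an incoming characteristic moves away from the axis and ends at t = 0,
         so this component is estimated first. *)
      assert (Hm : forall t r, 0 <= t <= t0 -> 0 <= r -> t + r <= R0 -> Cmod (dm (t, r)) <= bd (S n) t).
      { intros t r Ht Hr Htr.
        assert (M := mean_value_ineq (fun u => dm (u, (r + t) + -1 * u)) (fun u => Fd u ((r + t) + -1 * u))
          (bd (S n)) (fun u => 2 * K * bd n u) 0 t ltac:(lra)).
        assert (E : Cmod (Cminus (dm (t, r + t + -1 * t)) (dm (0, r + t + -1 * 0))) <= bd (S n) t - bd (S n) 0).
        { apply M.
          - intros x Hx. apply Cd; auto; try lra. rewrite Rabs_left; lra. intros; lra.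
          - intros x Hx. assert (A := Dm x (r + t + -1 * x) ltac:(lra) ltac:(lra)).
            eapply der_in_ext; [|exact A]. intros u; simpl. do 2 f_equal. ring.
          - intros x. apply pow_fact_der.
          - intros x Hx. apply HF; lra. }
        replace (r + t + -1 * t) with r in E by ring. replace (r + t + -1 * 0) with (r + t) in E by ring.
        replace (dm (0, r + t)) with (RtoC 0) in E.
        2:{ unfold dm. rewrite (proj1 (Vi (r + t) ltac:(lra))), (proj1 (Wi (r + t) ltac:(lra))). ring. }
        replace (Cminus (dm (t, r)) (RtoC 0)) with (dm (t, r)) in E by ring. lra. }
      intros t r Ht Hr Htr. split; [now apply Hm|].
      assert (M : forall a, 0 <= a <= t -> 0 <= r - t + a ->
        Cmod (Cminus (dp (t, r)) (dp (a, r - t + a))) <= bd (S n) t - bd (S n) a).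
      { intros a Ha Hra.
        assert (M := mean_value_ineq (fun u => dp (u, (r - t) + 1 * u)) (fun u => Fd u ((r - t) + 1 * u))
          (bd (S n)) (fun u => 2 * K * bd n u) a t ltac:(lra)).
        replace r with (r - t + 1 * t) at 1 by ring. replace (r - t + a) with (r - t + 1 * a) by ring.
        apply M.
        - intros x Hx. apply Cd; auto; try lra. rewrite Rabs_R1; lra. intros; lra.
        - intros x Hx. assert (A := Dp x (r - t + 1 * x) ltac:(lra) ltac:(lra)).
          eapply der_in_ext; [|exact A]. intros u; simpl. do 2 f_equal. ring.
        - intros x. apply pow_fact_der.
        - intros x Hx. apply HF; lra. }
      (* If t > r, the outgoing characteristic starts on the axis at time t - r, where the boundary
         condition converts the estimate of [dm] into one of [dp]. *)
      destruct (Rle_dec t r) as [Htr'|Htr'].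
      + specialize (M 0 ltac:(lra) ltac:(lra)).
        replace (dp (0, r - t + 0)) with (RtoC 0) in M.
        2:{ unfold dp. rewrite (proj2 (Vi (r - t + 0) ltac:(lra))), (proj2 (Wi (r - t + 0) ltac:(lra))). ring. }
        replace (Cminus (dp (t, r)) (RtoC 0)) with (dp (t, r)) in M by ring. lra.
      + specialize (M (t - r) ltac:(lra) ltac:(lra)).
        replace (r - t + (t - r)) with 0 in M by ring.
        assert (Hb := Hm (t - r) 0 ltac:(lra) ltac:(lra) ltac:(unfold R0 in *; lra)).
        assert (Hs : slab T (t - r, 0)) by (apply (slab_le t0); auto; lra).
        assert (E : dp (t - r, 0) = Copp (dm (t - r, 0))).
        { unfold dp, dm.
          replace (vp (t - r, 0)) with (Cminus (Cplus (vm (t - r, 0)) (vp (t - r, 0))) (vm (t - r, 0))) by ring.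
          replace (wp (t - r, 0)) with (Cminus (Cplus (wm (t - r, 0)) (wp (t - r, 0))) (wm (t - r, 0))) by ring.
          rewrite (V0 _ Hs), (W0 _ Hs). ring. }
        assert (N : Cmod (dp (t - r, 0)) <= bd (S n) (t - r)) by (rewrite E, Cmod_opp; exact Hb).
        replace (dp (t, r)) with (Cplus (Cminus (dp (t, r)) (dp (t - r, 0))) (dp (t - r, 0))) by ring.
        eapply Rle_trans; [apply Cmod_triangle|]. lra. }
  assert (Hz : forall z w : C, (forall n, Cmod (Cminus z w) <= bd n t0) -> w = z).
  { intros z w Hn.
    assert (E : Cmod (Cminus z w) <= 0).
    { apply Rnot_lt_le. intros Hlt.
      destruct (pow_fact_lim B (2 * K * t0) (Cmod (Cminus z w) / 2)) as [n Hl]; [unfold B; lra|lra|].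
      specialize (Hn n). unfold bd in Hn. lra. }
    assert (E1 := Cmod_ge_0 (Cminus z w)).
    assert (E2 : Cminus z w = RtoC 0) by (apply Cmod_eq_0; lra).
    replace w with (Cminus z (Cminus z w)) by ring. rewrite E2. ring. }
  assert (Hr0 : 0 <= t0 /\ 0 <= r0) by (unfold slab in Hq; simpl in Hq; tauto).
  split; apply Hz; intros n; apply (HI n t0 r0); unfold R0; lra.
Qed.

End Uniqueness.

(** * Concentrated initial data *)

(** The partial derivatives are carried explicitly, and only r > 0 is considered: for small eps the
    data vanish near r = 0, so the edge of the half-plane never enters their derivatives. *)
Definition C1_right (V V1 V2 : R -> R -> C) : Prop := forall r z, 0 < r ->
  der_in full (fun s => V s z) r (V1 r z) /\ der_in full (V r) z (V2 r z) /\
  cont2_in full2 V r z /\ cont2_in full2 V1 r z /\ cont2_in full2 V2 r z.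

Lemma half_plane_interior r : 0 < r -> forall u v, Rabs (u - r) < r -> half_plane (u, v).
Proof. intros Hr u v Hu. unfold half_plane; simpl. apply Rabs_lt_between in Hu. lra. Qed.

Lemma RtoC_inj (x y : R) : RtoC x = RtoC y -> x = y.
Proof. intros H. now injection H. Qed.

Lemma Ck_on_half_plane_right (f : R * R -> R) :
  Ck_on (V := R_CompleteNormedModule) 1 half_plane f ->
  C1_right (fun r z => RtoC (f (r, z)))
    (fun r z => RtoC (partial1 (V := R_CompleteNormedModule) half_plane f (r, z)))
    (fun r z => RtoC (partial2 (V := R_CompleteNormedModule) half_plane f (r, z))).
Proof.
  intros [C0 [E1 [E2 [[C1 _] [C2 _]]]]] r z Hr.
  assert (Hin : half_plane (r, z)) by (unfold half_plane; simpl; lra).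
  assert (HI : forall h : R * R -> R,
    continuous_on (T := prod_UniformSpace R_UniformSpace R_UniformSpace) (U := R_CompleteNormedModule) half_plane h ->
    cont2_in full2 (fun r z => RtoC (h (r, z))) r z).
  { intros h Hh. apply (cont2_in_interior (fun u v => half_plane (u, v))) with r; auto.
    - intros u v Hu _. now apply (half_plane_interior r).
    - now apply continuous_on_cont2_in_R. }
  assert (D1 : forall l : R, is_partial1 (V := R_CompleteNormedModule) half_plane f (r, z) l ->
    der_in full (fun s => RtoC (f (s, z))) r (RtoC l)).
  { intros l Hl. apply filterdiff_within_der_in_R in Hl. simpl in Hl.
    eapply der_in_interior; [exact Hr| |exact Hl]. intros y Hy. now apply (half_plane_interior r). }
  assert (D2 : forall l : R, is_partial2 (V := R_CompleteNormedModule) half_plane f (r, z) l ->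
    der_in full (fun s => RtoC (f (r, s))) z (RtoC l)).
  { intros l Hl. apply filterdiff_within_der_in_R in Hl. simpl in Hl.
    eapply der_in_interior; [exact Hr| |exact Hl]. intros y Hy. exact Hin. }
  split; [|split; [|split; [|split]]]; auto.
  - apply D1. apply (iota_correct (V := R_CompleteNormedModule) (is_partial1 (V := R_CompleteNormedModule) half_plane f (r, z))).
    destruct (E1 _ Hin) as [l Hl]. exists l. split; auto.
    intros l' Hl'. apply RtoC_inj. exact (der_in_full_unique _ _ _ _ (D1 _ Hl) (D1 _ Hl')).
  - apply D2. apply (iota_correct (V := R_CompleteNormedModule) (is_partial2 (V := R_CompleteNormedModule) half_plane f (r, z))).
    destruct (E2 _ Hin) as [l Hl]. exists l. split; auto.
    intros l' Hl'. apply RtoC_inj. exact (der_in_full_unique _ _ _ _ (D2 _ Hl) (D2 _ Hl')).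
Qed.

Lemma der_in_plus D f h x l m :
  der_in D f x l -> der_in D h x m -> der_in D (fun y => Cplus (f y) (h y)) x (Cplus l m).
Proof.
  intros H1 H2. apply der_in_opp in H2. assert (G := der_in_minus _ _ _ _ _ _ H1 H2).
  replace (Cplus l m) with (Cminus l (Copp m)) by ring.
  eapply der_in_ext; [|exact G]. intros y; simpl. ring.
Qed.

Lemma C1_right_plus V V1 V2 W W1 W2 : C1_right V V1 V2 -> C1_right W W1 W2 ->
  C1_right (fun r z => Cplus (V r z) (W r z)) (fun r z => Cplus (V1 r z) (W1 r z))
           (fun r z => Cplus (V2 r z) (W2 r z)).
Proof.
  intros H H' r z Hr. destruct (H r z Hr) as [A1 [A2 [A3 [A4 A5]]]].
  destruct (H' r z Hr) as [B1 [B2 [B3 [B4 B5]]]].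
  split; [|split; [|split; [|split]]]; auto using der_in_plus, cont2_in_plus.
Qed.

Lemma C1_right_opp V V1 V2 : C1_right V V1 V2 ->
  C1_right (fun r z => Copp (V r z)) (fun r z => Copp (V1 r z)) (fun r z => Copp (V2 r z)).
Proof.
  intros H r z Hr. destruct (H r z Hr) as [A1 [A2 [A3 [A4 A5]]]].
  split; [|split; [|split; [|split]]]; auto using der_in_opp, cont2_in_opp.
Qed.

Lemma cont2_in_mul_r D V r z : cont2_in D V r z -> cont2_in D (fun u v => Cmult (RtoC u) (V u v)) r z.
Proof.
  intros H e He.
  set (k := 1 + Rabs r + Cmod (V r z)).
  assert (A := Rabs_pos r). assert (B := Cmod_ge_0 (V r z)).
  set (e' := Rmin 1 (e / (2 * k))).
  assert (Hk : 0 < e / (2 * k)) by (apply Rdiv_lt_0_compat; unfold k; lra).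
  assert (He' : 0 < e') by (apply Rmin_pos; lra).
  destruct (H e' He') as [d [Hd G]].
  exists (Rmin d e'). split; [now apply Rmin_pos|]. intros u v Duv Hu Hv.
  specialize (G u v Duv (Rlt_le_trans _ _ _ Hu (Rmin_l _ _)) (Rlt_le_trans _ _ _ Hv (Rmin_l _ _))).
  assert (Hu' := Rlt_le_trans _ _ _ Hu (Rmin_r _ _)).
  replace (Cminus _ _) with (Cplus (Cmult (RtoC u) (Cminus (V u v) (V r z))) (Cmult (RtoC (u - r)) (V r z)))
    by (rewrite RtoC_minus; ring).
  eapply Rle_lt_trans; [apply Cmod_triangle|]. rewrite !Cmod_scal.
  assert (M1 : e' <= 1) by apply Rmin_l. assert (M2 : e' <= e / (2 * k)) by apply Rmin_r.
  assert (Hur : Rabs u <= Rabs r + 1).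
  { replace u with ((u - r) + r) by ring. eapply Rle_trans; [apply Rabs_triang|]. lra. }
  assert (T1 : Rabs u * Cmod (Cminus (V u v) (V r z)) <= (Rabs r + 1) * e').
  { apply Rmult_le_compat; try lra; auto using Rabs_pos, Cmod_ge_0. }
  assert (T2 : Rabs (u - r) * Cmod (V r z) <= e' * Cmod (V r z)) by (apply Rmult_le_compat_r; lra).
  assert (T3 : k * e' <= k * (e / (2 * k))) by (apply Rmult_le_compat_l; auto; unfold k; lra).
  replace (k * (e / (2 * k))) with (e / 2) in T3 by (field; unfold k; lra).
  unfold k in T3. lra.
Qed.

Lemma C1_right_mul_r V V1 V2 : C1_right V V1 V2 ->
  C1_right (fun r z => Cmult (RtoC r) (V r z)) (fun r z => Cplus (V r z) (Cmult (RtoC r) (V1 r z)))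
           (fun r z => Cmult (RtoC r) (V2 r z)).
Proof.
  intros H r z Hr. destruct (H r z Hr) as [A1 [A2 [A3 [A4 A5]]]].
  split; [|split; [|split; [|split]]]; auto using cont2_in_mul_r, cont2_in_plus.
  - intros e He.
    assert (Hr1 := Rabs_pos r). assert (Hc := der_in_cont _ _ _ _ A1).
    destruct (A1 (e / (2 * (1 + Rabs r)))) as [d1 [Hd1 G1]]; [apply Rdiv_lt_0_compat; lra|].
    destruct (Hc (e / 2)) as [d2 [Hd2 G2]]; [lra|].
    exists (Rmin d1 d2). split; [now apply Rmin_pos|]. intros y _ Hy.
    specialize (G1 y I (Rlt_le_trans _ _ _ Hy (Rmin_l _ _))).
    specialize (G2 y I (Rlt_le_trans _ _ _ Hy (Rmin_r _ _))). simpl in *.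
    replace (Cminus _ _) with (Cplus (Cmult (RtoC r) (Cminus (Cminus (V y z) (V r z)) (Cmult (RtoC (y - r)) (V1 r z))))
      (Cmult (RtoC (y - r)) (Cminus (V y z) (V r z)))) by (rewrite RtoC_minus; ring).
    eapply Rle_trans; [apply Cmod_triangle|]. rewrite !Cmod_scal.
    assert (P := Rabs_pos (y - r)).
    assert (T1 : Rabs r * Cmod (Cminus (Cminus (V y z) (V r z)) (Cmult (RtoC (y - r)) (V1 r z)))
      <= Rabs r * (e / (2 * (1 + Rabs r)) * Rabs (y - r))) by (apply Rmult_le_compat_l; auto).
    assert (T2 : Rabs (y - r) * Cmod (Cminus (V y z) (V r z)) <= Rabs (y - r) * (e / 2))
      by (apply Rmult_le_compat_l; lra).
    replace (Rabs r * (e / (2 * (1 + Rabs r)) * Rabs (y - r))) with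
      (e / 2 * Rabs (y - r) - e / (2 * (1 + Rabs r)) * Rabs (y - r)) in T1 by (field; lra).
    assert (0 <= e / (2 * (1 + Rabs r)) * Rabs (y - r)).
    { apply Rmult_le_pos; auto. left. apply Rdiv_lt_0_compat; lra. }
    lra.
  - intros e He.
    assert (Hr1 := Rabs_pos r).
    destruct (A2 (e / (1 + Rabs r))) as [d1 [Hd1 G1]]; [apply Rdiv_lt_0_compat; lra|].
    exists d1. split; auto. intros y _ Hy. specialize (G1 y I Hy).
    replace (Cminus _ _) with (Cmult (RtoC r) (Cminus (Cminus (V r y) (V r z)) (Cmult (RtoC (y - z)) (V2 r z)))) by ring.
    rewrite Cmod_scal.
    assert (P := Rabs_pos (y - z)).
    assert (T1 : Rabs r * Cmod (Cminus (Cminus (V r y) (V r z)) (Cmult (RtoC (y - z)) (V2 r z)))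
      <= Rabs r * (e / (1 + Rabs r) * Rabs (y - z))) by (apply Rmult_le_compat_l; auto).
    replace (Rabs r * (e / (1 + Rabs r) * Rabs (y - z))) with
      (e * Rabs (y - z) - e / (1 + Rabs r) * Rabs (y - z)) in T1 by (field; lra).
    assert (0 <= e / (1 + Rabs r) * Rabs (y - z)).
    { apply Rmult_le_pos; auto. left. apply Rdiv_lt_0_compat; lra. }
    lra.
Qed.

(** If one of two points at distance at most 1 leaves the interval enlarged by 1, both lie outside
    [a, b] and [f] vanishes at both; otherwise uniform continuity on a compact interval applies. *)
Lemma unif_cont_compact_support (f : R -> C) a b : a <= b -> ccont f ->
  (forall x, x < a \/ b < x -> f x = RtoC 0) ->
  forall e, 0 < e -> exists d, 0 < d /\
    forall x y, Rabs (x - y) <= d -> Cmod (Cminus (f x) (f y)) <= e.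
Proof.
  intros Hab Hf H0 e He.
  assert (Hn := norm_factor_gt_0 (V := CR)). set (nf := norm_factor (V := CR)) in *.
  assert (He' : 0 < e / (1 + nf)) by (apply Rdiv_lt_0_compat; lra).
  destruct (unifcont_1d (V := CR) f (a - 1) (b + 1)
     (fun x _ => cont_in_continuous f x (Hf x)) (mkposreal _ He')) as [d Hd].
  assert (Hdp := cond_pos d).
  exists (Rmin (d / 2) 1). split; [apply Rmin_pos; lra|].
  intros x y Hxy. assert (M1 := Rmin_l (d / 2) 1). assert (M2 := Rmin_r (d / 2) 1).
  assert (A := Rle_trans _ _ _ Hxy M2). apply Rabs_le_between in A.
  destruct (Rle_dec (a - 1) x) as [X1|X1]; [destruct (Rle_dec x (b + 1)) as [X2|X2];
    [destruct (Rle_dec (a - 1) y) as [Y1|Y1]; [destruct (Rle_dec y (b + 1)) as [Y2|Y2]|]|]|].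
  { destruct (Rle_dec (Cmod (Cminus (f x) (f y))) e) as [L|L]; auto. exfalso.
    apply (Hd x y); try lra.
    - unfold ball; simpl; unfold AbsRing_ball, abs, minus, plus, opp; simpl.
      fold (y - x). rewrite Rabs_minus_sym. lra.
    - intros B. apply (norm_compat2 (V := CR)) in B. rewrite norm_CR, minus_CR in B.
      rewrite Cmod_minus_sym in B. simpl in B. fold nf in B.
      replace (nf * (e / (1 + nf))) with (e - e / (1 + nf)) in B by (field; lra). lra. }
  all: rewrite (H0 x), (H0 y) by lra; replace (Cminus _ _) with (RtoC 0) by ring; rewrite Cmod_0; lra.
Qed.

(** Amplitude M on the length scale eps. The modulus of continuity of [f'] may degenerate with eps;
    the argument with difference quotients only asks that it exists. *)
Definition pulse (eps M : R) (f f' : R -> C) : Prop :=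
  (forall x, der_in full f x (f' x)) /\
  (forall e, 0 < e -> exists d, 0 < d /\
    forall x y, Rabs (x - y) <= d -> Cmod (Cminus (f' x) (f' y)) <= e) /\
  (forall x, Cmod (f x) <= M) /\ (forall x, Cmod (f' x) <= M / eps).

Lemma pulse_plus eps M N f f' h h' : pulse eps M f f' -> pulse eps N h h' ->
  pulse eps (M + N) (fun x => Cplus (f x) (h x)) (fun x => Cplus (f' x) (h' x)).
Proof.
  intros [A1 [A2 [A3 A4]]] [B1 [B2 [B3 B4]]]. split; [|split; [|split]].
  - intros x. now apply der_in_plus.
  - intros e He. destruct (A2 (e / 2)) as [d1 [Hd1 G1]]; [lra|]. destruct (B2 (e / 2)) as [d2 [Hd2 G2]]; [lra|].
    exists (Rmin d1 d2). split; [now apply Rmin_pos|]. intros x y Hxy.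
    specialize (G1 x y (Rle_trans _ _ _ Hxy (Rmin_l _ _))).
    specialize (G2 x y (Rle_trans _ _ _ Hxy (Rmin_r _ _))).
    replace (Cminus _ _) with (Cplus (Cminus (f' x) (f' y)) (Cminus (h' x) (h' y))) by ring.
    eapply Rle_trans; [apply Cmod_triangle|]. lra.
  - intros x. eapply Rle_trans; [apply Cmod_triangle|]. specialize (A3 x). specialize (B3 x). lra.
  - intros x. eapply Rle_trans; [apply Cmod_triangle|]. specialize (A4 x). specialize (B4 x).
    unfold Rdiv in *. lra.
Qed.

Lemma pulse_scal eps M k f f' : 0 <= k <= 1 -> pulse eps M f f' ->
  pulse eps M (fun x => Cmult (RtoC k) (f x)) (fun x => Cmult (RtoC k) (f' x)).
Proof.
  intros Hk [A1 [A2 [A3 A4]]].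
  assert (Hs : forall z, Cmod (Cmult (RtoC k) z) <= Cmod z).
  { intros z. rewrite Cmod_scal, Rabs_pos_eq by lra. assert (H := Cmod_ge_0 z). nra. }
  split; [|split; [|split]].
  - intros x e He. destruct (A1 x e He) as [d [Hd G]]. exists d. split; auto. intros y Dy Hy.
    replace (Cminus _ _) with (Cmult (RtoC k) (Cminus (Cminus (f y) (f x)) (Cmult (RtoC (y - x)) (f' x)))) by ring.
    eapply Rle_trans; [apply Hs|auto].
  - intros e He. destruct (A2 e He) as [d [Hd G]]. exists d. split; auto. intros x y Hxy.
    replace (Cminus _ _) with (Cmult (RtoC k) (Cminus (f' x) (f' y))) by ring.
    eapply Rle_trans; [apply Hs|auto].
  - intros x. eapply Rle_trans; [apply Hs|auto].
  - intros x. eapply Rle_trans; [apply Hs|auto].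
Qed.

Lemma pulse_opp eps M f f' : pulse eps M f f' -> pulse eps M (fun x => Copp (f x)) (fun x => Copp (f' x)).
Proof.
  intros [A1 [A2 [A3 A4]]]. split; [|split; [|split]].
  - intros x. now apply der_in_opp.
  - intros e He. destruct (A2 e He) as [d [Hd G]]. exists d. split; auto. intros x y Hxy.
    replace (Cminus _ _) with (Copp (Cminus (f' x) (f' y))) by ring. rewrite Cmod_opp. auto.
  - intros x. rewrite Cmod_opp. auto.
  - intros x. rewrite Cmod_opp. auto.
Qed.

Lemma pulse_reflect eps M f f' : pulse eps M f f' ->
  pulse eps M (fun x => f (- x)) (fun x => Copp (f' (- x))).
Proof.
  intros [A1 [A2 [A3 A4]]]. split; [|split; [|split]].
  - intros x e He. destruct (A1 (- x) e He) as [d [Hd G]]. exists d. split; auto.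
    intros y _ Hy. assert (E : Rabs (- y - - x) = Rabs (y - x)).
    { rewrite <- Rabs_Ropp. f_equal; ring. }
    specialize (G (- y) I). rewrite E in G. specialize (G Hy).
    replace (Cminus _ _) with (Cminus (Cminus (f (- y)) (f (- x))) (Cmult (RtoC (- y - - x)) (f' (- x)))); auto.
    replace (- y - - x) with (- (y - x)) by ring. rewrite RtoC_opp. ring.
  - intros e He. destruct (A2 e He) as [d [Hd G]]. exists d. split; auto. intros x y Hxy.
    replace (Cminus _ _) with (Copp (Cminus (f' (- x)) (f' (- y)))) by ring. rewrite Cmod_opp. apply G.
    replace (- x - - y) with (- (x - y)) by ring. now rewrite Rabs_Ropp.
  - intros x. auto.
  - intros x. rewrite Cmod_opp. auto.
Qed.

Lemma pulse_lip eps M f f' : pulse eps M f f' ->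
  forall x y, Cmod (Cminus (f x) (f y)) <= M / eps * Rabs (x - y).
Proof.
  intros [A1 [_ [_ A4]]].
  assert (W : forall x y, y <= x -> Cmod (Cminus (f x) (f y)) <= M / eps * Rabs (x - y)).
  { intros x y Hxy. rewrite Rabs_pos_eq by lra.
    replace (M / eps * (x - y)) with ((fun s => M / eps * s) x - (fun s => M / eps * s) y) by ring.
    apply (mean_value_ineq f f' (fun s => M / eps * s) (fun _ => M / eps)); auto.
    - intros u _. eapply der_in_cont, der_in_full_sub, A1.
    - intros u. auto_derive; auto; ring. }
  intros x y. destruct (Rle_dec y x); [now apply W|].
  rewrite Cmod_minus_sym, Rabs_minus_sym. apply W. lra.
Qed.

Definition beta (r0 eps : R) (V : R -> R -> C) (x : R) : C :=
  if Rle_dec x 0 then RtoC 0 else V x ((x - r0) / eps).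

Lemma beta_pos r0 eps V x : 0 < x -> beta r0 eps V x = V x ((x - r0) / eps).
Proof. intros H. unfold beta. destruct Rle_dec; auto; lra. Qed.

Lemma beta_neg r0 eps V x : x <= 0 -> beta r0 eps V x = RtoC 0.
Proof. intros H. unfold beta. destruct Rle_dec; auto; lra. Qed.

(** Once z0 eps <= r0 / 4, the function lives in r0 / 2 <= x <= 2 r0, so the profile and its
    derivatives are evaluated on a compact set independent of eps. The derivative in [z] brings the
    factor 1 / eps. *)
Lemma beta_pulse r0 z0 V V1 V2 : 0 < r0 -> 0 < z0 -> C1_right V V1 V2 ->
  (forall r z, 0 < r -> z0 < Rabs z -> V r z = RtoC 0) ->
  exists M, 0 < M /\ forall eps, 0 < eps <= 1 -> z0 * eps <= r0 / 4 ->
    exists f', pulse eps M (beta r0 eps V) f'.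
Proof.
  intros Hr0 Hz0 HV HS.
  assert (HB : forall G : R -> R -> C, (forall r z, 0 < r -> cont2_in full2 G r z) ->
     exists B, 0 <= B /\ forall r z, r0 / 2 <= r <= 2 * r0 -> - z0 <= z <= z0 -> Cmod (G r z) <= B).
  { intros G HG. apply (bounded_on_rectangle full2). intros r z Hr _. split; auto. apply HG. lra. }
  destruct (HB V) as [B0 [HB0 K0]]. { intros r z Hr. apply (HV r z Hr). }
  destruct (HB V1) as [B1 [HB1 K1]]. { intros r z Hr. apply (HV r z Hr). }
  destruct (HB V2) as [B2 [HB2 K2]]. { intros r z Hr. apply (HV r z Hr). }
  assert (S1 : forall r z, 0 < r -> z0 < Rabs z -> V1 r z = RtoC 0).
  { intros r z Hr Hz. apply (der_in_full_locally_0 (fun s => V s z) r _ r Hr); [|apply (HV r z Hr)].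
    intros y Hy. apply HS; auto. apply Rabs_lt_between in Hy. lra. }
  assert (S2 : forall r z, 0 < r -> z0 < Rabs z -> V2 r z = RtoC 0).
  { intros r z Hr Hz. apply (der_in_full_locally_0 (V r) z _ (Rabs z - z0)); [lra| |apply (HV r z Hr)].
    intros y Hy. apply HS; auto. assert (G := Rabs_triang_inv z (z - y)).
    replace (z - (z - y)) with y in G by ring. rewrite Rabs_minus_sym in Hy. lra. }
  exists (1 + B0 + B1 + B2). split; [lra|].
  intros eps Heps Hsmall.
  assert (Hinv : 1 <= / eps) by (rewrite <- Rinv_1; apply Rinv_le_contravar; lra).
  set (f := beta r0 eps V).
  set (f' := fun x => if Rle_dec x 0 then RtoC 0
      else Cplus (V1 x ((x - r0) / eps)) (Cmult (RtoC (/ eps)) (V2 x ((x - r0) / eps)))).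
  assert (Hout : forall x, x < r0 / 2 \/ 2 * r0 < x -> z0 < Rabs ((x - r0) / eps)).
  { intros x Hx. unfold Rdiv. rewrite Rabs_mult, Rabs_inv, (Rabs_pos_eq eps) by lra.
    apply Rmult_lt_reg_r with eps; [lra|]. rewrite Rmult_assoc, Rinv_l, Rmult_1_r by lra.
    apply Rle_lt_trans with (r0 / 4); auto.
    destruct Hx as [Hx|Hx]; [rewrite Rabs_left by lra|rewrite Rabs_pos_eq by lra]; lra. }
  assert (F0 : forall x, x < r0 / 2 \/ 2 * r0 < x -> f x = RtoC 0).
  { intros x Hx. unfold f, beta. destruct Rle_dec; auto. apply HS; [lra|auto]. }
  assert (F0' : forall x, x < r0 / 2 \/ 2 * r0 < x -> f' x = RtoC 0).
  { intros x Hx. unfold f'. destruct Rle_dec; auto.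
    rewrite S1, S2; auto; try lra. ring. }
  assert (Fin : forall x, - z0 <= (x - r0) / eps <= z0 -> r0 / 2 <= x <= 2 * r0).
  { intros x Hx. destruct (Rle_dec (r0 / 2) x); [destruct (Rle_dec x (2 * r0)); auto|].
    - assert (G := Hout x ltac:(lra)). apply Rabs_le in Hx. lra.
    - assert (G := Hout x ltac:(lra)). apply Rabs_le in Hx. lra. }
  assert (HD : forall x, der_in full f x (f' x)).
  { intros x. destruct (Rlt_dec x (r0 / 2)) as [Hx|Hx].
    - rewrite F0' by auto. intros e He. exists (r0 / 2 - x). split; [lra|].
      intros y _ Hy. apply Rabs_lt_between in Hy. rewrite !F0 by lra.
      replace (Cminus _ _) with (RtoC 0) by ring. rewrite Cmod_0.
      apply Rmult_le_pos; [lra|apply Rabs_pos].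
    - assert (Hx0 : 0 < x) by lra. unfold f'. destruct Rle_dec as [Hn|_]; [lra|].
      destruct (HV x ((x - r0) / eps) Hx0) as [_ [E2 [_ [E1 _]]]].
      assert (G := der_along_line V V1 (V2 x ((x - r0) / eps)) x ((x - r0) / eps) x 1 (/ eps) x Hx0).
      rewrite Cmult_1_l in G.
      assert (G1 : der_in full (fun t => V (x + 1 * (t - x)) ((x - r0) / eps + / eps * (t - x))) x
        (Cplus (V1 x ((x - r0) / eps)) (Cmult (RtoC (/ eps)) (V2 x ((x - r0) / eps))))).
      { apply G; auto. intros u v Hu _. apply HV. apply Rabs_lt_between in Hu. lra. }
      intros e He. destruct (G1 e He) as [d [Hd G2]].
      exists (Rmin d x). split; [now apply Rmin_pos|]. intros y Dy Hy.
      specialize (G2 y Dy (Rlt_le_trans _ _ _ Hy (Rmin_l _ _))).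
      assert (Hyx := Rlt_le_trans _ _ _ Hy (Rmin_r _ _)). apply Rabs_lt_between in Hyx.
      unfold f. rewrite !beta_pos by lra.
      replace (x + 1 * (y - x)) with y in G2 by ring.
      replace ((x - r0) / eps + / eps * (y - x)) with ((y - r0) / eps) in G2 by (field; lra).
      replace (x + 1 * (x - x)) with x in G2 by ring.
      replace ((x - r0) / eps + / eps * (x - x)) with ((x - r0) / eps) in G2 by (field; lra).
      exact G2. }
  assert (HC : ccont f').
  { intros x. destruct (Rlt_dec x (r0 / 2)) as [Hx|Hx].
    - intros e He. exists (r0 / 2 - x). split; [lra|].
      intros y _ Hy. apply Rabs_lt_between in Hy. rewrite !F0' by lra.
      replace (Cminus _ _) with (RtoC 0) by ring. rewrite Cmod_0. lra.
    - assert (Hx0 : 0 < x) by lra.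
      destruct (HV x ((x - r0) / eps) Hx0) as [_ [_ [_ [E1 E2]]]].
      intros e He.
      destruct (E1 (e / 2)) as [d1 [Hd1 G1]]; [lra|].
      destruct (E2 (e * eps / 2)) as [d2 [Hd2 G2]]; [nra|].
      set (d := Rmin (Rmin d1 d2) (Rmin x 1)).
      assert (Hd : 0 < d) by (unfold d; repeat apply Rmin_pos; lra).
      exists (d * eps). split; [nra|]. intros y _ Hy.
      assert (Q1 : d <= d1) by (unfold d; eapply Rle_trans; [apply Rmin_l|apply Rmin_l]).
      assert (Q2 : d <= d2) by (unfold d; eapply Rle_trans; [apply Rmin_l|apply Rmin_r]).
      assert (Q3 : d <= x) by (unfold d; eapply Rle_trans; [apply Rmin_r|apply Rmin_l]).
      assert (Hy1 : Rabs (y - x) < d) by nra.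
      assert (Hy2 : Rabs ((y - r0) / eps - (x - r0) / eps) < d).
      { replace ((y - r0) / eps - (x - r0) / eps) with ((y - x) * / eps) by (field; lra).
        rewrite Rabs_mult, Rabs_inv, (Rabs_pos_eq eps) by lra.
        apply Rmult_lt_reg_r with eps; [lra|]. rewrite Rmult_assoc, Rinv_l, Rmult_1_r by lra. auto. }
      assert (Hy3 := Hy1). apply Rabs_lt_between in Hy3.
      unfold f'. destruct Rle_dec as [Hn|_]; [lra|]. destruct Rle_dec as [Hn|_]; [lra|].
      specialize (G1 y ((y - r0) / eps) I ltac:(lra) ltac:(lra)).
      specialize (G2 y ((y - r0) / eps) I ltac:(lra) ltac:(lra)).
      set (zy := (y - r0) / eps) in *. set (zx := (x - r0) / eps) in *.
      replace (Cminus _ _) with (Cplus (Cminus (V1 y zy) (V1 x zx)) (Cmult (RtoC (/ eps)) (Cminus (V2 y zy) (V2 x zx)))) by ring.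
      eapply Rle_lt_trans; [apply Cmod_triangle|]. rewrite Cmod_scal, Rabs_inv, (Rabs_pos_eq eps) by lra.
      assert (G3 : / eps * Cmod (Cminus (V2 y zy) (V2 x zx)) <= / eps * (e * eps / 2))
        by (apply Rmult_le_compat_l; lra).
      replace (/ eps * (e * eps / 2)) with (e / 2) in G3 by (field; lra). lra. }
  exists f'. split; [exact HD|]. split; [|split].
  - apply (unif_cont_compact_support f' (r0 / 2) (2 * r0)); auto. lra.
  - intros x. unfold f, beta. destruct Rle_dec as [Hx|Hx]; [rewrite Cmod_0; lra|].
    destruct (Rle_dec (Rabs ((x - r0) / eps)) z0) as [Hz|Hz].
    + apply Rabs_le_between in Hz. assert (G := K0 x _ (Fin x Hz) Hz). lra.
    + rewrite HS by lra. rewrite Cmod_0. lra.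
  - intros x. assert (Hpos : 0 <= (1 + B0 + B1 + B2) / eps).
    { apply Rmult_le_pos; lra. }
    unfold f'. destruct Rle_dec as [Hx|Hx]; [rewrite Cmod_0; lra|].
    destruct (Rle_dec (Rabs ((x - r0) / eps)) z0) as [Hz|Hz].
    + apply Rabs_le_between in Hz. assert (G1 := K1 x _ (Fin x Hz) Hz). assert (G2 := K2 x _ (Fin x Hz) Hz).
      eapply Rle_trans; [apply Cmod_triangle|]. rewrite Cmod_scal, Rabs_inv, (Rabs_pos_eq eps) by lra.
      unfold Rdiv. assert (/ eps * Cmod (V2 x ((x - r0) / eps)) <= / eps * B2) by (apply Rmult_le_compat_l; lra).
      assert (B1 * 1 <= B1 * / eps) by (apply Rmult_le_compat_l; lra).
      assert (0 <= B0 * / eps) by (apply Rmult_le_pos; lra). unfold Rdiv in *. lra.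
    + rewrite S1, S2 by lra. replace (Cplus _ _) with (RtoC 0) by ring. rewrite Cmod_0. auto.
Qed.

(** Here [c] is the reflected datum of the free problem and [b] that of the full one. They differ by
    eps times a contribution of P_1, which enters v_- and v_+ with opposite signs and is therefore
    even in [x] after the reflection. *)
Lemma initial_data r0 z0 U0 U1 : 0 < r0 -> 0 < z0 ->
  admissible_profile z0 U0 -> admissible_profile z0 U1 ->
  exists e1 M, 0 < e1 <= 1 /\ 0 < M /\ forall eps, 0 < eps <= e1 ->
    exists b b' c c' : R -> C, pulse eps M b b' /\ pulse eps M c c' /\
      (forall x, Cmod (Cminus (b x) (c x)) <= M * eps) /\
      (forall x, Cmod (Cminus (b' x) (c' x)) <= M) /\
      (forall r, 0 <= r -> b r = data_minus U0 U1 r0 eps r /\ b (- r) = Copp (data_plus U0 U1 r0 eps r)) /\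
      (forall x, c x = RtoC (P_minus U0 U1 (x, (x - r0) / eps) - P_plus U0 U1 (- x, (- x - r0) / eps))).
Proof.
  intros Hr0 Hz0 [S0 [_ Z0]] [S1 [_ Z1]].
  destruct (S0 2%nat) as [_ [_ [_ [S01 S02]]]].
  assert (A0 := Ck_on_half_plane_right U0 (S0 1%nat)). assert (A1 := Ck_on_half_plane_right U1 (S1 1%nat)).
  assert (A01 := Ck_on_half_plane_right _ S01). assert (A02 := Ck_on_half_plane_right _ S02).
  assert (Z0' : forall r z, 0 < r -> z0 < Rabs z ->
     partial1 (V := R_CompleteNormedModule) half_plane U0 (r, z) = 0 /\
     partial2 (V := R_CompleteNormedModule) half_plane U0 (r, z) = 0).
  { intros r z Hr Hz. destruct (A0 r z Hr) as [D1 [D2 _]]. split; apply RtoC_inj.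
    - apply (der_in_full_locally_0 (fun s => RtoC (U0 (s, z))) r _ r Hr); [|exact D1]. intros y Hy. simpl. rewrite Z0; auto. apply Rabs_lt_between in Hy. lra.
    - apply (der_in_full_locally_0 (fun s => RtoC (U0 (r, s))) z _ (Rabs z - z0)); [lra| |exact D2]. intros y Hy. simpl. rewrite Z0; auto; [lra|].
      assert (G := Rabs_triang_inv z (z - y)).
      replace (z - (z - y)) with y in G by ring. rewrite Rabs_minus_sym in Hy. lra. }
  set (Vm := fun r z => Cplus (Cmult (RtoC r) (RtoC (U1 (r, z))))
     (Cmult (RtoC r) (RtoC (partial2 (V := R_CompleteNormedModule) half_plane U0 (r, z))))).
  set (Vp := fun r z => Cplus (Cmult (RtoC r) (RtoC (U1 (r, z))))
     (Copp (Cmult (RtoC r) (RtoC (partial2 (V := R_CompleteNormedModule) half_plane U0 (r, z)))))).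
  set (V1 := fun r z => Cplus (RtoC (U0 (r, z)))
     (Cmult (RtoC r) (RtoC (partial1 (V := R_CompleteNormedModule) half_plane U0 (r, z))))).
  destruct (beta_pulse r0 z0 Vm _ _ Hr0 Hz0
    (C1_right_plus _ _ _ _ _ _ (C1_right_mul_r _ _ _ A1) (C1_right_mul_r _ _ _ A02))) as [Mm [HMm Km]].
  { intros r z Hr Hz. unfold Vm. rewrite Z1, (proj2 (Z0' r z Hr Hz)); auto; [ring|lra]. }
  destruct (beta_pulse r0 z0 Vp _ _ Hr0 Hz0
    (C1_right_plus _ _ _ _ _ _ (C1_right_mul_r _ _ _ A1) (C1_right_opp _ _ _ (C1_right_mul_r _ _ _ A02))))
    as [Mp [HMp Kp]].
  { intros r z Hr Hz. unfold Vp. rewrite Z1, (proj2 (Z0' r z Hr Hz)); auto; [ring|lra]. }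
  destruct (beta_pulse r0 z0 V1 _ _ Hr0 Hz0
    (C1_right_plus _ _ _ _ _ _ A0 (C1_right_mul_r _ _ _ A01))) as [M1 [HM1 K1]].
  { intros r z Hr Hz. unfold V1. rewrite Z0, (proj1 (Z0' r z Hr Hz)); auto; [ring|lra]. }
  set (e1 := Rmin 1 (r0 / (8 * z0))).
  assert (He1 : 0 < e1) by (apply Rmin_pos; [lra|apply Rdiv_lt_0_compat; lra]).
  exists e1, (Mm + Mp + (M1 + M1)).
  split; [split; [auto|apply Rmin_l]|]. split; [lra|].
  intros eps [Heps Hle].
  assert (Hle1 : eps <= 1) by (eapply Rle_trans; [exact Hle|apply Rmin_l]).
  assert (Hz : z0 * eps <= r0 / 8).
  { apply Rle_trans with (z0 * (r0 / (8 * z0))).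
    - apply Rmult_le_compat_l; [lra|]. eapply Rle_trans; [exact Hle|apply Rmin_r].
    - right. field. lra. }
  destruct (Km eps (conj Heps Hle1) ltac:(lra)) as [fm Hfm].
  destruct (Kp eps (conj Heps Hle1) ltac:(lra)) as [fp Hfp].
  destruct (K1 eps (conj Heps Hle1) ltac:(lra)) as [f1 Hf1].
  assert (Pc := pulse_plus _ _ _ _ _ _ _ Hfm (pulse_opp _ _ _ _ (pulse_reflect _ _ _ _ Hfp))).
  assert (P1 := pulse_plus _ _ _ _ _ _ _ Hf1 (pulse_reflect _ _ _ _ Hf1)).
  assert (Pb := pulse_plus _ _ _ _ _ _ _ Pc (pulse_scal _ _ eps _ _ ltac:(lra) P1)).
  set (c := fun x => Cplus (beta r0 eps Vm x) (Copp (beta r0 eps Vp (- x)))) in *.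
  set (c' := fun x => Cplus (fm x) (Copp (Copp (fp (- x))))) in *.
  set (d := fun x => Cplus (beta r0 eps V1 x) (beta r0 eps V1 (- x))) in *.
  set (d' := fun x => Cplus (f1 x) (Copp (f1 (- x)))) in *.
  exists (fun x => Cplus (c x) (Cmult (RtoC eps) (d x))), (fun x => Cplus (c' x) (Cmult (RtoC eps) (d' x))), c, c'.
  assert (Em : forall x, beta r0 eps Vm x = RtoC (P_minus U0 U1 (x, (x - r0) / eps))).
  { intros x. unfold beta, P_minus, ext0, Vm; simpl.
    destruct Rle_dec as [H|H]; destruct Rle_dec as [H'|H']; auto; try lra.
    - replace x with 0 by lra. f_equal; ring.
    - now rewrite RtoC_plus, !RtoC_mult. }
  assert (Ep : forall x, beta r0 eps Vp x = RtoC (P_plus U0 U1 (x, (x - r0) / eps))).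
  { intros x. unfold beta, P_plus, ext0, Vp; simpl.
    destruct Rle_dec as [H|H]; destruct Rle_dec as [H'|H']; auto; try lra.
    - replace x with 0 by lra. f_equal; ring.
    - now rewrite RtoC_minus, !RtoC_mult. }
  assert (E1 : forall x, 0 <= x -> beta r0 eps V1 x = RtoC (P_1 U0 (x, (x - r0) / eps))).
  { intros x Hx. unfold beta, P_1, V1; simpl. destruct Rle_dec as [H|H].
    (* [P_1] lacks the overall factor r that makes the other profiles vanish at 0. It vanishes there
       because r0 / eps exceeds z0. *)
    - replace x with 0 by lra. rewrite Z0; [f_equal; ring|lra|].
      unfold Rdiv. rewrite Rabs_mult, Rabs_inv, (Rabs_pos_eq eps), Rabs_left by lra.
      apply Rmult_lt_reg_r with eps; [lra|]. rewrite Rmult_assoc, Rinv_l, Rmult_1_r by lra. lra.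
    - now rewrite RtoC_plus, RtoC_mult. }
  destruct P1 as [_ [_ [P1a P1b]]].
  split; [|split; [|split; [|split; [|split]]]].
  - exact Pb.
  - destruct Pc as [Q1 [Q2 [Q3 Q4]]]. split; auto. split; auto. split.
    + intros x. eapply Rle_trans; [apply Q3|lra].
    + intros x. eapply Rle_trans; [apply Q4|]. unfold Rdiv.
      apply Rmult_le_compat_r; [left; apply Rinv_0_lt_compat; lra|lra].
  - intros x. replace (Cminus _ _) with (Cmult (RtoC eps) (d x)) by ring.
    rewrite Cmod_scal, Rabs_pos_eq, Rmult_comm by lra. apply Rmult_le_compat_r; [lra|].
    specialize (P1a x). fold (d x) in P1a. lra.
  (* The derivative of the correction is of size 1 / eps, which its prefactor eps cancels: the bound
     is O(1), and becomes O(eps) only for eps times the derivative. *)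
  - intros x. replace (Cminus _ _) with (Cmult (RtoC eps) (d' x)) by ring.
    rewrite Cmod_scal, Rabs_pos_eq by lra. specialize (P1b x). fold (d' x) in P1b.
    apply Rle_trans with (eps * ((M1 + M1) / eps)); [apply Rmult_le_compat_l; lra|].
    replace (eps * ((M1 + M1) / eps)) with (M1 + M1) by (field; lra). lra.
  - intros r Hr. unfold c, d, data_minus, data_plus. rewrite Ropp_involutive. split.
    + rewrite (beta_neg _ _ Vp (- r)), (beta_neg _ _ V1 (- r)) by lra.
      rewrite Em, E1 by auto. rewrite RtoC_plus, RtoC_mult. ring.
    + rewrite (beta_neg _ _ Vm (- r)), (beta_neg _ _ V1 (- r)) by lra.
      rewrite Ep, E1 by auto. rewrite RtoC_minus, RtoC_mult. ring.
  - intros x. unfold c. rewrite Em, Ep, RtoC_minus. ring.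
Qed.

(** * Integrals of the weight *)

Section WeightIntegral.

Variables (p eps : R) (P : R -> R).
Hypotheses (Hp : 1 < p) (Heps : 0 < eps).
Hypothesis P_der : forall u, 0 < u -> is_derive P u (Rpower u (1 - p)).

(** The integral of u^(1-p) over [eps, S + eps]. The primitive [P] is left abstract so that the
    power and the logarithm are treated together. *)
Definition Qint (S : R) : R := P (S + eps) - P eps.

Lemma Qint_le S S' : 0 <= S <= S' -> Qint S <= Qint S'.
Proof.
  intros H. unfold Qint. destruct (Rle_lt_or_eq_dec S S') as [Hlt| ->]; try lra.
  destruct (MVT_cor2 P (fun u => Rpower u (1 - p)) (S + eps) (S' + eps)) as [c [E Hc]].
  - lra.
  - intros c Hc. apply is_derive_Reals, P_der. lra.
  - assert (G := Rpower_gt_0 c (1 - p)). nra.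
Qed.

Lemma Rpower_cont_comp (f : R -> R) q s : continuous f s -> 0 < f s -> continuous (fun s => Rpower (f s) q) s.
Proof.
  intros Hf H. apply (continuous_comp f (fun u => Rpower u q)); auto.
  apply (ex_derive_continuous (fun u => Rpower u q)). eexists. now apply is_derive_Rpower.
Qed.

(** The distance |x - s| is at least s - u, so the worst position of the singularity is the left end
    of the interval. *)
Lemma kap_int_right x u v : x <= u -> u <= v -> RInt (fun s => kap p eps (x - s)) u v <= Qint (v - u).
Proof.
  intros Hx Huv.
  assert (I : is_RInt (fun s => Rpower (s - u + eps) (1 - p)) u v (Qint (v - u))).
  { unfold Qint. replace (P eps) with (P (u - u + eps)) by (f_equal; ring).
    apply (is_RInt_derive (fun s => P (s - u + eps)) (fun s => Rpower (s - u + eps) (1 - p))).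
    - intros s. rewrite Rmin_left, Rmax_right by auto. intros Hs.
      replace (Rpower (s - u + eps) (1 - p)) with (scal 1 (Rpower (s - u + eps) (1 - p))) by apply Rmult_1_l.
      apply (is_derive_comp P (fun s => s - u + eps)).
      + apply P_der. lra.
      + auto_derive; auto; ring.
    - intros s. rewrite Rmin_left, Rmax_right by auto. intros Hs.
      apply Rpower_cont_comp; [|lra].
      apply (ex_derive_continuous (fun s => s - u + eps)). auto_derive; auto. }
  rewrite <- (is_RInt_unique _ _ _ _ I). apply RInt_le; auto.
  - apply rcont_ex_RInt. now apply rcont_kap.
  - now exists (Qint (v - u)).
  - intros s Hs. unfold kap. apply Rpower_neg_le; [lra|]. rewrite Rabs_left1 by lra. lra.
Qed.

Lemma kap_int_left x u v : v <= x -> u <= v -> RInt (fun s => kap p eps (x - s)) u v <= Qint (v - u).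
Proof.
  intros Hx Huv.
  assert (I : is_RInt (fun s => Rpower (v - s + eps) (1 - p)) u v (Qint (v - u))).
  { unfold Qint.
    replace (P (v - u + eps) - P eps) with (minus (- P (v - v + eps)) (- P (v - u + eps))).
    2:{ unfold minus, plus, opp; simpl. replace (v - v + eps) with eps by ring. ring. }
    apply (is_RInt_derive (fun s => - P (v - s + eps)) (fun s => Rpower (v - s + eps) (1 - p))).
    - intros s. rewrite Rmin_left, Rmax_right by auto. intros Hs.
      replace (Rpower (v - s + eps) (1 - p)) with (opp (scal (-1) (Rpower (v - s + eps) (1 - p)))).
      2:{ unfold opp, scal; simpl; unfold mult; simpl. ring. }
      apply (is_derive_opp (fun s => P (v - s + eps))).
      apply (is_derive_comp P (fun s => v - s + eps)).
      + apply P_der. lra.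
      + auto_derive; auto; ring.
    - intros s. rewrite Rmin_left, Rmax_right by auto. intros Hs.
      apply Rpower_cont_comp; [|lra].
      apply (ex_derive_continuous (fun s => v - s + eps)). auto_derive; auto. }
  rewrite <- (is_RInt_unique _ _ _ _ I). apply RInt_le; auto.
  - apply rcont_ex_RInt. now apply rcont_kap.
  - now exists (Qint (v - u)).
  - intros s Hs. unfold kap. apply Rpower_neg_le; [lra|]. rewrite Rabs_pos_eq by lra. lra.
Qed.

(** A singularity inside the interval splits it into two one-sided pieces, hence the factor 2. *)
Lemma kap_int x u v : u <= v -> RInt (fun s => kap p eps (x - s)) u v <= 2 * Qint (v - u).
Proof.
  intros Huv.
  assert (H0 : 0 <= Qint (v - u)).
  { replace 0 with (Qint 0) by (unfold Qint; rewrite Rplus_0_l; ring). apply Qint_le; lra. }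
  destruct (Rle_dec x u); [assert (G := kap_int_right x u v); lra|].
  destruct (Rle_dec v x); [assert (G := kap_int_left x u v); lra|].
  rewrite <- (RInt_Chasles (fun s => kap p eps (x - s)) u x v)
    by (apply rcont_ex_RInt; now apply rcont_kap).
  assert (G1 := kap_int_left x u x ltac:(lra) ltac:(lra)).
  assert (G2 := kap_int_right x x v ltac:(lra) ltac:(lra)).
  assert (G3 := Qint_le (x - u) (v - u) ltac:(lra)). assert (G4 := Qint_le (v - x) (v - u) ltac:(lra)).
  unfold plus; simpl. lra.
Qed.

Lemma weighted_int_le h x t : rcont h -> (forall s, 0 <= h s <= kap p eps (x - s)) ->
  Rabs (RInt h 0 t) <= 2 * Qint (Rabs t).
Proof.
  intros Hh H. eapply Rle_trans.
  { apply Rabs_RInt_le with (k := fun s => kap p eps (x - s)); auto. now apply rcont_kap. }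
  rewrite RInt_abs_nonneg; [|now apply rcont_kap|intros; left; apply kap_pos].
  destruct Rle_dec as [Ht|Ht].
  - rewrite Rabs_pos_eq by auto. replace t with (t - 0) at 2 by ring. now apply kap_int.
  - rewrite Rabs_left by lra. replace (- t) with (0 - t) by ring. apply kap_int. lra.
Qed.

(** Beyond |t| = S the integral is constant, equal to the one up to S or -S according to the sign of
    [t]. *)
Lemma weighted_int_support_le h S x t : 0 <= S -> rcont h -> (forall s, 0 <= h s <= kap p eps (x - s)) ->
  (forall s, S <= Rabs s -> h s = 0) -> Rabs (RInt h 0 t) <= 2 * Qint S.
Proof.
  intros HS Hh H H0.
  destruct (Rle_dec (Rabs t) S) as [Ht|Ht].
  { eapply Rle_trans; [now apply (weighted_int_le h x)|].
    assert (G := Qint_le (Rabs t) S (conj (Rabs_pos t) Ht)). lra. }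
  assert (E : exists S', Rabs S' = S /\ RInt h S' t = 0).
  { assert (Z : forall a b, (forall s, Rmin a b < s < Rmax a b -> S <= Rabs s) -> RInt h a b = 0).
    { intros a b Hs. rewrite (RInt_ext h (fun _ => 0)).
      - rewrite RInt_const. unfold scal; simpl; unfold mult; simpl. ring.
      - intros s Hs'. apply H0, Hs, Hs'. }
    destruct (Rle_dec 0 t) as [Ht0|Ht0].
    - rewrite Rabs_pos_eq in Ht by auto. exists S. split; [now apply Rabs_pos_eq|]. apply Z.
      intros s. rewrite Rmin_left, Rmax_right by lra. intros Hs. rewrite Rabs_pos_eq; lra.
    - rewrite Rabs_left in Ht by lra. exists (- S). split; [rewrite Rabs_Ropp; now apply Rabs_pos_eq|].
      apply Z. intros s. rewrite Rmin_right, Rmax_left by lra. intros Hs. rewrite Rabs_left; lra. }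
  destruct E as [S' [E1 E2]].
  rewrite <- (RInt_Chasles h 0 S' t) by (now apply rcont_ex_RInt).
  rewrite E2. unfold plus; simpl. rewrite Rplus_0_r, <- E1. now apply (weighted_int_le h x).
Qed.

End WeightIntegral.

(** * Asymptotics *)

(** On |y| <= L r the Lipschitz constant of the power is p (L r)^(p-1), whose dependence on r
    cancels the coefficient r^(1-p). *)
Lemma source_lip a p alpha eps : 1 < p -> 0 < eps -> forall L, 0 <= L -> exists K, 0 <= K /\
  forall r y z, 0 < r -> Cmod y <= L * r -> Cmod z <= L * r ->
    Cmod (Cminus (source a p alpha eps r y) (source a p alpha eps r z)) <= K * Cmod (Cminus y z).
Proof.
  intros Hp Heps L HL.
  set (A := Rpower eps alpha * Cmod (Cmult (Copp a) (RtoC (Rpower 2 (- p))))).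
  assert (HA : 0 <= A) by (apply Rmult_le_pos; [left; apply Rpower_gt_0|apply Cmod_ge_0]).
  assert (Hr := rp_ge_0 (p - 1) L).
  exists (A * (p * rp (p - 1) L)). split.
  { apply Rmult_le_pos; auto. apply Rmult_le_pos; lra. }
  intros r y z Hr0 Hy Hz. unfold source, g. fold (pw p y). fold (pw p z).
  replace (Cminus _ _) with (Cmult (RtoC (Rpower eps alpha * Rpower r (1 - p)))
    (Cmult (Cmult (Copp a) (RtoC (Rpower 2 (- p)))) (Cminus (pw p y) (pw p z)))) by ring.
  assert (P1 := Rpower_gt_0 eps alpha). assert (P2 := Rpower_gt_0 r (1 - p)).
  rewrite Cmod_scal, Cmod_mult, Rabs_pos_eq by (apply Rmult_le_pos; lra).
  assert (G := pw_lip p (L * r) y z Hp Hy Hz).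
  rewrite rp_mult, (rp_pos _ r) in G by lra.
  assert (E : Rpower r (1 - p) * Rpower r (p - 1) = 1).
  { rewrite <- Rpower_plus. replace (1 - p + (p - 1)) with 0 by ring. now apply Rpower_O. }
  replace (Rpower eps alpha * Rpower r (1 - p) * (Cmod (Copp a * RtoC (Rpower 2 (- p))) * Cmod (Cminus (pw p y) (pw p z))))
    with (A * (Rpower r (1 - p) * Cmod (Cminus (pw p y) (pw p z)))) by (unfold A; ring).
  rewrite (Rmult_assoc A). apply Rmult_le_compat_l; auto.
  apply Rle_trans with (Rpower r (1 - p) * (p * (rp (p - 1) L * Rpower r (p - 1)) * Cmod (Cminus y z))).
  - apply Rmult_le_compat_l; lra.
  - right. transitivity (p * rp (p - 1) L * Cmod (Cminus y z) * (Rpower r (1 - p) * Rpower r (p - 1))); [ring|].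
    rewrite E. ring.
Qed.

Lemma der_in_ext_on (D : R -> Prop) f h x l :
  (forall y, D y -> f y = h y) -> D x -> der_in D f x l -> der_in D h x l.
Proof.
  intros E Dx H e He. destruct (H e He) as [d [Hd G]]. exists d. split; auto.
  intros y Dy Hy. rewrite <- !E by auto. auto.
Qed.

Lemma cont2_in_ext_on (D : R -> R -> Prop) f h x y :
  (forall u v, D u v -> f u v = h u v) -> D x y -> cont2_in D f x y -> cont2_in D h x y.
Proof.
  intros E Dxy H e He. destruct (H e He) as [d [Hd G]]. exists d. split; auto.
  intros u v Du Hu Hv. rewrite <- !E by auto. auto.
Qed.

Lemma partial1_slab_ext T (f h : R * R -> C) t r : Rbar_lt 0 T -> Ck_on (V := CR) 1 (slab T) f ->
  (forall q, slab T q -> f q = h q) -> slab T (t, r) ->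
  partial1 (V := CR) (slab T) h (t, r) = partial1 (V := CR) (slab T) f (t, r).
Proof.
  intros HT Hf E H. apply partial1_slab; auto.
  apply (der_in_ext_on _ (fun s => f (s, r))); auto. now apply (Ck_on_1_elim T HT f Hf).
Qed.

Lemma partial2_slab_ext T (f h : R * R -> C) t r : Rbar_lt 0 T -> Ck_on (V := CR) 1 (slab T) f ->
  (forall q, slab T q -> f q = h q) -> slab T (t, r) ->
  partial2 (V := CR) (slab T) h (t, r) = partial2 (V := CR) (slab T) f (t, r).
Proof.
  intros HT Hf E H. apply partial2_slab; auto.
  apply (der_in_ext_on _ (fun s => f (t, s))); auto. now apply (Ck_on_1_elim T HT f Hf).
Qed.

Lemma Ck_on_1_slab_ext T (f h : R * R -> C) : Rbar_lt 0 T -> Ck_on (V := CR) 1 (slab T) f ->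
  (forall q, slab T q -> f q = h q) -> Ck_on (V := CR) 1 (slab T) h.
Proof.
  intros HT Hf E. destruct (Ck_on_1_elim T HT f Hf) as [D1 [D2 [C0 [C1 C2]]]].
  apply (Ck_on_1_intro T HT h (partial1 (V := CR) (slab T) f) (partial2 (V := CR) (slab T) f)); auto.
  - intros t r H. apply (der_in_ext_on _ (fun s => f (s, r))); auto.
  - intros t r H. apply (der_in_ext_on _ (fun s => f (t, s))); auto.
  - intros t r H. apply (cont2_in_ext_on _ (fun u v => f (u, v))); auto.
Qed.

(** The explicit formula for the free incoming component agrees on the slab with the trace of a
    function of the plane, but in general not outside it. *)
Lemma is_solution_ext T F bm bp vm vp wm wp : Rbar_lt 0 T -> is_solution T F bm bp vm vp ->
  (forall q, slab T q -> vm q = wm q) -> (forall q, slab T q -> vp q = wp q) ->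
  is_solution T F bm bp wm wp.
Proof.
  intros HT [Hm [Hp [He [H0 Hi]]]] Em Ep.
  split; [now apply (Ck_on_1_slab_ext T vm)|]. split; [now apply (Ck_on_1_slab_ext T vp)|].
  split; [|split].
  - intros t r H Hr. rewrite (partial1_slab_ext T vp wp), (partial2_slab_ext T vp wp),
      (partial1_slab_ext T vm wm), (partial2_slab_ext T vm wm), <- Em, <- Ep; auto.
  - intros t H. rewrite <- Em, <- Ep; auto.
  - intros r Hr. assert (H : slab T (0, r)).
    { unfold slab; simpl. split; [lra|]. split; [exact (Rbar_lt_le 0 T HT)|auto]. }
    rewrite <- Em, <- Ep; auto.
Qed.

(** * The free problem *)

Section Free.

Variables (T : Rbar) (r0 eps M : R) (U0 U1 : R * R -> R) (c c' : R -> C).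
Hypothesis HT : Rbar_lt 0 T.
Hypothesis c_pulse : pulse eps M c c'.
Hypothesis c_eq : forall x, c x = RtoC (P_minus U0 U1 (x, (x - r0) / eps) - P_plus U0 U1 (- x, (- x - r0) / eps)).

(** Without a source, W does not depend on [t]: the reflected datum is transported unchanged. *)
Let W0 (t x : R) : C := c x.
Let W0x (t x : R) : C := c' x.
Let Z (t x : R) : C := RtoC 0.

Lemma ext0_neg f q : fst q <= 0 -> f (0, snd q) = 0 -> ext0 f q = 0.
Proof.
  intros H H0. unfold ext0. destruct Rle_dec as [H1|H1]; auto.
  destruct q as [x z]; simpl in *. replace x with 0 by lra. auto.
Qed.

Lemma P_minus_neg x z : x <= 0 -> P_minus U0 U1 (x, z) = 0.
Proof. intros H. apply ext0_neg; simpl; auto; ring. Qed.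

Lemma P_plus_neg x z : x <= 0 -> P_plus U0 U1 (x, z) = 0.
Proof. intros H. apply ext0_neg; simpl; auto; ring. Qed.

Lemma free_minus_eq q : slab T q -> incoming W0 q = free_minus U0 U1 r0 eps q.
Proof.
  destruct q as [t r]. intros [H1 [_ H2]]; simpl in *. unfold incoming, W0; simpl.
  rewrite c_eq, (P_plus_neg (- (t + r))) by lra. rewrite Rminus_0_r, (Rplus_comm t r). reflexivity.
Qed.

Lemma free_plus_eq q : slab T q -> outgoing W0 q = free_plus U0 U1 r0 eps q.
Proof.
  destruct q as [t r]. intros _; simpl in *. unfold outgoing, W0; simpl.
  rewrite c_eq, <- RtoC_opp. f_equal.
  replace (- (t - r)) with (r - t) by ring. ring.
Qed.

Lemma const_cont2 (f : R -> C) : ccont f -> forall t x, cont2_in full2 (fun _ : R => f) t x.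
Proof.
  intros Hf t x e He. destruct (Hf x e He) as [d [Hd G]]. exists d. split; auto.
Qed.

Lemma W0_t t x : der_in full (fun t => W0 t x) t (Z t x).
Proof.
  intros e He. exists 1. split; [lra|]. intros y _ _. unfold W0, Z.
  replace (Cminus _ _) with (RtoC 0) by ring. rewrite Cmod_0. apply Rmult_le_pos; [lra|apply Rabs_pos].
Qed.

Lemma W0_x t x : der_in full (W0 t) x (W0x t x).
Proof. apply c_pulse. Qed.

Lemma W0x_cont t x : cont2_in full2 W0x t x.
Proof.
  apply const_cont2. intros y e He. destruct c_pulse as [_ [H _]].
  destruct (H (e / 2)) as [d [Hd G]]; [lra|]. exists d. split; auto.
  intros u _ Hu. specialize (G u y (Rlt_le _ _ Hu)). eapply Rle_lt_trans; [exact G|lra].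
Qed.

Lemma W0_cont t x : cont2_in full2 W0 t x.
Proof. apply const_cont2. intros y. eapply der_in_cont, c_pulse. Qed.

Lemma Z_cont t x : cont2_in full2 Z t x.
Proof.
  intros e He. exists 1. split; [lra|]. intros. unfold Z.
  replace (Cminus _ _) with (RtoC 0) by ring. rewrite Cmod_0. lra.
Qed.

Lemma free_solution : is_solution T (fun _ _ => RtoC 0)
  (fun r => RtoC (P_minus U0 U1 (r, (r - r0) / eps)))
  (fun r => RtoC (P_plus U0 U1 (r, (r - r0) / eps)))
  (free_minus U0 U1 r0 eps) (free_plus U0 U1 r0 eps).
Proof.
  apply (is_solution_ext T _ _ _ (incoming W0) (outgoing W0)); auto using free_minus_eq, free_plus_eq.
  apply (plane_solution T _ _ _ W0 Z W0x HT W0_t W0_x W0_cont Z_cont W0x_cont).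
  - reflexivity.
  - intros. unfold Z. ring.
  - intros r Hr. unfold W0. rewrite !c_eq, Ropp_involutive.
    rewrite (P_plus_neg (- r)), (P_minus_neg (- r)) by lra.
    rewrite Rminus_0_r. split; [reflexivity|]. rewrite <- RtoC_opp. f_equal; ring.
Qed.

Lemma partial1_free_minus t r : slab T (t, r) ->
  partial1 (V := CR) (slab T) (free_minus U0 U1 r0 eps) (t, r) = c' (t + r).
Proof.
  intros H. apply partial1_slab; auto.
  apply (der_in_ext_on _ (fun s => incoming W0 (s, r))); [|exact H|].
  - intros y Hy. now apply free_minus_eq.
  - apply der_in_full_sub. assert (G := incoming_der_t W0 Z W0x W0_t W0_x Z_cont t r).
    replace (Cplus _ _) with (c' (t + r)) in G by (unfold Z, W0x; ring). exact G.
Qed.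

Lemma partial1_free_plus t r : slab T (t, r) ->
  partial1 (V := CR) (slab T) (free_plus U0 U1 r0 eps) (t, r) = Copp (c' (t - r)).
Proof.
  intros H. apply partial1_slab; auto.
  apply (der_in_ext_on _ (fun s => outgoing W0 (s, r))); [|exact H|].
  - intros y Hy. now apply free_plus_eq.
  - apply der_in_full_sub. assert (G := outgoing_der_t W0 Z W0x W0_t W0_x Z_cont t r).
    replace (Copp _) with (Copp (c' (t - r))) in G by (unfold Z, W0x; ring). exact G.
Qed.

Lemma free_unique : is_unique_free_solution T r0 U0 U1 eps (free_minus U0 U1 r0 eps) (free_plus U0 U1 r0 eps).
Proof.
  split; [apply free_solution|]. intros wm wp Hw.
  eapply uniqueness; [exact HT| |apply free_solution|exact Hw].
  intros L _. exists 0. split; [lra|]. intros.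
  replace (Cminus (RtoC 0) (RtoC 0)) with (RtoC 0) by ring. rewrite Cmod_0. lra.
Qed.

End Free.

Definition coef (a : C) (p alpha eps : R) : C :=
  Cmult (RtoC (Rpower eps alpha)) (Cmult (Copp a) (RtoC (Rpower 2 (- p)))).

Lemma Cmod_coef a p alpha eps :
  Cmod (coef a p alpha eps) = Cmod a * Rpower 2 (- p) * Rpower eps alpha.
Proof.
  unfold coef. rewrite Cmod_scal, Cmod_mult, Cmod_opp, Cmod_R, !Rabs_pos_eq
    by (left; apply Rpower_gt_0). ring.
Qed.

Lemma source_psi a p alpha eps r y : 0 < r -> source a p alpha eps r y = Cmult (coef a p alpha eps) (psi p r y).
Proof.
  intros Hr. unfold source, g, coef, psi, pw. rewrite (Rabs_pos_eq r) by lra. rewrite RtoC_mult. ring.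
Qed.

Lemma psi_opp p s y : psi p (- s) (Copp y) = Copp (psi p s y).
Proof. unfold psi. rewrite Rabs_Ropp, pw_opp. ring. Qed.

(** The factor [chi] may switch the source off in time and equals 1 on the slab, so bounded and
    unbounded time intervals share one construction. The t-derivative at fixed r is W_t + W_x up to
    sign; accordingly the terms of [E2] come from W_t, W_x - b' and b' - c'. *)
Lemma nonlinear_solution T a p alpha r0 U0 U1 eps M J0 (chi : R -> R) (b b' c c' : R -> C) :
  1 < p -> 0 < eps -> 0 < M -> Rbar_lt 0 T ->
  (forall s t, Rabs (chi s - chi t) <= Rabs (s - t)) -> (forall s, 0 <= chi s <= 1) ->
  (forall t, slab T (t, 0) -> chi t = 1) ->
  (forall x t, Rabs (RInt (fun s => chi s * kap p eps (x - s)) 0 t) <= J0) ->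
  16 * p * psi_const p M * (Cmod (coef a p alpha eps) * J0) <= 1 ->
  pulse eps M b b' -> pulse eps M c c' ->
  (forall x, Cmod (Cminus (b x) (c x)) <= M * eps) ->
  (forall x, Cmod (Cminus (b' x) (c' x)) <= M) ->
  (forall r, 0 <= r -> b r = data_minus U0 U1 r0 eps r /\ b (- r) = Copp (data_plus U0 U1 r0 eps r)) ->
  (forall x, c x = RtoC (P_minus U0 U1 (x, (x - r0) / eps) - P_plus U0 U1 (- x, (- x - r0) / eps))) ->
  exists vm vp, is_unique_nonlinear_solution T a p alpha r0 U0 U1 eps vm vp /\
    let E1 := 4 * psi_const p M * M * (Cmod (coef a p alpha eps) * J0) + M * eps in
    let E2 := eps * time_lip p eps M (Cmod (coef a p alpha eps))
       + 16 * p * psi_const p M * M * (Cmod (coef a p alpha eps) * J0) + M * eps in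
    forall q, slab T q ->
      Cmod (Cminus (vm q) (free_minus U0 U1 r0 eps q)) <= E1 /\
      Cmod (Cminus (vp q) (free_plus U0 U1 r0 eps q)) <= E1 /\
      Cmod (Cminus (Cmult (RtoC eps) (partial1 (V := CR) (slab T) vm q))
        (Cmult (RtoC eps) (partial1 (V := CR) (slab T) (free_minus U0 U1 r0 eps) q))) <= E2 /\
      Cmod (Cminus (Cmult (RtoC eps) (partial1 (V := CR) (slab T) vp q))
        (Cmult (RtoC eps) (partial1 (V := CR) (slab T) (free_plus U0 U1 r0 eps) q))) <= E2.
Proof.
  intros Hp Heps HM HT Hchi Hchi1 HchiT HJ0 Hsmall Hb Hc Hbc Hbc' Hdata Hcf.
  set (k := coef a p alpha eps) in *. set (Lam := Cmod k) in *. set (J := Lam * J0) in *.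
  assert (HLam : 0 <= Lam) by apply Cmod_ge_0.
  set (lam := fun s => Cmult (RtoC (chi s)) k).
  assert (lam_mod : forall s, Cmod (lam s) = Lam * chi s).
  { intros s. unfold lam. rewrite Cmod_scal, Rabs_pos_eq by apply Hchi1. unfold Lam. ring. }
  assert (lam_le : forall s, Cmod (lam s) <= Lam).
  { intros s. rewrite lam_mod. specialize (Hchi1 s). nra. }
  assert (lam_cont : ccont lam).
  { intros s e He. exists (e / (1 + Lam)). split; [apply Rdiv_lt_0_compat; lra|]. intros u _ Hu.
    unfold lam. replace (Cminus _ _) with (Cmult (RtoC (chi u - chi s)) k) by (rewrite RtoC_minus; ring).
    rewrite Cmod_scal. fold Lam. assert (G := Hchi u s).
    apply Rle_lt_trans with (e / (1 + Lam) * Lam); [apply Rmult_le_compat_r; lra|].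
    replace (e / (1 + Lam) * Lam) with (e - e / (1 + Lam)) by (field; lra).
    assert (0 < e / (1 + Lam)) by (apply Rdiv_lt_0_compat; lra). lra. }
  assert (chi_cont : rcont chi).
  { apply rcont_nonneg_lip1; auto. intros s. apply Hchi1. }
  assert (HJ : forall x t, Rabs (RInt (fun s => Cmod (lam s) * kap p eps (x - s)) 0 t) <= J).
  { intros x t. rewrite (RInt_ext _ (fun s => Lam * (chi s * kap p eps (x - s)))).
    - rewrite Rabs_RInt_scal.
      + rewrite Rabs_pos_eq by auto. apply Rmult_le_compat_l; auto.
      + apply rcont_mult; auto. now apply rcont_kap.
    - intros s _. rewrite lam_mod. apply Rmult_assoc. }
  assert (Hb' := Hb). destruct Hb' as [b_der [b'_unif [b_le b'_le]]].
  assert (b_lip := pulse_lip _ _ _ _ Hb).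
  destruct (fixed_point_exists p eps M Lam J lam b Hp Heps ltac:(lra) lam_cont lam_le b_le b_lip HJ Hsmall)
    as [W [W_class W_fix]].
  destruct (space_derivative p eps M Lam J lam b b' W Hp Heps HM lam_cont lam_le b_der b'_unif HJ Hsmall W_class W_fix)
    as [Wx [W_x [Wx_cont Wx_b]]].
  set (Wt := rhs p lam W).
  assert (W_t : forall t x, der_in full (fun t => W t x) t (Wt t x)).
  { intros t x. apply (der_in_ext _ (fun t => picard p lam b W t x)).
    - intros; symmetry; apply W_fix.
    - assert (G := RInt_CR_der (fun s => rhs p lam W s x) t
        (rhs_ccont p eps M Lam lam Hp Heps ltac:(lra) lam_cont lam_le W x W_class)).
      intros e He. destruct (G e He) as [d [Hd G1]]. exists d. split; auto.
      intros y Dy Hy. eapply Rle_trans; [|exact (G1 y Dy Hy)].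
      right. unfold picard, Wt. f_equal. ring. }
  assert (Wt_cont : forall t x, cont2_in full2 Wt t x).
  { intros t x. apply (rhs_cont p eps M Lam lam); auto; lra. }
  assert (Wt_le : forall t x, Cmod (Wt t x) <= time_lip p eps M Lam).
  { intros t x. apply (rhs_le_time_lip p eps M Lam lam); auto; lra. }
  assert (W_cont : forall t x, cont2_in full2 W t x).
  { intros t x e He. destruct W_class as [_ [L1 L2]].
    assert (HL := time_lip_ge_0 p eps M Lam lam ltac:(lra) lam_le). set (L := time_lip p eps M Lam) in *.
    assert (HMe := Meps_ge_0 eps M Heps ltac:(lra)).
    set (Q := 1 + L + 2 * (M / eps)). assert (HQ : 0 < Q) by (unfold Q; lra).
    exists (e / Q). split; [apply Rdiv_lt_0_compat; lra|]. intros u v _ Hu Hv.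
    eapply Rle_lt_trans; [apply (Cmod_minus_triangle _ (W t v))|].
    assert (G1 := L2 u t v). assert (G2 := L1 t v x).
    replace (2 * M / eps) with (2 * (M / eps)) in G2 by (unfold Rdiv; ring).
    assert (L * Rabs (u - t) <= L * (e / Q)) by (apply Rmult_le_compat_l; lra).
    assert (2 * (M / eps) * Rabs (v - x) <= 2 * (M / eps) * (e / Q)) by (apply Rmult_le_compat_l; lra).
    assert (E : Q * (e / Q) = e) by (field; lra). unfold Q in E at 1.
    assert (0 < e / Q) by (apply Rdiv_lt_0_compat; lra). lra. }
  assert (chi_slab : forall t r, slab T (t, r) -> lam t = k).
  { intros t r H. unfold lam. rewrite HchiT; [ring|].
    destruct H as [H1 [H2 _]]. unfold slab; simpl in *. split; auto. split; auto. lra. }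
  assert (W_plus : forall t r, slab T (t, r) -> 0 < r ->
    Wt t (t + r) = source a p alpha eps r (Cminus (W t (t + r)) (W t (t - r)))).
  { intros t r H Hr. rewrite source_psi by auto. unfold Wt, rhs, jump.
    rewrite (chi_slab t r H). fold k. replace (t + r - t) with r by ring.
    replace (2 * t - (t + r)) with (t - r) by ring. reflexivity. }
  (* At x = t - r both the jump and x - t change sign; [psi] is odd under this change, which
     produces the sign required of the reflected component. *)
  assert (W_minus : forall t r, slab T (t, r) -> 0 < r ->
    Wt t (t - r) = Copp (source a p alpha eps r (Cminus (W t (t + r)) (W t (t - r))))).
  { intros t r H Hr. rewrite source_psi by auto. unfold Wt, rhs, jump.
    rewrite (chi_slab t r H). fold k. replace (t - r - t) with (- r) by ring.
    replace (2 * t - (t - r)) with (t + r) by ring.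
    replace (Cminus (W t (t - r)) (W t (t + r))) with (Copp (Cminus (W t (t + r)) (W t (t - r)))) by ring.
    rewrite psi_opp. ring. }
  assert (W_b : forall x, W 0 x = b x).
  { intros x. rewrite W_fix. unfold picard, CInt.
    rewrite (RInt_point (V := CR)). apply Cplus_0_r. }
  assert (Sol : is_solution T (source a p alpha eps) (data_minus U0 U1 r0 eps) (data_plus U0 U1 r0 eps)
    (incoming W) (outgoing W)).
  { apply (plane_solution T _ _ _ W Wt Wx); auto.
    intros r Hr. rewrite !W_b. now apply Hdata. }
  exists (incoming W), (outgoing W). split.
  { split; auto. intros wm wp Hw. eapply uniqueness; [exact HT| |exact Sol|exact Hw].
    now apply source_lip. }
  intros E1 E2 [t r] Hq.
  assert (B1 : forall x, Cmod (Cminus (W t x) (c x)) <= E1).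
  { intros x. eapply Rle_trans; [apply (Cmod_minus_triangle _ (b x))|].
    assert (G := picard_bound p eps M Lam J lam b Hp Heps ltac:(lra) lam_cont lam_le HJ W t x W_class).
    rewrite <- W_fix in G. assert (G2 := Hbc x). unfold E1. lra. }
  assert (B2 : forall x, Cmod (Cminus (Cmult (RtoC eps) (Cplus (Wt t x) (Wx t x))) (Cmult (RtoC eps) (c' x))) <= E2).
  { intros x. replace (Cminus _ _) with (Cmult (RtoC eps) (Cplus (Wt t x) (Cplus (Cminus (Wx t x) (b' x)) (Cminus (b' x) (c' x))))) by ring.
    rewrite Cmod_scal, Rabs_pos_eq by lra.
    assert (G1 := Wt_le t x). assert (G2 := Wx_b t x). assert (G3 := Hbc' x).
    assert (G4 := Cmod_triangle (Wt t x) (Cplus (Cminus (Wx t x) (b' x)) (Cminus (b' x) (c' x)))).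
    assert (G5 := Cmod_triangle (Cminus (Wx t x) (b' x)) (Cminus (b' x) (c' x))).
    apply Rle_trans with (eps * (time_lip p eps M Lam + (16 * p * psi_const p M * J * (M / eps) + M))).
    - apply Rmult_le_compat_l; lra.
    - unfold E2. right. field. lra. }
  split; [|split; [|split]].
  - rewrite <- (free_minus_eq T r0 eps U0 U1 c Hcf _ Hq). apply B1.
  - rewrite <- (free_plus_eq T r0 eps U0 U1 c Hcf _ Hq). unfold outgoing; simpl.
    replace (Cminus _ _) with (Copp (Cminus (W t (t - r)) (c (t - r)))) by ring. rewrite Cmod_opp. apply B1.
  - rewrite (partial1_incoming T W Wt Wx HT W_t W_x Wt_cont) by auto.
    rewrite (partial1_free_minus T r0 eps M U0 U1 c c' HT Hc Hcf) by auto. apply B2.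
  - rewrite (partial1_outgoing T W Wt Wx HT W_t W_x Wt_cont) by auto.
    rewrite (partial1_free_plus T r0 eps M U0 U1 c c' HT Hc Hcf) by auto.
    replace (Cminus _ _) with (Copp (Cminus (Cmult (RtoC eps) (Cplus (Wt t (t - r)) (Wx t (t - r))))
       (Cmult (RtoC eps) (c' (t - r))))) by ring.
    rewrite Cmod_opp. apply B2.
Qed.

Lemma at_right_0_intro (P : R -> Prop) e0 : 0 < e0 -> (forall e, 0 < e <= e0 -> P e) -> at_right 0 P.
Proof.
  intros He H. exists (mkposreal e0 He). intros e He1 He2. apply H. split; auto.
  unfold ball in He1; simpl in He1; unfold AbsRing_ball, abs, minus, plus, opp in He1; simpl in He1.
  rewrite Ropp_0, Rplus_0_r in He1. apply Rabs_lt_between in He1. lra.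
Qed.

(** Three errors have to be dominated by [eta]: the integral term eps^alpha J0, the contribution eps
    of P_1, and eps times the time derivative, of order eps^(alpha + 2 - p). The last hypothesis
    provides the smallness for the contraction. *)
Lemma solution_family T a p alpha r0 z0 U0 U1 (chi J0 eta : R -> R) K e2 :
  1 < p -> 0 < r0 -> 0 < z0 -> admissible_profile z0 U0 -> admissible_profile z0 U1 -> Rbar_lt 0 T ->
  (forall s t, Rabs (chi s - chi t) <= Rabs (s - t)) -> (forall s, 0 <= chi s <= 1) ->
  (forall t, slab T (t, 0) -> chi t = 1) ->
  (forall eps x t, 0 < eps <= 1 -> Rabs (RInt (fun s => chi s * kap p eps (x - s)) 0 t) <= J0 eps) ->
  0 < e2 -> 0 <= K ->
  (forall eps, 0 < eps <= e2 -> Rpower eps alpha * J0 eps <= K * eta eps /\ eps <= K * eta eps /\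
     Rpower eps (alpha + 2 - p) <= K * eta eps) ->
  (forall d, 0 < d -> exists e3, 0 < e3 /\ forall eps, 0 < eps <= e3 -> Rpower eps alpha * J0 eps <= d) ->
  exists (eps0 : R) (vm vp : R -> R * R -> C), 0 < eps0 <= 1 /\
     (forall eps, 0 < eps <= eps0 ->
        is_unique_nonlinear_solution T a p alpha r0 U0 U1 eps (vm eps) (vp eps)) /\
     C1_asymptotics T vm (free_minus U0 U1 r0) eta /\ C1_asymptotics T vp (free_plus U0 U1 r0) eta.
Proof.
  intros Hp Hr0 Hz0 HU0 HU1 HT Hchi Hchi1 HchiT HJ0 He2 HK Heta Hlim.
  destruct (initial_data r0 z0 U0 U1 Hr0 Hz0 HU0 HU1) as [e1 [M [He1 [HM Hdata]]]].
  set (A := Cmod a * Rpower 2 (- p)).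
  assert (HA : 0 <= A) by (apply Rmult_le_pos; [apply Cmod_ge_0|left; apply Rpower_gt_0]).
  assert (HB := psi_const_ge_0 p M). set (B := psi_const p M) in *.
  assert (HpB : 0 <= p * B) by (apply Rmult_le_pos; lra).
  assert (HpBA : 0 <= 16 * p * B * A) by (apply Rmult_le_pos; lra).
  (* Tuned to the smallness condition of [nonlinear_solution]; the added 1 keeps the denominator
     positive when a = 0. *)
  destruct (Hlim (/ (1 + 16 * p * B * A))) as [e3 [He3 Hs]]; [apply Rinv_0_lt_compat; lra|].
  set (eps0 := Rmin e1 (Rmin e2 e3)).
  assert (Hpos : 0 < eps0) by (unfold eps0; repeat apply Rmin_pos; lra).
  assert (L1 : eps0 <= e1) by apply Rmin_l.
  assert (L2 : eps0 <= e2) by (unfold eps0; eapply Rle_trans; [apply Rmin_r|apply Rmin_l]).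
  assert (L3 : eps0 <= e3) by (unfold eps0; eapply Rle_trans; [apply Rmin_r|apply Rmin_r]).
  set (K1 := (4 * B * M * A + 4 * M * A * B + 16 * p * B * M * A + M) * K).
  assert (HX : forall eps, exists v : (R * R -> C) * (R * R -> C), 0 < eps <= eps0 ->
     is_unique_nonlinear_solution T a p alpha r0 U0 U1 eps (fst v) (snd v) /\
     forall q, slab T q ->
      Cmod (Cminus (fst v q) (free_minus U0 U1 r0 eps q)) <= K1 * eta eps /\
      Cmod (Cminus (snd v q) (free_plus U0 U1 r0 eps q)) <= K1 * eta eps /\
      Cmod (Cminus (Cmult (RtoC eps) (partial1 (V := CR) (slab T) (fst v) q))
        (Cmult (RtoC eps) (partial1 (V := CR) (slab T) (free_minus U0 U1 r0 eps) q))) <= K1 * eta eps /\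
      Cmod (Cminus (Cmult (RtoC eps) (partial1 (V := CR) (slab T) (snd v) q))
        (Cmult (RtoC eps) (partial1 (V := CR) (slab T) (free_plus U0 U1 r0 eps) q))) <= K1 * eta eps).
  { intros eps. destruct (Rlt_dec 0 eps) as [P1|P1]; [destruct (Rle_dec eps eps0) as [P2|P2]|].
    (* For eps outside ]0, eps0] an arbitrary pair is supplied, so that the choice yields functions
       of every real eps. *)
    2,3: exists (fun _ => RtoC 0, fun _ => RtoC 0); intros; lra.
    destruct (Hdata eps ltac:(lra)) as [b [b' [c [c' [D1 [D2 [D3 [D4 [D5 D6]]]]]]]]].
    assert (Hk := Cmod_coef a p alpha eps). fold A in Hk.
    assert (HR := Rpower_gt_0 eps alpha).
    specialize (Hs eps ltac:(lra)). destruct (Heta eps ltac:(lra)) as [N1 [N2 N3]].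
    assert (HJp : 0 <= J0 eps) by (eapply Rle_trans; [apply Rabs_pos|apply (HJ0 eps 0 0); lra]).
    assert (HRJ : 0 <= Rpower eps alpha * J0 eps) by (apply Rmult_le_pos; lra).
    destruct (nonlinear_solution T a p alpha r0 U0 U1 eps M (J0 eps) chi b b' c c') as [vm [vp [S E]]]; auto.
    { intros x t. apply HJ0. lra. }
    { rewrite Hk. fold B. replace (16 * p * B * (A * Rpower eps alpha * J0 eps)) with
        (16 * p * B * A * (Rpower eps alpha * J0 eps)) by ring.
      apply Rle_trans with (16 * p * B * A * / (1 + 16 * p * B * A)); [apply Rmult_le_compat_l; auto|].
      apply Rmult_le_reg_r with (1 + 16 * p * B * A); [lra|].
      rewrite Rmult_assoc, Rinv_l; lra. }
    exists (vm, vp). intros _. split; auto. simpl.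
    assert (HKe : 0 <= K * eta eps) by lra.
    assert (HBMA : 0 <= B * M * A) by (apply Rmult_le_pos; auto; apply Rmult_le_pos; lra).
    assert (HpBMA : 0 <= p * (B * M * A)) by (apply Rmult_le_pos; lra).
    set (kJ := Cmod (coef a p alpha eps) * J0 eps) in *.
    assert (EkJ : kJ = A * (Rpower eps alpha * J0 eps)) by (unfold kJ; rewrite Hk; ring).
    assert (ELt : eps * time_lip p eps M (Cmod (coef a p alpha eps)) = 4 * M * A * B * Rpower eps (alpha + 2 - p)).
    { unfold time_lip, kap_sup. fold B. rewrite Hk.
      replace (alpha + 2 - p) with (alpha + ((1 - p) + 1)) by ring.
      rewrite !Rpower_plus, (Rpower_1 eps) by lra. ring. }
    assert (F1 : B * M * A * (Rpower eps alpha * J0 eps) <= B * M * A * (K * eta eps)) by (apply Rmult_le_compat_l; lra).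
    assert (F2 : p * (B * M * A) * (Rpower eps alpha * J0 eps) <= p * (B * M * A) * (K * eta eps)) by (apply Rmult_le_compat_l; lra).
    assert (F3 : B * M * A * Rpower eps (alpha + 2 - p) <= B * M * A * (K * eta eps)) by (apply Rmult_le_compat_l; lra).
    assert (F4 : M * eps <= M * (K * eta eps)) by (apply Rmult_le_compat_l; lra).
    assert (F5 : 0 <= B * M * A * (K * eta eps)) by (apply Rmult_le_pos; lra).
    assert (F6 : 0 <= p * (B * M * A) * (K * eta eps)) by (apply Rmult_le_pos; lra).
    assert (G1 : 4 * B * M * kJ + M * eps <= K1 * eta eps) by (rewrite EkJ; unfold K1; lra).
    assert (G2 : eps * time_lip p eps M (Cmod (coef a p alpha eps)) + 16 * p * B * M * kJ + M * eps <= K1 * eta eps)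
      by (rewrite ELt, EkJ; unfold K1; lra).
    intros q Hq. destruct (E q Hq) as [Q1 [Q2 [Q3 Q4]]]. fold B in Q1, Q2, Q3, Q4.
    split; [exact (Rle_trans _ _ _ Q1 G1)|]. split; [exact (Rle_trans _ _ _ Q2 G1)|].
    split; [exact (Rle_trans _ _ _ Q3 G2)|exact (Rle_trans _ _ _ Q4 G2)]. }
  destruct (choice2 (fun eps (_ : unit) v => 0 < eps <= eps0 -> _) (fun eps _ => HX eps)) as [v Hv].
  exists eps0, (fun eps => fst (v eps tt)), (fun eps => snd (v eps tt)).
  split; [lra|]. split; [intros eps Heps; now apply (Hv eps tt)|].
  split; split; exists K1; apply (at_right_0_intro _ eps0 Hpos); intros eps Heps q Hq;
    destruct (proj2 (Hv eps tt Heps) q Hq) as [Q1 [Q2 [Q3 Q4]]].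
  - exact Q1.
  - exact Q3.
  - exact Q2.
  - exact Q4.
Qed.

(** * Rates in eps for the three ranges of p *)

Lemma Rpower_le_exp eps q r : 0 < eps <= 1 -> r <= q -> Rpower eps q <= Rpower eps r.
Proof.
  intros He H. unfold Rpower.
  assert (Hl : ln eps <= 0) by (rewrite <- ln_1; apply ln_le; lra).
  assert (Hq : q * ln eps <= r * ln eps) by nra.
  destruct Hq as [Hq|Hq]; [left; now apply exp_increasing|right; now f_equal].
Qed.

Lemma Rpower_small q d : 0 < q -> 0 < d -> exists e, 0 < e /\ forall eps, 0 < eps <= e -> Rpower eps q <= d.
Proof.
  intros Hq Hd. destruct (rp_small q d Hq Hd) as [e [He H]]. exists e. split; auto.
  intros eps Heps. rewrite <- rp_pos by lra. eapply Rle_trans; [|exact H]. apply rp_le; lra.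
Qed.

Lemma is_derive_power_primitive p u : p <> 2 -> 0 < u ->
  is_derive (fun u => Rpower u (2 - p) / (2 - p)) u (Rpower u (1 - p)).
Proof.
  intros Hp Hu.
  apply (is_derive_ext (fun u => / (2 - p) * Rpower u (2 - p))).
  { intros t. apply Rmult_comm. }
  replace (Rpower u (1 - p)) with (/ (2 - p) * ((2 - p) * Rpower u (2 - p - 1))).
  - apply (is_derive_scal (fun u => Rpower u (2 - p))). now apply is_derive_Rpower.
  - replace (2 - p - 1) with (1 - p) by ring. field. lra.
Qed.

(* For [p <= 2] the weight is not integrable on the line, so the nonlinearity is switched off
   after time [T]; the solution on [0, T] is not affected. *)
Definition cutoff (T s : R) : R := Rmax 0 (Rmin 1 (T + 1 - Rabs s)).

Lemma cutoff_lip T s t : Rabs (cutoff T s - cutoff T t) <= Rabs (s - t).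
Proof.
  assert (H := Rabs_triang_inv2 s t). apply Rabs_le_between in H.
  unfold cutoff, Rmax, Rmin. apply Rabs_le. repeat destruct Rle_dec; lra.
Qed.

Lemma cutoff_bounds T s : 0 <= cutoff T s <= 1.
Proof. unfold cutoff. split; [apply Rmax_l|]. apply Rmax_lub; [lra|apply Rmin_l]. Qed.

Lemma cutoff_eq_1 T s : Rabs s <= T -> cutoff T s = 1.
Proof. intros H. unfold cutoff. rewrite Rmin_left, Rmax_right; lra. Qed.

Lemma cutoff_eq_0 T s : T + 1 <= Rabs s -> cutoff T s = 0.
Proof. intros H. unfold cutoff. rewrite Rmin_right, Rmax_left; lra. Qed.

Lemma cutoff_rcont T : rcont (cutoff T).
Proof.
  apply rcont_nonneg_lip1; [|apply cutoff_lip]. intros s. apply cutoff_bounds.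
Qed.

Lemma cutoff_integral p eps P T x t : 1 < p -> 0 < eps -> 0 <= T ->
  (forall u, 0 < u -> is_derive P u (Rpower u (1 - p))) ->
  Rabs (RInt (fun s => cutoff T s * kap p eps (x - s)) 0 t) <= 2 * Qint eps P (T + 1).
Proof.
  intros Hp He HT HP. apply (weighted_int_support_le p eps P Hp He HP _ _ x); [lra| | |].
  - apply rcont_mult; [apply cutoff_rcont|now apply rcont_kap].
  - intros s. assert (H := cutoff_bounds T s). assert (H1 := kap_pos p eps (x - s)). nra.
  - intros s Hs. rewrite cutoff_eq_0; [ring|auto].
Qed.

(** From 1 + u <= exp u with u = -q ln eps. *)
Lemma ln_bound q eps : 0 < q -> 0 < eps <= 1 -> Rabs (ln eps) <= / q * Rpower eps (- q).
Proof.
  intros Hq He.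
  assert (Hl : ln eps <= 0) by (rewrite <- ln_1; apply ln_le; lra).
  rewrite Rabs_left1 by auto.
  assert (H := exp_ineq1_le (- q * ln eps)). fold (Rpower eps (- q)) in H.
  apply Rmult_le_reg_l with q; auto. rewrite <- Rmult_assoc, Rinv_r, Rmult_1_l by lra. lra.
Qed.

Theorem theorem1p1 :
  forall (a : C) (p r0 alpha z0 : R) (U0 U1 : R * R -> R),
  1 < p -> 0 < r0 -> Rmax 0 (p - 2) < alpha ->
  0 < z0 -> admissible_profile z0 U0 -> admissible_profile z0 U1 ->
  at_right 0 (fun eps =>
    is_unique_free_solution p_infty r0 U0 U1 eps
      (free_minus U0 U1 r0 eps) (free_plus U0 U1 r0 eps)) /\
  (0 < p - 2 < alpha ->
   exists (eps0 : R) (vm vp : R -> R * R -> C),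
     0 < eps0 <= 1 /\
     (forall eps, 0 < eps <= eps0 ->
        is_unique_nonlinear_solution p_infty a p alpha r0 U0 U1 eps
          (vm eps) (vp eps)) /\
     C1_asymptotics p_infty vm (free_minus U0 U1 r0)
       (fun eps => Rpower eps (Rmin 1 (alpha + 2 - p))) /\
     C1_asymptotics p_infty vp (free_plus U0 U1 r0)
       (fun eps => Rpower eps (Rmin 1 (alpha + 2 - p)))) /\
  (0 < alpha -> 1 < p <= 2 ->
   forall T : R, 0 < T ->
   exists (epsT : R) (vm vp : R -> R * R -> C),
     0 < epsT <= 1 /\
     (forall eps, 0 < eps <= epsT ->
        is_unique_nonlinear_solution T a p alpha r0 U0 U1 eps
          (vm eps) (vp eps)) /\
     (p < 2 ->
        C1_asymptotics T vm (free_minus U0 U1 r0)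
          (fun eps => Rpower eps (Rmin 1 alpha)) /\
        C1_asymptotics T vp (free_plus U0 U1 r0)
          (fun eps => Rpower eps (Rmin 1 alpha))) /\
     (p = 2 ->
        C1_asymptotics T vm (free_minus U0 U1 r0)
          (fun eps => eps + Rpower eps alpha * Rabs (ln eps)) /\
        C1_asymptotics T vp (free_plus U0 U1 r0)
          (fun eps => eps + Rpower eps alpha * Rabs (ln eps)))).
Proof.
  intros a p r0 alpha z0 U0 U1 Hp Hr0 Halpha Hz0 HU0 HU1.
  split; [|split].
  - destruct (initial_data r0 z0 U0 U1 Hr0 Hz0 HU0 HU1) as [e1 [M [He1 [HM Hdata]]]].
    apply (at_right_0_intro _ e1); [lra|]. intros eps Heps.
    destruct (Hdata eps Heps) as [b [b' [c [c' [_ [D2 [_ [_ [_ D6]]]]]]]]].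
    apply (free_unique p_infty r0 eps M U0 U1 c c'); simpl; auto.
  - intros Hpa.
    set (P := fun u => Rpower u (2 - p) / (2 - p)).
    assert (HP : forall u, 0 < u -> is_derive P u (Rpower u (1 - p))).
    { intros u Hu. apply is_derive_power_primitive; lra. }
    (* For p > 2 the weight is integrable at infinity, and L eps^(2-p) is twice the integral of
       u^(1-p) over u >= eps. *)
    set (L := 2 / (p - 2)). assert (HL : 0 < L) by (apply Rdiv_lt_0_compat; lra).
    assert (HE : forall eps, Rpower eps alpha * (L * Rpower eps (2 - p)) = L * Rpower eps (alpha + 2 - p)).
    { intros eps. replace (alpha + 2 - p) with (alpha + (2 - p)) by ring. rewrite Rpower_plus. ring. }
    apply (solution_family p_infty a p alpha r0 z0 U0 U1 (fun _ => 1) (fun eps => L * Rpower eps (2 - p))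
      _ (1 + L) 1); simpl; auto; try lra.
    + intros s t. rewrite Rminus_eq_0, Rabs_R0. apply Rabs_pos.
    + intros s. lra.
    + intros eps x t Heps.
      eapply Rle_trans.
      { apply (weighted_int_le p eps P Hp (proj1 Heps) HP _ x).
        - apply rcont_mult; [apply rcont_const|apply rcont_kap; lra].
        - intros s. assert (G := kap_pos p eps (x - s)). lra. }
      unfold Qint, P, L. assert (G := Rpower_gt_0 (Rabs t + eps) (2 - p)).
      assert (G1 := Rinv_0_lt_compat (p - 2) ltac:(lra)).
      replace (2 * (Rpower (Rabs t + eps) (2 - p) / (2 - p) - Rpower eps (2 - p) / (2 - p)))
        with (2 / (p - 2) * Rpower eps (2 - p) - 2 * (Rpower (Rabs t + eps) (2 - p) * / (p - 2))) by (field; lra).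
      assert (0 <= Rpower (Rabs t + eps) (2 - p) * / (p - 2)) by (apply Rmult_le_pos; lra). lra.
    + intros eps Heps. rewrite HE.
      assert (G1 := Rpower_le_exp eps 1 (Rmin 1 (alpha + 2 - p)) Heps (Rmin_l _ _)).
      assert (G2 := Rpower_le_exp eps (alpha + 2 - p) (Rmin 1 (alpha + 2 - p)) Heps (Rmin_r _ _)).
      rewrite Rpower_1 in G1 by lra. set (X := Rpower eps (Rmin 1 (alpha + 2 - p))) in *.
      assert (0 < X) by apply Rpower_gt_0.
      assert (0 <= L * X) by (apply Rmult_le_pos; lra).
      assert (L * Rpower eps (alpha + 2 - p) <= L * X) by (apply Rmult_le_compat_l; lra). lra.
    + intros d Hd. destruct (Rpower_small (alpha + 2 - p) (d / L)) as [e [He H]]; [lra|apply Rdiv_lt_0_compat; lra|].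
      exists e. split; auto. intros eps Heps. rewrite HE. specialize (H eps Heps).
      apply Rle_trans with (L * (d / L)); [apply Rmult_le_compat_l; lra|]. right. field. lra.
  - intros Ha Hp2 T HT.
    assert (Hchi : forall t, slab T (t, 0) -> cutoff T t = 1).
    { intros t [H1 [H2 _]]; simpl in *. apply cutoff_eq_1. rewrite Rabs_pos_eq; auto. }
    destruct (Rlt_dec p 2) as [Hlt|Hge].
    + set (P := fun u => Rpower u (2 - p) / (2 - p)).
      assert (HP : forall u, 0 < u -> is_derive P u (Rpower u (1 - p))).
      { intros u Hu. apply is_derive_power_primitive; lra. }
      (* For p < 2 the weight is integrable at 0; with eps <= 1 the integral over the support of the
         cutoff is bounded independently of eps. *)
      set (L := 2 * (Rpower (T + 2) (2 - p) / (2 - p))).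
      assert (HL : 0 < L).
      { unfold L. apply Rmult_lt_0_compat; [lra|]. apply Rdiv_lt_0_compat; [apply Rpower_gt_0|lra]. }
      destruct (solution_family T a p alpha r0 z0 U0 U1 (cutoff T) (fun _ => L)
        (fun eps => Rpower eps (Rmin 1 alpha)) (1 + L) 1) as [e0 [vm [vp [X1 [X2 [X3 X4]]]]]];
        simpl; auto using cutoff_lip, cutoff_bounds; try lra.
      * intros eps x t Heps. eapply Rle_trans; [apply (cutoff_integral p eps P); lra || auto|].
        unfold Qint, P, L. apply Rmult_le_compat_l; [lra|].
        assert (G := Rpower_gt_0 eps (2 - p)).
        assert (G0 := Rinv_0_lt_compat (2 - p) ltac:(lra)).
        assert (G1 : Rpower (T + 1 + eps) (2 - p) <= Rpower (T + 2) (2 - p)) by (apply Rle_Rpower_l; lra).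
        unfold Rdiv. rewrite <- Rmult_minus_distr_r. apply Rmult_le_compat_r; lra.
      * intros eps Heps.
        assert (G1 := Rpower_le_exp eps 1 (Rmin 1 alpha) Heps (Rmin_l _ _)).
        assert (G2 := Rpower_le_exp eps alpha (Rmin 1 alpha) Heps (Rmin_r _ _)).
        assert (G3 := Rpower_le_exp eps (alpha + 2 - p) alpha Heps ltac:(lra)).
        rewrite Rpower_1 in G1 by lra. set (X := Rpower eps (Rmin 1 alpha)) in *.
        assert (0 < X) by apply Rpower_gt_0.
        assert (0 <= L * X) by (apply Rmult_le_pos; lra).
        assert (L * Rpower eps alpha <= L * X) by (apply Rmult_le_compat_l; lra). lra.
      * intros d Hd. destruct (Rpower_small alpha (d / L)) as [e [He H]]; [lra|apply Rdiv_lt_0_compat; lra|].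
        exists e. split; auto. intros eps Heps. specialize (H eps Heps).
        apply Rle_trans with (d / L * L); [apply Rmult_le_compat_r; lra|]. right. field. lra.
      * exists e0, vm, vp. split; auto. split; auto. split; [auto|intros; lra].
    + assert (E2 : p = 2) by lra. subst p.
      assert (HP : forall u, 0 < u -> is_derive ln u (Rpower u (1 - 2))).
      { intros u Hu. replace (Rpower u (1 - 2)) with (/ u).
        - now apply is_derive_ln.
        - replace (1 - 2) with (- (1)) by ring. rewrite Rpower_Ropp, Rpower_1; auto. }
      set (L := ln (T + 2) + 1).
      assert (HlT : 0 < ln (T + 2)) by (rewrite <- ln_1; apply ln_increasing; lra).
      assert (HL : 1 < L) by (unfold L; lra).
      assert (HJ : forall eps, 0 < eps <= 1 -> 2 * Qint eps ln (T + 1) <= 2 * (ln (T + 2) + Rabs (ln eps))).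
      { intros eps Heps. unfold Qint. apply Rmult_le_compat_l; [lra|].
        assert (ln (T + 1 + eps) <= ln (T + 2)) by (apply ln_le; lra).
        assert (G := Rle_abs (- ln eps)). rewrite Rabs_Ropp in G. lra. }
      (* Below exp (-1) one has |ln eps| >= 1, so the constant ln (T + 2) and the bare power
         eps^alpha are absorbed by eps^alpha |ln eps|. *)
      destruct (solution_family T a 2 alpha r0 z0 U0 U1 (cutoff T) (fun eps => 2 * (ln (T + 2) + Rabs (ln eps)))
        (fun eps => eps + Rpower eps alpha * Rabs (ln eps)) (2 * L) (exp (- 1))) as [e0 [vm [vp [X1 [X2 [X3 X4]]]]]];
        simpl; auto using cutoff_lip, cutoff_bounds, exp_pos; try lra.
      * intros eps x t Heps. eapply Rle_trans; [apply (cutoff_integral 2 eps ln); lra || auto|].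
        now apply HJ.
      * intros eps Heps.
        assert (Hln : 1 <= Rabs (ln eps)).
        { assert (ln eps <= -1) by (rewrite <- (ln_exp (- 1)); apply ln_le; lra). rewrite Rabs_left; lra. }
        assert (Hra := Rpower_gt_0 eps alpha).
        replace (alpha + 2 - 2) with alpha by ring.
        set (X := Rabs (ln eps)) in *. set (Y := Rpower eps alpha) in *.
        assert (0 <= Y * (X - 1)) by (apply Rmult_le_pos; lra).
        assert (0 <= ln (T + 2) * (Y * (X - 1))) by (apply Rmult_le_pos; lra).
        assert (0 <= L * eps) by (apply Rmult_le_pos; lra).
        assert (1 * eps <= L * eps) by (apply Rmult_le_compat_r; lra).
        assert (0 <= Y * X) by (apply Rmult_le_pos; lra).
        assert (1 * (Y * X) <= L * (Y * X)) by (apply Rmult_le_compat_r; lra).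
        split; [|split]; [unfold L in *; lra|lra|lra].
      * intros d Hd.
        (* One half of the exponent alpha absorbs the logarithm, through |ln eps| <= eps^(-q) / q;
           the other half tends to 0. *)
        set (q := alpha / 2). assert (Hq : 0 < q) by (unfold q; lra).
        set (N := 2 * (ln (T + 2) + / q)).
        assert (Hiq : 0 < / q) by (now apply Rinv_0_lt_compat).
        assert (HN : 0 < N) by (unfold N; lra).
        destruct (Rpower_small q (d / N)) as [e [He H]]; [lra|apply Rdiv_lt_0_compat; lra|].
        exists (Rmin e 1). split; [apply Rmin_pos; lra|]. intros eps Heps.
        assert (Le := Rmin_l e 1). assert (L1 := Rmin_r e 1).
        specialize (H eps ltac:(lra)).
        assert (Gl := ln_bound q eps Hq ltac:(lra)).
        assert (G1 : 1 <= Rpower eps (- q)).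
        { replace 1 with (Rpower eps 0) at 1 by (apply Rpower_O; lra). apply Rpower_le_exp; lra. }
        assert (Ga : Rpower eps alpha = Rpower eps q * Rpower eps q).
        { rewrite <- Rpower_plus. f_equal. unfold q; field. }
        assert (Gi : Rpower eps q * Rpower eps (- q) = 1).
        { rewrite <- Rpower_plus. replace (q + - q) with 0 by ring. apply Rpower_O; lra. }
        assert (Gq := Rpower_gt_0 eps q).
        assert (G2 : 2 * (ln (T + 2) + Rabs (ln eps)) <= N * Rpower eps (- q)).
        { unfold N. assert (ln (T + 2) * 1 <= ln (T + 2) * Rpower eps (- q)) by (apply Rmult_le_compat_l; lra). lra. }
        apply Rle_trans with (Rpower eps alpha * (N * Rpower eps (- q))).
        { apply Rmult_le_compat_l; [left; apply Rpower_gt_0|auto]. }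
        rewrite Ga. replace (Rpower eps q * Rpower eps q * (N * Rpower eps (- q)))
          with (N * Rpower eps q * (Rpower eps q * Rpower eps (- q))) by ring.
        rewrite Gi, Rmult_1_r.
        apply Rle_trans with (N * (d / N)); [apply Rmult_le_compat_l; lra|]. right. field. lra.
      * exists e0, vm, vp. split; auto. split; auto. split; [intros; lra|auto].
Qed.
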